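(* Fix $n\in\mathbb N$ and a normed space $\mathbf X=(\mathbb R^n,\|\cdot\|_{\mathbf X})$. Suppose that $B_{\mathbf X}$ is a polytope that has exactly $\rho n$ vertices (note that necessarily $\rho\ge 2$, since $B_{\mathbf X}$ is origin-symmetric). Then $$\mathsf{SEP}(\mathbf X)\gtrsim \frac{n}{\sqrt{\log\rho}}.$$ Moreover, this bound cannot be improved in general.
   Context: $B_{\mathbf X}=\{x\in\mathbb R^n:\ \|x\|_{\mathbf X}\le 1\}$ is the closed unit ball of $\mathbf X$. For $a,b>0$, the notation $a\gtrsim b$ means that $a\ge cb$ for some universal constant $c>0$ (in particular, $c$ does not depend on $n$, $\rho$ or $\mathbf X$). Separation modulus: a random partition $\mathscr P$ of a metric space $(\mathcal M,d_{\mathcal M})$ consists of a probability space $(\Omega,\mathbf{Prob})$ and set-valued mappings $\Gamma^k:\Omega\to2^{\mathcal M}$, $k\in\mathbb N$, such that $\mathscr P^\omega=\{\Gamma^k(\omega)\}_{k=1}^\infty$ is a partition of $\mathcal M$ for every $\omega\in\Omega$ (empty clusters are allowed) and each $\Gamma^k$ is strongly measurable, i.e., $\{\omega\in\Omega:\ E\cap\Gamma^k(\omega)\neq\emptyset\}$ is $\mathbf{Prob}$-measurable for every closed $E\subseteq\mathcal M$. $\mathscr P(x)$ denotes the cluster containing $x$. $\mathscr P$ is $\Delta$-bounded if every cluster of $\mathscr P^\omega$ has $d_{\mathcal M}$-diameter at most $\Delta$, for every $\omega\in\Omega$. A $\Delta$-bounded $\mathscr P$ is $\sigma$-separating if $\mathbf{Prob}[\mathscr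 P(x)\ne\mathscr P(y)]\le\frac{\sigma}{\Delta}d_{\mathcal M}(x,y)$ for all $x,y\in\mathcal M$. $\mathsf{SEP}(\mathcal M)$ is the infimum over those $\sigma>0$ such that for every $\Delta>0$ there is a $\sigma$-separating $\Delta$-bounded random partition of $\mathcal M$ ($\infty$ if there is no such $\sigma$). For a normed space it refers to the metric induced by the norm. *)

(* Defs.v *)
From HB Require Import structures.
From mathcomp Require Import all_boot all_order all_algebra.
From mathcomp Require Import all_classical all_reals all_analysis.

Set Implicit Arguments.
Unset Strict Implicit.
Unset Printing Implicit Defensive.

Import Order.TTheory GRing.Theory Num.Theory.
Import numFieldNormedType.Exports.

Local Open Scope classical_set_scope.
Local Open Scope ring_scope.

Record norm_on (R : realType) (n : nat) := NormOn {
  norm_fun :> 'rV[R]_n -> R ;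
  norm_triangle : forall x y, norm_fun (x + y) <= norm_fun x + norm_fun y ;
  norm_homogeneous : forall (a : R) x, norm_fun (a *: x) = `|a| * norm_fun x ;
  norm_definite : forall x, norm_fun x = 0 -> x = 0
}.

(* (R^n, N): an alias of ['rV[R]_n], whose canonical norm and topology are
   those of N and not the sup-norm ones attached to ['rV[R]_n]. *)
Definition normed_space (R : realType) (n : nat) (N : norm_on R n) : Type :=
  'rV[R]_n.

HB.instance Definition _ (R : realType) (n : nat) (N : norm_on R n) :=
  GRing.Lmodule.copy (normed_space N) 'rV[R]_n.

HB.instance Definition _ (R : realType) (n : nat) (N : norm_on R n) :=
  @Lmodule_isNormed.Build R (normed_space N) (norm_fun N)
    (@norm_triangle R n N) (@norm_homogeneous R n N) (@norm_definite R n N).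

Section normed_space_metric.
Context (R : realType) (n : nat) (N : norm_on R n).
Let dist (x y : normed_space N) : R := `|x - y|.

Let dist_ge0 x y : 0 <= dist x y. Proof. exact: normr_ge0. Qed.

Let dist_positivity x y : dist x y = 0 -> x = y.
Proof. by move/normr0_eq0/eqP; rewrite subr_eq0 => /eqP. Qed.

Let ballEdist x e : ball x e = [set y | dist x y < e].
Proof. by rewrite -ball_normE. Qed.

HB.instance Definition _ := @PseudoMetric_isMetric.Build R (normed_space N)
  dist dist_ge0 dist_positivity ballEdist.
End normed_space_metric.

Definition unit_ball (R : realType) (V : normedModType R) : set V :=
  [set x | `|x| <= 1].

Definition convex_hull (R : realType) (V : lmodType R) (A : set V) : set V :=
  smallest (@convex_set R V) A.

Definition is_polytope (R : realType) (V : lmodType R) (P : set V) : Prop :=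
  exists2 F : set V, finite_set F & P = convex_hull F.

(* The vertices of a polytope are its extreme points. *)
Definition vertices (R : realType) (V : lmodType R) (P : set V) : set V :=
  [set x | P x /\ forall (y z : V) (t : R), P y -> P z -> 0 < t < 1 ->
    x = t *: y + (1 - t) *: z -> y = x /\ z = x].

Definition strongly_measurable (d : measure_display) (Omega : measurableType d)
    (M : topologicalType) (Gamma : Omega -> set M) : Prop :=
  forall E : set M, closed E -> measurable [set w | E `&` Gamma w !=set0].

(* The library's [partition] is not used: it forbids empty clusters. *)
Definition random_partition (d : measure_display) (Omega : measurableType d)
    (M : topologicalType) (Gamma : nat -> Omega -> set M) : Prop :=
  (forall k, strongly_measurable (Gamma k)) /\
  (forall w, cover setT (Gamma ^~ w) = setT /\ trivIset setT (Gamma ^~ w)).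

(* When the [Gamma k w] partition M, this is the only one that contains x. *)
Definition cluster_of (Omega M : Type) (Gamma : nat -> Omega -> set M)
    (w : Omega) (x : M) : set M :=
  \bigcup_(k in [set k | Gamma k w x]) Gamma k w.

(* Equal to -oo on the empty set. *)
Definition diameter (R : realType) (M : metricType R) (A : set M) : \bar R :=
  ereal_sup [set (mdist x y)%:E | x in A & y in A].

Definition bounded_partition (R : realType) (Omega : Type) (M : metricType R)
    (Gamma : nat -> Omega -> set M) (Delta : R) : Prop :=
  forall w k, (diameter (Gamma k w) <= Delta%:E)%E.

(* [random_partition] makes the event below measurable. *)
Definition separating (R : realType) (d : measure_display)
    (Omega : measurableType d) (P : probability Omega R) (M : metricType R)
    (Gamma : nat -> Omega -> set M) (Delta sigma : R) : Prop :=
  forall x y : M,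
    (P [set w | cluster_of Gamma w x <> cluster_of Gamma w y]
     <= (sigma / Delta * mdist x y)%:E)%E.

Definition admits_separating (R : realType) (M : metricType R)
    (Delta sigma : R) : Prop :=
  exists (d : measure_display) (Omega : measurableType d)
    (P : probability Omega R) (Gamma : nat -> Omega -> set M),
    [/\ random_partition Gamma, bounded_partition Gamma Delta &
        separating P Gamma Delta sigma].

(* The infimum of the empty set is +oo. *)
Definition SEP (R : realType) (M : metricType R) : \bar R :=
  ereal_inf [set sigma%:E | sigma in
    [set sigma : R | 0 < sigma /\
       forall Delta : R, 0 < Delta -> admits_separating M Delta sigma]].

(* Main.v *)
Require Import Defs.
From HB Require Import structures.
From mathcomp Require Import all_boot all_order all_algebra.
From mathcomp Require Import all_classical all_reals all_analysis.
From mathcomp Require Import fingroup perm measurable_realfun ring lra zify.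
Import Order.TTheory GRing.Theory Num.Theory.
Import numFieldNormedType.Exports.
Set Implicit Arguments.
Unset Strict Implicit.
Unset Printing Implicit Defensive.
Local Open Scope classical_set_scope.
Local Open Scope ring_scope.

(** Lower bound.  Fix a lattice whose generators have X-norm at most 1, and a
    partition of the space into clusters of X-diameter at most Delta.  If every
    cluster contains at most K^n lattice points, then a counting argument on
    large boxes (grid_boundary) shows that, on average over the lattice points,
    at least n/K of the n edges in the positive coordinate directions join
    different clusters.  Since such an edge is cut with probability at most
    sigma/Delta, it follows that sigma >= Delta/K (grid_separation).  It remains
    to find a lattice for which K is a universal constant when
    Delta = n / sqrt(8 ln rho).

    The generators are n of the vertices of the unit ball B.  Among all families
    of 2n vertices, with repetitions, take one that maximises the determinant of
    the sum M of the matrices a^T a.  Its optimality says that all the vertices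
    have norm at most 1 for the inner product x M^-1 y^T, while M = sum a^T a
    makes the family a tight frame whose squared norms add up to n
    (spanning_frame, design_frame, design_trace): this is a discrete substitute
    for an ellipsoid in John's position.  A greedy Gram-Schmidt process on such
    a frame (greedy_triangular) selects n vertices for which the squares of the
    diagonal coefficients are at least (n - i) / (2n), so that the lattice that
    they generate has at most e^(6n) points in a Euclidean ball of radius
    sqrt n (card_ellipsoid_le, prod_triangular_le).  Finally Delta B is covered
    by e^(6n) such balls (hull_net): by the empirical method of Maurey, each
    point of B is within 2 / sqrt s of the average of s vertices, and for
    s = n / ln rho there are at most e^(6n) multisets of s vertices.  Together
    these give K = e^12 (lattice_cluster_card).

    Sharpness.  Let m be comparable to ln rho, and let Y be the l_1 sum of about
    n / m Euclidean spaces of dimension m.  A 1-net of the unit sphere of R^m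
    has e^(O(m)) points, so that there are sets of exactly k points on the
    spheres of the blocks of Y (exists_vertex_set) whose convex hull is the unit
    ball of a norm X with Y <= X <= 5 Y (lower_le_gauge, gauge_le_bnorm).  All
    these points are vertices because they are extreme already in the unit ball
    of Y (sphere_point_extreme).  For the partition, carve R^m by balls of a
    common random radius of order m^2, centred at the integer points and taken
    in a random order.  Two points at distance d <= 1 are separated with
    probability at most 7 m^(-3/2) d (exists_good_radius).  Apply the same
    random partition to each of the n / m blocks: in the scale in which the
    diameter is of order (n / m) m^2, the union bound loses nothing because the
    norm of Y is the sum of the norms of the blocks.  The modulus of separation is
    at most of order (n / m) sqrt m, that is n / sqrt (ln rho) (block_admits). *)

(** * Edge boundaries of partitions of a grid *)

Section isoperimetry.
Variables (R : realType) (n L : nat) (T : eqType).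
Let G := {ffun 'I_n -> 'I_L}.
Variable kap : G -> T.

Definition same_prefix (i : nat) (z z' : G) : bool :=
  (kap z' == kap z) && [forall j : 'I_n, (j < i)%N ==> (z' j == z j)].

Definition same_fiber (i : 'I_n) (z z' : G) : bool :=
  (kap z' == kap z) && [forall j : 'I_n, (j != i) ==> (z' j == z j)].

(** When z is uniform given its colour, the ratio of prefix_card at i.+1 to
    prefix_card at i is the conditional probability of the i-th coordinate
    of z given the previous ones, whereas the mean of ln (fiber_card) is the
    smaller conditional entropy given all the other coordinates. *)
Definition prefix_card i z : nat := #|[pred z' | same_prefix i z z']|.
Definition fiber_card i z : nat := #|[pred z' | same_fiber i z z']|.

Lemma same_prefixP i z z' :
  reflect (kap z' = kap z /\ forall j : 'I_n, (j < i)%N -> z' j = z j)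
    (same_prefix i z z').
Proof.
apply: (iffP andP) => [[/eqP -> /forallP h]|[-> h]]; split=> //.
  by move=> j ji; apply/eqP; move: (h j); rewrite ji.
by apply/forallP => j; apply/implyP => /h ->.
Qed.

Lemma same_fiberP i z z' :
  reflect (kap z' = kap z /\ forall j : 'I_n, j != i -> z' j = z j)
    (same_fiber i z z').
Proof.
apply: (iffP andP) => [[/eqP -> /forallP h]|[-> h]]; split=> //.
  by move=> j ji; apply/eqP; move: (h j); rewrite ji.
by apply/forallP => j; apply/implyP => /h ->.
Qed.

Lemma same_prefix_refl i z : same_prefix i z z.
Proof. by apply/same_prefixP. Qed.

Lemma same_fiber_refl i z : same_fiber i z z.
Proof. by apply/same_fiberP. Qed.

Lemma prefix_card_gt0 i z : (0 < prefix_card i z)%N.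
Proof. by apply/card_gt0P; exists z; rewrite inE same_prefix_refl. Qed.

Lemma fiber_card_gt0 i z : (0 < fiber_card i z)%N.
Proof. by apply/card_gt0P; exists z; rewrite inE same_fiber_refl. Qed.

Lemma eq_prefix_card i z z' :
  same_prefix i z z' -> prefix_card i z = prefix_card i z'.
Proof.
move=> /same_prefixP [k h]; apply: eq_card => w; rewrite !inE.
by apply/same_prefixP/same_prefixP => -[k1 h1]; split; rewrite ?k1 ?k //
  => j ji; rewrite h1 // h.
Qed.

Lemma eq_fiber_card i z z' :
  same_fiber i z z' -> fiber_card i z = fiber_card i z'.
Proof.
move=> /same_fiberP [k h]; apply: eq_card => w; rewrite !inE.
by apply/same_fiberP/same_fiberP => -[k1 h1]; split; rewrite ?k1 ?k //
  => j ji; rewrite h1 // h.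
Qed.

Lemma same_fiber_sym i z z' : same_fiber i z z' = same_fiber i z' z.
Proof.
by apply/same_fiberP/same_fiberP => -[k h]; split=> // j /h ->.
Qed.

Lemma prefix_card0 z : prefix_card 0 z = #|[pred z' | kap z' == kap z]|.
Proof.
apply: eq_card => w; rewrite !inE; apply/same_prefixP/eqP => [[]//|->].
by split.
Qed.

Lemma prefix_card_full z : prefix_card n z = 1%N.
Proof.
rewrite -(card1 z); apply: eq_card => w; rewrite !inE.
apply/same_prefixP/eqP => [[_ h]|->//]; apply/ffunP => j; exact: h.
Qed.

(** Double counting.  For z' a fiber neighbour of z and z'' agreeing with z up
    to coordinate i included, the pair (z', z'') determines z: coordinate i is
    that of z'' and the others are those of z'.  Moreover z'' agrees with z'
    before coordinate i, so that each z' occurs with at most prefix_card i z'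
    points z'', which the weight compensates. *)
Lemma sum_fiber_prefix (i : 'I_n) :
  \sum_z ((fiber_card i z)%:R * (prefix_card i.+1 z)%:R / (prefix_card i z)%:R)
    <= #|G|%:R :> R.
Proof.
have -> : \sum_z ((fiber_card i z)%:R * (prefix_card i.+1 z)%:R
                    / (prefix_card i z)%:R)
        = \sum_z' \sum_z'' \sum_(z | same_fiber i z z' && same_prefix i.+1 z z'')
             (prefix_card i z')%:R^-1 :> R.
  under [RHS]eq_bigr => z' _ do under eq_bigr => z'' _ do rewrite big_mkcond.
  under [RHS]eq_bigr => z' _ do rewrite exchange_big.
  rewrite exchange_big; apply: eq_bigr => z _ /=.
  rewrite /fiber_card -sum1_card natr_sum mulr_suml mulr_suml big_mkcond /=.
  apply: eq_bigr => z' _; rewrite inE; case: ifPn => fz; last first.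
    by rewrite big1.
  rewrite mul1r /prefix_card -sum1_card natr_sum mulr_suml big_mkcond /=.
  apply: eq_bigr => z'' _; rewrite inE; case: ifP => // _; rewrite mul1r.
  congr (_%:R^-1); apply: eq_prefix_card; apply/same_prefixP.
  have /same_fiberP [k h] := fz; split=> // j ji; apply: h.
  by rewrite -val_eqE /= ltn_eqF.
apply: (@le_trans _ _ (\sum_z' \sum_(z'' | same_prefix i z' z'')
    (prefix_card i z')%:R^-1)); last first.
  rewrite (eq_bigr (fun=> 1)) ?sumr_const ?cardT// => z' _.
  rewrite sumr_const -[LHS]mulr_natr; apply: mulVf.
  by rewrite pnatr_eq0 -lt0n prefix_card_gt0.
apply: ler_sum => z' _; rewrite [leRHS]big_mkcond; apply: ler_sum => z'' _ /=.
(* w is the only candidate for z. *)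
pose w : G := [ffun j => if j == i then z'' j else z' j].
rewrite (eq_bigl (fun z => (z == w) && same_fiber i z z' && same_prefix i.+1 z z''));
  last first.
  move=> z; apply/idP/idP => [/andP[h1 h2]|/andP[/andP[_ ->] ->] //].
  rewrite h1 h2 !andbT; apply/eqP/ffunP => j; rewrite ffunE.
  have /same_fiberP [_ h] := h1; have /same_prefixP [_ h'] := h2.
  by case: eqP => [->|/eqP ji]; rewrite ?h ?h'.
case: ifPn => [_|np].
  rewrite big_mkcond (bigD1 w) //= big1 => [|z /negbTE ->//].
  by rewrite addr0; case: ifP => // _; rewrite invr_ge0.
rewrite big1 // => z /andP[/andP[_ h1] h2]; case/negP: np.
have /same_fiberP [k h] := h1; have /same_prefixP [k' h'] := h2.
apply/same_prefixP; split; first by rewrite k' k.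
move=> j ji; rewrite h' ?ltnS 1?ltnW// h //.
by rewrite -val_eqE /= ltn_eqF.
Qed.

Lemma ln_le_subr1 (x : R) : 0 < x -> ln x <= x - 1.
Proof.
by move=> x0; rewrite -[in leLHS](subrK 1 x) addrC le_ln1Dx // ltrBrDl subrr.
Qed.

(** An entropy form of the Loomis-Whitney inequality: by the chain rule, the
    logarithm of the size of a colour class is the sum over i of the
    logarithms of the ratios of successive prefix_card, and each term
    dominates on average the logarithm of fiber_card, by the previous lemma
    and ln x <= x - 1. *)
Lemma sum_ln_fiber_card :
  \sum_(i < n) \sum_z ln (fiber_card i z)%:R
    <= \sum_z ln (#|[pred z' | kap z' == kap z]|%:R) :> R.
Proof.
pose N i z : R := (prefix_card i z)%:R.
have N0 i z : 0 < N i z by rewrite ltr0n prefix_card_gt0.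
have F0 (i : 'I_n) z : 0 < (fiber_card i z)%:R :> R by rewrite ltr0n fiber_card_gt0.
have step (i : 'I_n) : \sum_z ln (fiber_card i z)%:R
      <= \sum_z (ln (N i z) - ln (N i.+1 z)).
  rewrite -subr_le0 -sumrB.
  apply: (@le_trans _ _ (\sum_z ((fiber_card i z)%:R * N i.+1 z / N i z - 1))).
    apply: ler_sum => z _.
    have := @ln_le_subr1 _ (divr_gt0 (mulr_gt0 (F0 i z) (N0 i.+1 z)) (N0 i z)).
    by rewrite ln_div ?posrE ?mulr_gt0 // lnM ?posrE //; lra.
  rewrite sumrB sumr_const subr_le0; apply: le_trans (sum_fiber_prefix i) _.
  by rewrite cardT.
apply: le_trans (ler_sum _ (fun i _ => step i)) _.
rewrite exchange_big /=; apply: ler_sum => z _.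
have -> : \sum_(i < n) (ln (N i z) - ln (N i.+1 z)) = ln (N 0%N z) - ln (N n z).
  rewrite -(big_mkord xpredT (fun i => ln (N i z) - ln (N i.+1 z))).
  rewrite (eq_bigr (fun i => - (ln (N i.+1 z) - ln (N i z)))) => [|i _]; last by rewrite opprB.
  by rewrite sumrN telescope_sumr // opprB.
by rewrite /N prefix_card_full ln1 subr0 prefix_card0.
Qed.

(** The tangent inequality ln l >= 1 + ln K - K / l turns the bound on the mean
    of ln (fiber_card) into one on the mean of 1 / fiber_card, which counts the
    ends of the fibers. *)
Lemma sum_inv_fiber_card (K : R) : 0 < K ->
  (forall z, #|[pred z' | kap z' == kap z]|%:R <= K ^+ n) ->
  n%:R * #|G|%:R <= K * \sum_(i < n) \sum_z (fiber_card i z)%:R^-1.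
Proof.
move=> K0 Kb.
have h1 : \sum_z ln (#|[pred z' | kap z' == kap z]|%:R) <= #|G|%:R * (n%:R * ln K).
  rewrite [leRHS](_ : _ = \sum_(z : G) (ln (K ^+ n))); last first.
    by rewrite sumr_const lnXn // -(mulr_natl (ln K)) -[RHS]mulr_natl.
  apply: ler_sum => z _; rewrite ler_ln ?posrE ?exprn_gt0 //.
  by rewrite ltr0n; apply/card_gt0P; exists z; rewrite inE.
have h2 : \sum_(i < n) \sum_(z : G) (1 + ln K - K * (fiber_card i z)%:R^-1)
    <= \sum_(i < n) \sum_z ln (fiber_card i z)%:R.
  apply: ler_sum => i _; apply: ler_sum => z _.
  have f0 : 0 < (fiber_card i z)%:R :> R by rewrite ltr0n fiber_card_gt0.
  have := @ln_le_subr1 (K / (fiber_card i z)%:R) (divr_gt0 K0 f0).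
  by rewrite ln_div ?posrE//; lra.
have := le_trans h2 (le_trans sum_ln_fiber_card h1).
under eq_bigr => i _ do rewrite sumrB sumr_const -mulr_sumr.
rewrite sumrB sumr_const -mulr_sumr card_ord.
rewrite -[(_ + _) *+ _ *+ _]mulr_natl -[(_ + _) *+ _]mulr_natl /=.
have -> : #|{: G}| = #|G| by [].
lra.
Qed.

Definition fiber_end i z : bool :=
  [forall z', same_fiber i z z' ==> (z' i <= z i)%N].

(** Each fiber has a last point, and gives total weight 1 to its points. *)
Lemma sum_inv_fiber_card_le i :
  \sum_z (fiber_card i z)%:R^-1 <= (#|[pred z | fiber_end i z]|)%:R :> R.
Proof.
have end_ex z : exists2 z', same_fiber i z z' & fiber_end i z'.
  have [z' zz' max] := @arg_maxnP _ z (same_fiber i z) (fun w => w i : nat) (same_fiber_refl i z).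
  exists z' => //; apply/forallP => w; apply/implyP => z'w; apply: max.
  move: zz' z'w => /same_fiberP[k h] /same_fiberP[k' h'].
  by apply/same_fiberP; split; rewrite ?k' ?k // => j ji; rewrite h' ?h.
apply: (@le_trans _ _ (\sum_z \sum_(z' | same_fiber i z z' && fiber_end i z')
    (fiber_card i z')%:R^-1)).
  apply: ler_sum => z _; have [z' zz' ez'] := end_ex z.
  rewrite (bigD1 z') ?zz' //= (eq_fiber_card zz') lerDl; apply: sumr_ge0 => w _.
  by rewrite invr_ge0.
under eq_bigr => z _ do rewrite big_mkcond.
rewrite exchange_big /= -sum1_card natr_sum [leRHS]big_mkcond /=.
apply: ler_sum => z' _; rewrite inE; case: ifP => ez'; last first.
  by rewrite big1 // => z _; rewrite andbF.
under eq_bigr => z _ do rewrite andbT same_fiber_sym.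
rewrite -big_mkcond sumr_const -[leLHS]mulr_natr.
by rewrite [leLHS](_ : _ = 1) //; apply: mulVf; rewrite pnatr_eq0 -lt0n fiber_card_gt0.
Qed.
End isoperimetry.

Section grid_boundary.
Variables (R : realType) (n L : nat) (T : eqType).
Let G := {ffun 'I_n -> 'I_L.+1}.
Variable kap : G -> T.

Definition grid_succ (i : 'I_n) (z : G) : G :=
  [ffun j => if j == i then inord (z i).+1 else z j].

Lemma card_grid_last (i : 'I_n) :
  (#|[pred z : G | z i == ord_max]| * L.+1 <= #|G|)%N.
Proof.
pose f (p : G * 'I_L.+1) : G := [ffun j => if j == i then p.2 else p.1 j].
rewrite -[X in (_ * X)%N]card_ord -cardX.
rewrite -(@card_in_imset _ _ f); first exact: max_card.
move=> [z a] [w b] /=; rewrite !inE /= => /andP[/eqP zi _] /andP[/eqP wi _] /ffunP fE.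
have := fE i; rewrite !ffunE eqxx /= => <-; congr pair.
apply/ffunP => j; have := fE j; rewrite !ffunE /=.
by case: eqP => [->|//]; rewrite zi wi.
Qed.

(** Going one step beyond the last point of a fiber changes the colour, unless
    this leaves the grid; the latter happens for a proportion 1 / L.+1 of the
    points in each direction. *)
Lemma grid_boundary (K : R) : 0 < K ->
  (forall z, #|[pred z' | kap z' == kap z]|%:R <= K ^+ n) ->
  n%:R * #|G|%:R * (K^-1 - L.+1%:R^-1) <=
  \sum_(i < n) \sum_(z : G) (((z i).+1 < L.+1)%N && (kap (grid_succ i z) != kap z))%:R.
Proof.
move=> K0 /(sum_inv_fiber_card K0) h.
have e i : (#|[pred z | fiber_end kap i z]|)%:R <=
   \sum_(z : G) (((z i).+1 < L.+1)%N && (kap (grid_succ i z) != kap z))%:R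
   + #|[pred z : G | z i == ord_max]|%:R :> R.
  rewrite -!sum1_card !natr_sum !(big_mkcond (fun z => z \in _)) /= -big_split /=.
  apply: ler_sum => z _; rewrite !inE; case: ifPn => [|_]; last first.
    by apply: addr_ge0; rewrite ?ler0n //; case: ifP.
  move=> /forallP ez; case: ifPn => [|zm]; first by rewrite lerDr.
  rewrite addr0 ltnS.
  have zL : (z i < L)%N.
    by rewrite ltn_neqAle -ltnS ltn_ord andbT; apply: contra zm => /eqP zi; exact/eqP/val_inj.
  rewrite zL /= (_ : kap (grid_succ i z) != kap z) //.
  apply/negP => /eqP kz; have := ez (grid_succ i z).
  rewrite ffunE eqxx inordK ?ltnS // ltnn implybF => /negP; apply.
  by apply/same_fiberP; split=> // j /negbTE ji; rewrite ffunE ji.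
have b (i : 'I_n) : #|[pred z : G | z i == ord_max]|%:R <= #|G|%:R * L.+1%:R^-1 :> R.
  by rewrite ler_pdivlMr ?ltr0n // -natrM ler_nat card_grid_last.
rewrite mulrBr lerBlDr; apply: (@le_trans _ _ (\sum_(i < n) \sum_z (fiber_card kap i z)%:R^-1)).
  by rewrite ler_pdivrMr // (mulrC _ K).
rewrite [X in _ + X](_ : _ = \sum_(i < n) (#|G|%:R * L.+1%:R^-1)); last first.
  by rewrite sumr_const card_ord -[RHS]mulr_natl mulrA.
rewrite -big_split /=; apply: ler_sum => i _.
apply: le_trans (sum_inv_fiber_card_le _ _ _) (le_trans (e i) _).
by rewrite lerD2l.
Qed.
End grid_boundary.

(** * Lattice points in ellipsoids *)
Section lattice_count.
Variables (R : realType) (n : nat).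

Lemma sum_geometric_le (a : R) (B : nat) : 0 < a ->
  \sum_(m < B) (1 + a) ^- m <= (1 + a) / a.
Proof.
move=> a0; have a1 : 0 < 1 + a by rewrite addr_gt0.
suff -> : \sum_(m < B) (1 + a) ^- m = (1 + a) / a * (1 - (1 + a) ^- B).
  rewrite ger_pMr ?divr_gt0 // gerBl invr_ge0 exprn_ge0 // ltW //.
elim: B => [|B IH]; first by rewrite big_ord0 expr0 invr1 subrr mulr0.
rewrite big_ord_recr /= {}IH exprS; field.
by rewrite !gt_eqF ?exprn_gt0.
Qed.

(** Exponential weights: every point of A has weight at least e^(-3n) for the
    product weight with factors (1 + a_i)^(-|t_i|), because
    a |t| <= 1 + |u| <= 2 + u^2, whereas the sum of the weights over all the
    integer points is a product of geometric series.  The bound does not depend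
    on the region in which t takes its values, which may be shifted and sheared. *)
Lemma card_lattice_le (E : finType) (A : {pred E}) (a : 'I_n -> R)
    (t : E -> 'I_n -> int) (u : E -> 'I_n -> R) :
  (forall i, 0 < a i <= 1) ->
  {in A &, forall x y, t x =1 t y -> x = y} ->
  (forall x i, x \in A -> a i * `|(t x i)%:~R| <= 1 + `|u x i|) ->
  (forall x, x \in A -> \sum_i u x i ^+ 2 <= n%:R) ->
  #|A|%:R <= expR (3 * n%:R) * \prod_i (4 / a i).
Proof.
move=> a01 tinj tu un.
pose B := (\max_(x : E) \max_(i < n) `|t x i|%N)%N.
have tB x i : (`|t x i| < B.+1)%N.
  rewrite ltnS; apply: (@leq_trans (\max_(j < n) `|t x j|%N)).
    exact: (leq_bigmax_cond (F := fun j => `|t x j|%N)).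
  exact: (leq_bigmax_cond (F := fun y => \max_(j < n) `|t y j|%N)%N).
pose W (f : {ffun 'I_n -> 'I_B.+1 * bool}) : R := \prod_i (1 + a i) ^- (f i).1.
pose phi (x : E) : {ffun 'I_n -> 'I_B.+1 * bool} := [ffun i => (Ordinal (tB x i), (t x i < 0))].
have a1 i : 0 < 1 + a i by rewrite addr_gt0 //; case/andP: (a01 i).
have W0 f : 0 <= W f.
  by apply: prodr_ge0 => i _; rewrite invr_ge0 exprn_ge0 // ltW.
have phi_inj : {in A &, injective phi}.
  move=> x y xA yA /ffunP e; apply: tinj => // i.
  have := e i; rewrite !ffunE => -[e1 e2].
  by rewrite (intEsign (t x i)) (intEsign (t y i)) e1 e2.
have lower x : x \in A -> expR (- (3 * n%:R)) <= W (phi x).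
  move=> xA; rewrite /W.
  apply: (@le_trans _ _ (\prod_i expR (- (a i * `|(t x i)%:~R|)))).
    rewrite -expR_sum ler_expR lerNl -sumrN.
    apply: (@le_trans _ _ (\sum_(i < n) (2 + u x i ^+ 2))).
      apply: ler_sum => i _; rewrite opprK.
      apply: le_trans (tu _ _ xA) _.
      have := sqr_ge0 (`|u x i| - 1); rewrite -(real_normK (num_real (u x i))); nra.
    rewrite big_split /= sumr_const card_ord -mulr_natl.
    have := un x xA; lra.
  apply: ler_prod => i _; rewrite expR_ge0 /= ffunE /= expRN.
  rewrite lef_pV2 ?posrE ?expR_gt0 ?exprn_gt0 //.
  rewrite (_ : `|(t x i)%:~R| = (`|t x i|%N)%:R :> R); last by rewrite -intr_norm -abszE.
  rewrite (mulrC (a i)) expRM_natl.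
  by rewrite lerXn2r ?nnegrE ?expR_ge0 ?expR_ge1Dx ?ltW.
have upper : \sum_f W f <= \prod_i (4 / a i).
  rewrite /W -(bigA_distr_bigA (fun i (p : 'I_B.+1 * bool) => (1 + a i) ^- p.1)) /=.
  apply: ler_prod => i _; have /andP[ai0 ai1] := a01 i.
  rewrite sumr_ge0 => [|p _]; last by rewrite invr_ge0 exprn_ge0 // ltW.
  rewrite -(pair_bigA _ (fun (m : 'I_B.+1) (_ : bool) => (1 + a i) ^- m)) /=.
  under eq_bigr => m _ do rewrite sumr_const card_bool.
  rewrite sumrMnl; have h := @sum_geometric_le (a i) B.+1 ai0.
  apply: (@le_trans _ _ (((1 + a i) / a i) *+ 2)); first by rewrite lerMn2r h orbT.
  rewrite -mulr_natl mulrA ler_pM2r ?invr_gt0 //; lra.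
have key : #|A|%:R * expR (- (3 * n%:R)) <= \prod_i (4 / a i).
  apply: le_trans upper; rewrite -sum1_card natr_sum mulr_suml.
  apply: (@le_trans _ _ (\sum_(x in A) W (phi x))).
    by apply: ler_sum => x xA; rewrite mul1r lower.
  rewrite -(big_imset W phi_inj) [leRHS](bigID (mem (phi @: A))) /= lerDl.
  by apply: sumr_ge0.
by move: key; rewrite expRN ler_pdivrMr ?expR_gt0 // mulrC.
Qed.

(** In triangular coordinates, floor (tl z i) depends only on the coordinates of
    z after the i-th.  Hence adding it to z i is injective, and it makes the
    i-th linear form c_i(z) - d_i differ from c_ii times an integer by at most
    c_ii <= 1. *)
Lemma card_ellipsoid_le (L : nat) (c : 'I_n -> 'I_n -> R) (d : 'I_n -> R) :
  (forall i j : 'I_n, (j < i)%N -> c i j = 0) ->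
  (forall i, 0 < c i i <= 1) ->
  #|[pred z : {ffun 'I_n -> 'I_L} |
      \sum_i (\sum_j c i j * (z j)%:R - d i) ^+ 2 <= n%:R]|%:R
  <= expR (3 * n%:R) * \prod_i (4 / c i i) :> R.
Proof.
move=> tri c01.
pose tl (z : {ffun 'I_n -> 'I_L}) (i : 'I_n) : R := (\sum_(j : 'I_n | (i < j)%N) c i j * (z j)%:R - d i) / c i i.
have sumE (z : {ffun 'I_n -> 'I_L}) (i : 'I_n) : \sum_j c i j * (z j)%:R - d i = c i i * ((z i)%:R + tl z i).
  rewrite (bigD1 i) //= mulrDr /tl mulrC.
  rewrite (mulrC _ (_ / _)) divfK ?gt_eqF //; last by case/andP: (c01 i).
  rewrite -addrA mulrC; congr (_ + (_ - _)).
  rewrite (bigID (fun j : 'I_n => i < j)%N) /= [X in _ + X]big1 ?addr0.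
    apply: eq_bigl => j; rewrite -val_eqE /=; lia.
  move=> j /andP[ji]; rewrite -leqNgt leq_eqVlt => /orP[/eqP /val_inj e|/tri ->].
    by rewrite e eqxx in ji.
  by rewrite mul0r.
apply: (@card_lattice_le _ _ (fun i => c i i)
  (fun (z : {ffun 'I_n -> 'I_L}) i => (z i)%:Z + Num.floor (tl z i))
  (fun (z : {ffun 'I_n -> 'I_L}) i => \sum_j c i j * (z j)%:R - d i)) => //.
- move=> x y _ _ e; apply/ffunP.
  suff h k : forall i : 'I_n, (n - i <= k)%N -> x i = y i by move=> i; exact: (h n i (leq_subr _ _)).
  elim: k => [|k IH] i ik; first by have := ltn_ord i; lia.
  have := e i; rewrite (_ : tl x i = tl y i).
    by move=> /addIr [] /val_inj.
  rewrite /tl; congr ((_ - _) / _); apply: eq_bigr => j ij; rewrite IH //; have := ltn_ord j; lia.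
- move=> z i _; rewrite sumE.
  have /andP[c0 c1] := c01 i.
  rewrite normrM (gtr0_norm c0).
  apply: (@le_trans _ _ (c i i * (1 + `|(z i)%:R + tl z i|))); last first.
    by rewrite mulrDr mulr1 lerD2r.
  rewrite ler_pM2l // intrD -pmulrn.
  have := floor_le (tl z i); have := floorD1_gt (tl z i).
  rewrite intrD => h1 h2; rewrite ler_norml.
  have := ler_norm ((z i)%:R + tl z i); have := ler_norm (- ((z i)%:R + tl z i)); rewrite normrN.
  by move=> *; apply/andP; split; lra.
Qed.
End lattice_count.

(** * Maximal determinants and frames *)
Section determinant_update.
Variable R : comUnitRingType.

(** Both sides are the determinant of one block matrix, factorised in two ways. *)
Lemma det_add1_mulC m n (A : 'M[R]_(m, n)) (B : 'M[R]_(n, m)) :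
  \det (1%:M + A *m B) = \det (1%:M + B *m A).
Proof.
have e1 : \det (block_mx 1%:M (- A) B 1%:M) = \det (1%:M + B *m A).
  have -> : block_mx 1%:M (- A) B 1%:M
      = block_mx 1%:M 0 B 1%:M *m block_mx 1%:M (- A) 0 (1%:M + B *m A).
    rewrite mulmx_block ?mul1mx ?mulmx1 ?mul0mx ?mulmx0 ?addr0 mulmxN.
    by rewrite addrCA addNr addr0.
  by rewrite det_mulmx det_lblock det_ublock !det1 !mul1r.
have e2 : \det (block_mx 1%:M (- A) B 1%:M) = \det (1%:M + A *m B).
  have -> : block_mx 1%:M (- A) B 1%:M
      = block_mx (1%:M + A *m B) (- A) 0 1%:M *m block_mx 1%:M 0 B 1%:M.
    rewrite mulmx_block ?mul1mx ?mulmx1 ?mul0mx ?mulmx0 ?add0r mulNmx.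
    by rewrite addrK.
  by rewrite det_mulmx det_lblock det_ublock !det1 !mulr1.
by rewrite -e1 -e2.
Qed.

Lemma det_2x2 (A : 'M[R]_(1 + 1)) :
  \det A = ulsubmx A 0 0 * drsubmx A 0 0 - ursubmx A 0 0 * dlsubmx A 0 0.
Proof.
rewrite (expand_det_row _ 0) big_ord_recl big_ord1 /cofactor !det_mx11 !mxE /=.
rewrite expr0 expr1 mul1r mulN1r mulrN.
by congr (A _ _ * A _ _ - A _ _ * A _ _); apply: val_inj.
Qed.

(** The exchange of a for u is a perturbation of rank 2, so that its effect on
    the determinant is the determinant of a 2 x 2 matrix. *)
Lemma det_exchange n (M : 'M[R]_n) (a u : 'rV[R]_n) : M \in unitmx ->
  let q (x y : 'rV[R]_n) := (x *m invmx M *m y^T) 0 0 in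
  \det (M - a^T *m a + u^T *m u)
    = \det M * ((1 - q a a) * (1 + q u u) + q a u * q u a).
Proof.
move=> Mu q; pose X := row_mx (- a^T) u^T; pose Y := col_mx a u.
have -> : M - a^T *m a + u^T *m u = M *m (1%:M + (invmx M *m X) *m Y).
  rewrite mulmxDr mulmx1 -!mulmxA mulKVmx // /X /Y mul_row_col mulNmx.
  by rewrite addrA.
rewrite det_mulmx det_add1_mulC /X /Y mul_mx_row mul_col_row !mulmxN.
have subD (P Q : 'M[R]_(1 + 1)) :
    [/\ ulsubmx (P + Q) 0 0 = ulsubmx P 0 0 + ulsubmx Q 0 0,
        ursubmx (P + Q) 0 0 = ursubmx P 0 0 + ursubmx Q 0 0,
        dlsubmx (P + Q) 0 0 = dlsubmx P 0 0 + dlsubmx Q 0 0 &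
        drsubmx (P + Q) 0 0 = drsubmx P 0 0 + drsubmx Q 0 0].
  by split; rewrite !mxE.
set W := block_mx _ _ _ _.
have [e1 e2 e3 e4] := subD 1%:M W.
rewrite det_2x2 e1 e2 e3 e4 /W !block_mxKul !block_mxKdr !block_mxKur !block_mxKdl.
have mxN (P : 'M[R]_1) : (- P) 0 0 = - P 0 0 by rewrite mxE.
have [i1 i2 i3 i4] : [/\ ulsubmx (1%:M : 'M[R]_(1 + 1)) 0 0 = 1,
    drsubmx (1%:M : 'M[R]_(1 + 1)) 0 0 = 1, ursubmx (1%:M : 'M[R]_(1 + 1)) 0 0 = 0 &
    dlsubmx (1%:M : 'M[R]_(1 + 1)) 0 0 = 0] by split; rewrite !mxE.
rewrite !mulmxA !mxN i1 i2 i3 i4 -!/(q _ _) !add0r; congr (_ * (_ + _)).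
by rewrite mulrN opprK.
Qed.
End determinant_update.

Section optimal_design.
Variables (R : realType) (n k : nat) (J : finType) (f : 'I_k -> 'rV[R]_n).

Definition design (g : J -> 'I_k) : 'M[R]_n := \sum_j (f (g j))^T *m f (g j).

Definition qform (M : 'M[R]_n) (x y : 'rV[R]_n) : R := (x *m M *m y^T) 0 0.

Lemma design_frame g (x y : 'rV[R]_n) : design g \in unitmx ->
  \sum_j qform (invmx (design g)) x (f (g j))
       * qform (invmx (design g)) (f (g j)) y
  = qform (invmx (design g)) x y.
Proof.
move=> Mu; set M := design g.
have mulmx11 (A B : 'M[R]_1) : A 0 0 * B 0 0 = (A *m B) 0 0 by rewrite !mxE big_ord1.
rewrite /qform.
under eq_bigr => j _ do rewrite mulmx11.
rewrite -summxE -[in RHS](mulmxK Mu (x *m invmx M)).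
suff -> : \sum_j x *m invmx M *m (f (g j))^T *m (f (g j) *m invmx M *m y^T)
    = x *m invmx M *m M *m invmx M *m y^T by rewrite -/M.
rewrite (_ : x *m _ *m M = x *m invmx M *m (\sum_j (f (g j))^T *m f (g j))) // mulmx_sumr !mulmx_suml.
by apply: eq_bigr => j _; rewrite !mulmxA.
Qed.

Lemma design_trace g : design g \in unitmx ->
  \sum_j qform (invmx (design g)) (f (g j)) (f (g j)) = n%:R.
Proof.
move=> Mu; rewrite -[RHS](mxtrace1 R n) -(mulVmx Mu) {2}/design mulmx_sumr raddf_sum /=.
apply: eq_bigr => j _; rewrite /qform mulmxA mxtrace_mulC mulmxA.
by rewrite /mxtrace big_ord1.
Qed.

(** At a maximiser of the determinant no exchange of a member a of the design
    for a point u can help; by det_exchange this reads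
    (1 - q(a)) (1 + q(u)) + <a, u>^2 <= 1.  Summing over the members and using
    design_trace and design_frame leaves an inequality in q(u) alone. *)
Lemma optimal_design (g0 : {ffun J -> 'I_k}) : \det (design g0) != 0 ->
  exists2 g : J -> 'I_k, design g \in unitmx &
    forall l, qform (invmx (design g)) (f l) (f l) * (#|J|%:R - n%:R + 1) <= n%:R.
Proof.
move=> d0; pose F (g : {ffun J -> 'I_k}) := `|\det (design g)|.
pose g := [arg max_(g > g0) F g]%O.
have gmax h : F h <= F g by rewrite /g; case: Order.TotalTheory.arg_maxP => // i _; apply.
have Fg : 0 < F g by apply: lt_le_trans (gmax g0); rewrite normr_gt0.
have Mu : design g \in unitmx by rewrite unitmxE unitfE -normr_gt0.
exists g => // l; set q := qform _.
have step j : (1 - q (f (g j)) (f (g j))) * (1 + q (f l) (f l))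
    + q (f (g j)) (f l) * q (f l) (f (g j)) <= 1.
  pose h := [ffun i => if i == j then l else g i].
  have Mh : design h = design g - (f (g j))^T *m f (g j) + (f l)^T *m f l.
    rewrite /design (bigD1 j) //= ffunE eqxx addrC; congr (_ + _).
    rewrite [in RHS](bigD1 j) //= [RHS]addrAC subrr add0r.
    by apply: eq_bigr => i /negbTE ij; rewrite ffunE ij.
  have := gmax h; rewrite /F Mh det_exchange // normrM ger_pMr //.
  by apply: le_trans; apply: ler_norm.
have := ler_sum (index_enum J) (P := xpredT) (fun j _ => step j).
rewrite big_split /= -mulr_suml sumrB !sumr_const.
under [X in _ + X <= _ -> _]eq_bigr => j _ do rewrite mulrC.
rewrite design_trace // design_frame // -/q.
have -> : #|{: J}| = #|J| by [].
lra.
Qed.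

End optimal_design.

Section frame.
Variables (R : realType) (n k : nat) (f : 'I_k -> 'rV[R]_n).

(** With 2n members the bound of optimal_design is n / (n + 1) <= 1.  Any
    basis extracted from the points, taken twice, is an admissible starting
    design. *)
Lemma spanning_frame : row_full (\matrix_i f i) ->
  exists2 g : 'I_n * bool -> 'I_k, design f g \in unitmx &
    forall l, qform (invmx (design f g)) (f l) (f l) <= 1.
Proof.
move=> full; pose h := fullrankfun full; pose B := \matrix_i f (h i).
have Bu : B \in unitmx.
  have -> : B = rowsub h (\matrix_i f i) by apply/matrixP => i j; rewrite !mxE.
  exact: fullrowsub_unit.
pose g0 := [ffun p : 'I_n * bool => h p.1].
have d0 : \det (design f g0) != 0.
  have -> : design f g0 = 2%:R *: (B^T *m B).
    rewrite /design (eq_bigr (fun p => (fun i (b : bool) => (f (h i))^T *m f (h i)) p.1 p.2));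
      last by move=> p _; rewrite ffunE.
    rewrite -(pair_bigA _ (fun i (b : bool) => (f (h i))^T *m f (h i))) /=.
    apply/matrixP => i j; rewrite summxE !mxE mulr_sumr; apply: eq_bigr => l _.
    rewrite sumr_const card_bool mulmxnE !mxE big_ord1 !mxE; ring.
  rewrite detZ det_mulmx det_tr mulf_neq0 ?expf_neq0 ?pnatr_eq0 //.
  by rewrite mulf_neq0 // -unitfE -unitmxE.
have [g Mu hg] := optimal_design d0.
exists g => // l; have := hg l; rewrite card_prod card_ord card_bool natrM.
have n0 : 0 <= n%:R :> R by rewrite ler0n.
nra.
Qed.
End frame.

(** * Greedy orthogonalisation of a frame *)
Section inner_product.
Variables (R : realType) (V : lmodType R) (dot : V -> V -> R).
Hypothesis dotC : forall x y, dot x y = dot y x.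
Hypothesis dotDl : forall x y z, dot (x + y) z = dot x z + dot y z.
Hypothesis dotZl : forall (a : R) x z, dot (a *: x) z = a * dot x z.
Hypothesis dot_ge0 : forall x, 0 <= dot x x.

Lemma dot0l z : dot 0 z = 0.
Proof. by rewrite -(scale0r 0) dotZl mul0r. Qed.

Lemma dot_suml (I : Type) (r : seq I) (P : pred I) (F : I -> V) z :
  dot (\sum_(i <- r | P i) F i) z = \sum_(i <- r | P i) dot (F i) z.
Proof. by apply: (big_morph (dot^~ z)) => [x y|]; rewrite ?dotDl ?dot0l. Qed.

Lemma dotDr x y z : dot z (x + y) = dot z x + dot z y.
Proof. by rewrite dotC dotDl !(dotC z). Qed.

Lemma dotZr (a : R) x z : dot z (a *: x) = a * dot z x.
Proof. by rewrite dotC dotZl (dotC z). Qed.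

Lemma dotNl x z : dot (- x) z = - dot x z.
Proof. by rewrite -scaleN1r dotZl mulN1r. Qed.

Lemma dotNr x z : dot z (- x) = - dot z x.
Proof. by rewrite dotC dotNl (dotC z). Qed.

Lemma dot_sumr (I : Type) (r : seq I) (P : pred I) (F : I -> V) z :
  dot z (\sum_(i <- r | P i) F i) = \sum_(i <- r | P i) dot z (F i).
Proof. by rewrite dotC dot_suml; apply: eq_bigr => i _; rewrite dotC. Qed.

Lemma dot_sqD x y : dot (x + y) (x + y) = dot x x + 2 * dot x y + dot y y.
Proof. rewrite dotDl !dotDr (dotC y x); ring. Qed.

Lemma dot_cauchy x y : dot x y ^+ 2 <= dot x x * dot y y.
Proof.
have h (s t : R) : 0 <= s ^+ 2 * dot x x + 2 * (s * t * dot x y) + t ^+ 2 * dot y y.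
  have := dot_ge0 (s *: x + t *: y); rewrite dot_sqD !(dotZl, dotZr); lra.
have x0 := dot_ge0 x; have y0 := dot_ge0 y.
have [yy|yy] := eqVneq (dot y y) 0.
  have [->|xy] := eqVneq (dot x y) 0; first by rewrite expr0n mulr_ge0.
  have := h 1 (- (dot x x + 1) / dot x y).
  by rewrite yy mul1r divfK // expr1n mulr0 addr0; lra.
have yp : 0 < dot y y by rewrite lt_def yy.
have := h (dot y y) (- dot x y).
have -> : dot y y ^+ 2 * dot x x + 2 * (dot y y * - dot x y * dot x y) + (- dot x y) ^+ 2 * dot y y
  = dot y y * (dot x x * dot y y - dot x y ^+ 2) by ring.
by rewrite pmulr_rge0 // subr_ge0.
Qed.

Lemma dot_conv_le (t : R) x y : 0 <= t <= 1 ->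
  dot (t *: x + (1 - t) *: y) (t *: x + (1 - t) *: y)
    <= t * dot x x + (1 - t) * dot y y.
Proof.
move=> /andP[t0 t1]; rewrite dot_sqD !(dotZl, dotZr).
have := dot_ge0 (x - y); rewrite dot_sqD dotNl !dotNr opprK => h.
have := mulr_ge0 (mulr_ge0 t0 (_ : 0 <= 1 - t)) h; rewrite subr_ge0 => /(_ t1).
lra.
Qed.

Section orthonormal.
Variables (m : nat) (g : nat -> V).
Hypothesis gorth : forall i j, (i < m)%N -> (j < m)%N -> dot (g i) (g j) = (i == j)%:R.

Let proj x := \sum_(i < m) dot (g i) x *: g i.

Lemma dot_orthonormal_residual i x : (i < m)%N -> dot (g i) (x - proj x) = 0.
Proof.
move=> im; rewrite dotDr dotNr dot_sumr (bigD1 (Ordinal im)) //= dotZr gorth // eqxx mulr1.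
rewrite big1 ?addr0 ?subrr // => j ji; rewrite dotZr gorth //.
by rewrite (_ : (i == j) = false) ?mulr0 //; apply: contra_neqF ji => /eqP ij; apply: val_inj.
Qed.

Lemma dot_residual x :
  dot (x - proj x) (x - proj x) = dot x x - \sum_(i < m) dot (g i) x ^+ 2.
Proof.
rewrite {2}/proj dotDr dotNr dot_sumr big1 ?subr0 => [|i _]; last first.
  by rewrite dotZr (dotC (x - _)) dot_orthonormal_residual // mulr0.
rewrite dotDl dotNl /proj dot_suml; congr (_ - _); apply: eq_bigr => i _.
by rewrite dotZl expr2.
Qed.

Lemma bessel x : \sum_(i < m) dot (g i) x ^+ 2 <= dot x x.
Proof. by rewrite -subr_ge0 -dot_residual. Qed.

Lemma dot_residual_self x :
  dot (x - proj x) x = dot x x - \sum_(i < m) dot (g i) x ^+ 2.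
Proof.
rewrite dotDl dotNl /proj dot_suml; congr (_ - _); apply: eq_bigr => i _.
by rewrite dotZl expr2.
Qed.

End orthonormal.

Variables (J : finType) (a : J -> V) (n : nat).
Hypothesis frame : forall x y, dot x y = \sum_j dot x (a j) * dot (a j) y.
Hypothesis trace : \sum_j dot (a j) (a j) = n%:R.

(** The last clause is a way to say that a (v l) is a combination of
    g 0, ..., g l: it is what lets orthogonality pass from the g's to the a's. *)
Let triangular m (v : nat -> J) (g : nat -> V) :=
 [/\ forall i j, (i < m)%N -> (j < m)%N -> dot (g i) (g j) = (i == j)%:R,
     forall i j, (i < m)%N -> (j < i)%N -> dot (g i) (a (v j)) = 0,
     forall i, (i < m)%N -> 0 < dot (g i) (a (v i)) /\
        n%:R - i%:R <= #|J|%:R * dot (g i) (a (v i)) ^+ 2 &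
     forall l x, (l < m)%N -> (forall j, (j <= l)%N -> dot (g j) x = 0) ->
        dot (a (v l)) x = 0].

(** The residuals of the a's on the span of g 0, ..., g (m - 1) have squared
    norms adding up to n - m: the trace of the frame is n, and by the frame
    identity each unit vector g i absorbs exactly 1.  One residual is therefore
    at least the average (n - m) / #|J|; normalise it. *)
Lemma greedy_step m v g : (m < n)%N -> triangular m v g ->
  exists v' g', triangular m.+1 v' g'.
Proof.
move=> mn [orth tri pos spn].
pose r j := dot (a j) (a j) - \sum_(i < m) dot (g i) (a j) ^+ 2.
have sumr : \sum_j r j = n%:R - m%:R.
  rewrite /r sumrB trace exchange_big /=; congr (_ - _).
  rewrite (eq_bigr (fun=> 1)) ?sumr_const ?card_ord // => i _.
  have <- : dot (g i) (g i) = 1 by rewrite orth // eqxx.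
  by rewrite frame; apply: eq_bigr => j _; rewrite expr2 (dotC (a j)).
have [j rj] : exists j, n%:R - m%:R <= #|J|%:R * r j.
  apply/not_existsP => h.
  have {}h j : #|J|%:R * r j < n%:R - m%:R by rewrite ltNge; apply/negP/h.
  have [J0|] := posnP #|J|.
    move: sumr; rewrite big1 => [/eqP|j _]; last first.
      by have := card0_eq J0 j; rewrite inE.
    by rewrite eq_sym subr_eq0 eqr_nat gtn_eqF.
  move=> /card_gt0P [j0 _].
  have : \sum_j (#|J|%:R * r j) < \sum_(j : J) (n%:R - m%:R).
    by apply: ltr_sum => [|j _]; [apply/hasP; exists j0; rewrite ?mem_index_enum|exact: h].
  by rewrite -mulr_sumr sumr sumr_const -[ltRHS]mulr_natl ltxx.
pose w := a j - \sum_(i < m) dot (g i) (a j) *: g i.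
have rp : 0 < r j.
  have mn' : 0 < n%:R - m%:R :> R by rewrite subr_gt0 ltr_nat.
  have := lt_le_trans mn' rj; rewrite pmulr_rgt0 // ltr0n.
  by apply/card_gt0P; exists j.
pose s := Num.sqrt (r j); have sp : 0 < s by rewrite sqrtr_gt0.
have ss : s * s = r j by rewrite -expr2 sqr_sqrtr // ltW.
have wa : dot w (a j) = r j by rewrite /w dot_residual_self.
have ww : dot w w = r j by rewrite /w dot_residual.
have gw i : (i < m)%N -> dot (g i) w = 0 by apply: dot_orthonormal_residual.
have aE : a j = w + \sum_(i < m) dot (g i) (a j) *: g i by rewrite subrK.
exists (fun i => if i == m then j else v i), (fun i => if i == m then s^-1 *: w else g i).
have gn i : i != m -> (i < m.+1)%N -> (i < m)%N by move=> im; rewrite ltnS leq_eqVlt (negbTE im).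
split.
- move=> i l im lm; have [ei|ni] := eqVneq i m; have [el|nl] := eqVneq l m.
  + by rewrite ei el dotZl dotZr ww -ss eqxx mulKf ?gt_eqF // mulVf ?gt_eqF.
  + by rewrite dotZl dotC gw ?gn // mulr0 ei eq_sym (negbTE nl).
  + by rewrite dotZr gw ?gn // mulr0 el (negbTE ni).
  + by rewrite orth ?gn.
- move=> i l im li; have lm : (l < m)%N by apply: leq_trans li _.
  rewrite (ltn_eqF lm); have [e|ni] := eqVneq i m; last by rewrite tri ?gn.
  rewrite dotZl dotC spn ?mulr0 // => p pl; apply: gw; exact: leq_ltn_trans pl lm.
- move=> i im; have [->|ni] := eqVneq i m; last by apply: pos; rewrite gn.
  rewrite dotZl wa -ss mulKf ?gt_eqF //; split=> //.
  by rewrite expr2 ss.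
- move=> l x lm hx; have [el|nl] := eqVneq l m; last first.
    apply: spn; first exact: gn.
    by move=> p pl; have := hx p pl; rewrite ltn_eqF // (leq_ltn_trans pl) ?gn.
  rewrite aE dotDl dot_suml big1 ?addr0 => [|i _]; last first.
    by have := hx i; rewrite ltn_eqF // dotZl => ->; rewrite ?mulr0 // el ltnW.
  have := hx m; rewrite eqxx dotZl el leqnn => /(_ isT) /eqP.
  by rewrite mulf_eq0 invr_eq0 (gt_eqF sp) => /eqP.
Qed.

(** The vectors a (v i) are triangular in the orthonormal system g, with diagonal
    coefficients bounded below: this controls the covolume of the lattice that
    they generate. *)
Lemma greedy_triangular : exists (v : 'I_n -> J) (g : nat -> V),
 [/\ forall i j, (i < n)%N -> (j < n)%N -> dot (g i) (g j) = (i == j)%:R,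
     forall i j : 'I_n, (j < i)%N -> dot (g i) (a (v j)) = 0 &
     forall i : 'I_n, 0 < dot (g i) (a (v i)) /\
        n%:R - i%:R <= #|J|%:R * dot (g i) (a (v i)) ^+ 2].
Proof.
have [j0|noJ] := pselect (exists j : J, True); last first.
  suff n0 : n = 0%N by subst n; exists (fun i : 'I_0 => match i with Ordinal _ h => False_rect _ (notF h) end), (fun=> 0); split=> // -[].
  apply/eqP; rewrite -(eqr_nat R) -trace big1 // => j _; case: noJ; by exists j.
have [j1 _] := j0.
have h m : (m <= n)%N -> exists v g, triangular m v g.
  elim: m => [_|m IH mn]; first by exists (fun=> j1), (fun=> 0); split.
  have [v [g /greedy_step]] := IH (ltnW mn); exact.
have [v [g [h1 h2 h3 _]]] := h n (leqnn n).
by exists (fun i => v i), g; split=> // i *; [apply: h2|apply: h3].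
Qed.

End inner_product.

(** * Approximation of convex hulls by averages of few points *)
Section convex_hull.
Variables (R : realType) (V : lmodType R).
Implicit Types (A C : set V).

Definition convex_closed C := forall x y (t : R),
  0 <= t <= 1 -> C x -> C y -> C (t *: x + (1 - t) *: y).

Lemma convex_closedP C : convex_closed C <-> @convex_set R V C.
Proof.
split=> [h x y t /set_mem Cx /set_mem Cy|h x y t /andP[t0 t1] Cx Cy].
  by apply/mem_set/h => //; rewrite ge0 le1.
by have /set_mem := h x y (Itv01 t0 t1) (mem_set Cx) (mem_set Cy).
Qed.

Lemma convex_hull_sub A C : convex_closed C -> A `<=` C -> convex_hull A `<=` C.
Proof. by move=> /convex_closedP cC AC; apply: smallest_sub. Qed.

Lemma sub_convex_hull A : A `<=` convex_hull A.
Proof. exact: sub_gen_smallest. Qed.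

Lemma convex_hull_closed A : convex_closed (convex_hull A).
Proof.
move=> x y t t01 hx hy C [cC AC]; have /convex_closedP h := cC.
by apply: h => //; [exact: hx|exact: hy].
Qed.

End convex_hull.

Section maurey.
Variables (R : realType) (V : lmodType R) (dot : V -> V -> R).
Hypothesis dotC : forall x y, dot x y = dot y x.
Hypothesis dotDl : forall x y z, dot (x + y) z = dot x z + dot y z.
Hypothesis dotZl : forall (a : R) x z, dot (a *: x) z = a * dot x z.
Hypothesis dot_ge0 : forall x, 0 <= dot x x.
Variables (k : nat) (f : 'I_k -> V).
Hypothesis f_le1 : forall l, dot (f l) (f l) <= 1.

Lemma dot_convex_hull_le1 x : convex_hull (range f) x -> dot x x <= 1.
Proof.
move: x; apply: convex_hull_sub => [x y t t01 hx hy|_ [l _ <-]//].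
apply: le_trans (dot_conv_le dotC dotDl dotZl dot_ge0 _ _ t01) _.
case/andP: t01 => t0 t1; nra.
Qed.

Lemma convex_hull_below x D : convex_hull (range f) x ->
  exists l, dot (f l) D <= dot x D.
Proof.
move=> hx; apply/not_existsP => h.
have : [set y | dot x D < dot y D] x; last by rewrite /= ltxx.
apply: convex_hull_sub hx => [y z t /andP[t0 t1] /= hy hz|_ [l _ <-] /=].
  rewrite dotDl !dotZl; have [->|tn] := eqVneq t 0; first by rewrite mul0r add0r subr0 mul1r.
  have tp : 0 < t by rewrite lt_def tn.
  have := mulr_gt0 tp (_ : 0 < dot y D - dot x D); rewrite subr_gt0 => /(_ hy).
  have := mulr_ge0 (_ : 0 <= 1 - t) (_ : 0 <= dot z D - dot x D).
  by rewrite !subr_ge0 => /(_ t1 (ltW hz)); lra.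
by rewrite ltNge; apply/negP/h.
Qed.

Lemma dot_sqB_le4 x y : dot x x <= 1 -> dot y y <= 1 -> dot (x - y) (x - y) <= 4.
Proof.
move=> hx hy; have := dot_ge0 (x + y); rewrite !(dot_sqD dotC dotDl).
rewrite !(dotNl dotZl, dotNr dotC dotZl); lra.
Qed.

(** Derandomised form of Maurey's empirical method: by convex_hull_below, a
    point f l can be chosen at each step so that its contribution is not
    positively correlated with the current error y, and the squared error
    increases by at most |x - f l|^2 <= 4. *)
Lemma maurey x s : convex_hull (range f) x ->
  exists t : s.-tuple 'I_k,
    let y := s%:R *: x - \sum_(l <- t) f l in dot y y <= 4 * s%:R.
Proof.
move=> hx; elim: s => [|s [t IH]].
  by exists [tuple]; rewrite /= big_nil scale0r subr0 (dot0l dotZl) mulr0.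
have [l hl] := convex_hull_below (- (s%:R *: x - \sum_(l <- t) f l)) hx.
exists [tuple of l :: t] => /=; rewrite big_cons.
set y := s%:R *: x - _ in IH hl *; rewrite !(dotNr dotC dotZl) lerN2 in hl.
have -> : s.+1%:R *: x - (f l + \sum_(l <- t) f l) = y + (x - f l).
  by rewrite mulrS scalerDl scale1r /y opprD addrACA addrC.
rewrite (dot_sqD dotC dotDl).
have := dot_sqB_le4 (dot_convex_hull_le1 hx) (f_le1 l).
have : dot y (x - f l) = dot x y - dot (f l) y.
  by rewrite dotC dotDl (dotNl dotZl).
move: IH; rewrite /= mulrS; lra.
Qed.

(** Only the multiset of the chosen points matters, and sorted tuples count
    multisets. *)
Lemma maurey_sorted x s : convex_hull (range f) x ->
  exists2 t : s.-tuple 'I_k, sorted leq (map val t) &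
    let y := s%:R *: x - \sum_(l <- t) f l in dot y y <= 4 * s%:R.
Proof.
move=> /(maurey s)[t ht].
have sz : size (sort (relpre val leq) t) == s by rewrite size_sort size_tuple.
exists (Tuple sz) => /=.
  rewrite sorted_map; apply: sort_sorted => i j; exact: leq_total.
by rewrite (perm_big t) // perm_sort.
Qed.

End maurey.

Section estimates.
Variable R : realType.

Lemma expn_fact_le s : s%:R ^+ s <= s`!%:R * expR s%:R :> R.
Proof.
case: s => [|s]; first by rewrite expr0 fact0 expR0 mulr1.
have h := @expR_ge1Dxn R s.+1%:R s (ler0n _ _).
rewrite mulrC -ler_pdivrMr ?ltr0n ?fact_gt0 //; apply: le_trans h.
by rewrite lerDr.
Qed.

Lemma ffact_le_expn m s : (m ^_ s <= m ^ s)%N.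
Proof.
elim: s => [|s IH]; first by rewrite ffactn0.
by rewrite ffactnSr expnSr leq_mul // leq_subr.
Qed.

Lemma bin_le_exp m s : (0 < s)%N ->
  'C(m, s)%:R <= (m%:R / s%:R) ^+ s * expR s%:R :> R.
Proof.
move=> s0; have sp : 0 < s%:R :> R by rewrite ltr0n.
rewrite -(ler_pM2r (exprn_gt0 s sp)) expr_div_n mulrAC divfK ?gt_eqF ?exprn_gt0 //.
apply: le_trans (ler_wpM2l (ler0n _ _) (expn_fact_le s)) _.
rewrite mulrA ler_wpM2r ?expR_ge0 // -natrM bin_ffact -natrX ler_nat.
exact: ffact_le_expn.
Qed.

Lemma expR1_lt4 : expR 1 < 4 :> R.
Proof.
have h : 2 / 3 <= expR (- 3^-1) :> R by apply: le_trans (expR_ge1Dx _); lra.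
have e0 := @expR_gt0 R 1.
have e : expR 1 * (expR (- 3^-1) * expR (- 3^-1) * expR (- 3^-1)) = 1 :> R.
  by rewrite -!expRD [X in expR X](_ : _ = 0) ?expR0 //; lra.
move: (expR (- _)) h e => a h e.
have a2 : 4 / 9 <= a * a by nra.
have a3 : 8 / 27 <= a * a * a by nra.
have := ler_wpM2l (ltW e0) a3; rewrite e; lra.
Qed.

Lemma ln_ge_half (rho : R) : 2 <= rho -> 2^-1 <= ln rho.
Proof.
move=> r2; have r0 : 0 < rho by lra.
rewrite -ler_expR lnK ?posrE //; apply: le_trans r2.
have h := ltW expR1_lt4; have := @expR_gt0 R 2^-1.
have : expR 2^-1 * expR 2^-1 <= 4 :> R.
  by rewrite -expRD [X in expR X](_ : _ = 1) //; lra.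
nra.
Qed.

End estimates.

Section hull_net.
Variables (R : realType) (V : lmodType R) (dot : V -> V -> R).
Hypothesis dotC : forall x y, dot x y = dot y x.
Hypothesis dotDl : forall x y z, dot (x + y) z = dot x z + dot y z.
Hypothesis dotZl : forall (a : R) x z, dot (a *: x) z = a * dot x z.
Hypothesis dot_ge0 : forall x, 0 <= dot x x.
Variables (n k : nat) (rho : R) (f : 'I_k.+1 -> V).
Hypothesis n_gt0 : (0 < n)%N.
Hypothesis rho2 : 2 <= rho.
Hypothesis krho : k.+1%:R = rho * n%:R.
Hypothesis f_le1 : forall l, dot (f l) (f l) <= 1.

(** A scale at which the hull of rho n points of norm at most 1 can be covered by
    e^(O(n)) balls of radius sqrt n. *)
Definition critical_scale (m : nat) (r : R) : R := m%:R / Num.sqrt (8 * ln r).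

Lemma critical_scale_gt0 : 0 < critical_scale n rho.
Proof.
have := ln_ge_half rho2 => h.
by rewrite divr_gt0 ?ltr0n // sqrtr_gt0; lra.
Qed.

Lemma critical_scale_sqr : critical_scale n rho ^+ 2 * (8 * ln rho) = n%:R ^+ 2.
Proof.
have h := ln_ge_half rho2; rewrite /critical_scale expr_div_n sqr_sqrtr; last by lra.
by rewrite divfK // gt_eqF //; lra.
Qed.

Lemma card_multiset_le s : (0 < s)%N -> s%:R * ln rho <= n%:R -> n%:R <= 2 * (s%:R * ln rho) ->
  'C(s + k, s)%:R <= expR (6 * n%:R) :> R.
Proof.
move=> s0 sn ns; have L0 := ln_ge_half rho2; set Lr := ln rho in sn ns L0 *.
have sp : 1 <= s%:R :> R by rewrite ler1n.
have r2 := rho2; have rp : 0 < rho by apply: lt_le_trans rho2.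
have kE : k%:R <= rho * n%:R by rewrite -krho ler_nat.
have Lrho : Lr <= rho by apply/ltW/ln_sublinear.
apply: le_trans (bin_le_exp R _ s0) _.
have -> : (s + k)%:R / s%:R = 1 + k%:R / s%:R :> R.
  by rewrite natrD mulrDl divff // gt_eqF //; lra.
have h1 : k%:R / s%:R <= 2 * Lr * rho.
  rewrite ler_pdivrMr; last by lra.
  by apply: le_trans kE _; have := ler_wpM2l (ltW rp) ns; lra.
have h2 : 1 + k%:R / s%:R <= rho ^+ 4.
  have r4 : 4 <= rho ^+ 2 by rewrite expr2; nra.
  have : 1 + 2 * rho ^+ 2 <= rho ^+ 4 by rewrite (exprM rho 2 2) [in leRHS]expr2; nra.
  apply: le_trans; rewrite lerD2l; apply: le_trans h1 _; rewrite expr2; nra.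
have rE : rho = expR Lr by rewrite lnK.
apply: (@le_trans _ _ ((rho ^+ 4) ^+ s * expR s%:R)).
  by rewrite ler_wpM2r ?expR_ge0 // lerXn2r // nnegrE ?exprn_ge0 ?addr_ge0 ?divr_ge0 // ltW.
rewrite rE -!expRM_natl -expRD ler_expR; nra.
Qed.

(** Take s = floor (n / ln rho) in maurey_sorted: the error at the critical scale
    is then at most sqrt n, and there are few multisets of size s.  If
    ln rho > n, the critical scale is below sqrt n and one ball is enough. *)
Lemma hull_net : exists C : seq V, (size C)%:R <= expR (6 * n%:R) :> R /\
  forall x, convex_hull (range f) x ->
    exists2 c, c \in C & let y := critical_scale n rho *: x - c in dot y y <= n%:R.
Proof.
have L0 := ln_ge_half rho2; set Lr := ln rho in L0.
have Lp : 0 < Lr by lra.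
have np : 1 <= n%:R :> R by rewrite ler1n.
have D2 := critical_scale_sqr; set D := critical_scale n rho in D2 *.
rewrite -/Lr in D2.
have [nL|Ln] := ltP n%:R Lr.
  exists [:: 0]; split.
    apply: le_trans (expR_ge1Dx _); rewrite lerDl; lra.
  move=> x hx; exists 0; rewrite ?inE //= subr0.
  rewrite dotZl (dotZr dotC dotZl) mulrA -expr2.
  have := dot_convex_hull_le1 dotC dotDl dotZl dot_ge0 f_le1 hx.
  have := dot_ge0 x; have := sqr_ge0 D => h1 h2 h3.
  have : D ^+ 2 <= n%:R.
    rewrite -(ler_pM2r (_ : 0 < 8 * Lr)); last by lra.
    rewrite D2 expr2; nra.
  nra.
pose s := Num.truncn (n%:R / Lr).
have x1 : 1 <= n%:R / Lr by rewrite ler_pdivlMr // mul1r.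
have s0 : (0 < s)%N by rewrite truncn_gt0.
have sp : 1 <= s%:R :> R by rewrite ler1n.
have s1 : s%:R * Lr <= n%:R by rewrite -ler_pdivlMr // truncn_le //; lra.
have s2 : n%:R <= 2 * (s%:R * Lr).
  have : n%:R / Lr < s.+1%:R by rewrite truncnS_gt.
  rewrite ltr_pdivrMr // mulrS; nra.
exists [seq (D / s%:R) *: \sum_(l <- (t : s.-tuple 'I_k.+1)) f l
       | t in [set t : s.-tuple 'I_k.+1 | sorted leq (map val t)]%SET]; split.
  by rewrite size_map -cardE card_sorted_tuples card_multiset_le.
move=> x /(maurey_sorted dotC dotDl dotZl dot_ge0 f_le1 s)[t ts /= ht].
exists ((D / s%:R) *: \sum_(l <- t) f l).
  by apply/mapP; exists t => //; rewrite mem_enum inE.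
have -> : D *: x - (D / s%:R) *: \sum_(l <- t) f l
    = (D / s%:R) *: (s%:R *: x - \sum_(l <- t) f l).
  by rewrite scalerBr scalerA divfK // gt_eqF //; lra.
rewrite dotZl (dotZr dotC dotZl) mulrA -expr2.
apply: le_trans (ler_wpM2l (sqr_ge0 _) ht) _.
rewrite expr_div_n (_ : D ^+ 2 / s%:R ^+ 2 * (4 * s%:R) = 4 * D ^+ 2 / s%:R); last first.
  by field; rewrite gt_eqF //; lra.
rewrite ler_pdivrMr; last by lra.
rewrite -(ler_pM2r (_ : 0 < 8 * Lr)); last by lra.
rewrite -mulrA D2 expr2; nra.
Qed.

End hull_net.

(** * Lattice points in a cluster *)
Section cluster_card.
Variables (R : realType) (n k : nat) (rho : R) (f : 'I_k.+1 -> 'rV[R]_n).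
Hypothesis n_gt0 : (0 < n)%N.
Hypothesis rho2 : 2 <= rho.
Hypothesis krho : k.+1%:R = rho * n%:R.
Hypothesis f_span : row_full (\matrix_i f i).

(** The square of the product is at most 32^n n^n / n!, which is at most
    e^(6n) because n^n <= n! e^n and 32 <= e^5. *)
Lemma prod_triangular_le (b : 'I_n -> R) : (forall i, 0 < b i) ->
  (forall i : 'I_n, n%:R - i%:R <= (2 * n)%:R * b i ^+ 2) ->
  \prod_i (4 / b i) <= expR (3 * n%:R).
Proof.
move=> b0 hb; rewrite -ler_sqr ?nnegrE ?expR_ge0 //; last first.
  by apply: prodr_ge0 => i _; rewrite divr_ge0 // ltW.
rewrite -prodrXl.
apply: (@le_trans _ _ (\prod_(i < n) (32 * n%:R / (n - i)%:R))).
  apply: ler_prod => i _; rewrite exprn_ge0 /=; last by rewrite divr_ge0 // ltW.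
  have ni : 0 < (n - i)%:R :> R by rewrite ltr0n subn_gt0.
  have := hb i; rewrite -natrB ?(ltnW (ltn_ord i)) // natrM => h.
  by rewrite ler_pdivlMr // expr_div_n mulrAC ler_pdivrMr ?exprn_gt0 //; lra.
rewrite prodf_div prodr_const card_ord -natr_prod -ffact_prod ffactnn.
rewrite ler_pdivrMr ?ltr0n ?fact_gt0 // exprMn -expRM_natl.
rewrite [2%:R * _](_ : _ = n%:R * 5 + n%:R); last by lra.
rewrite expRD -mulrA [expR n%:R * _]mulrC; apply: ler_pM; rewrite ?exprn_ge0 ?expn_fact_le //.
rewrite expRM_natl lerXn2r ?nnegrE ?expR_ge0 //.
rewrite -[5]mulr1 expRM_natl.
have e2 : 2 <= expR 1 :> R by apply: le_trans (expR_ge1Dx _); lra.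
have : 2 ^+ 5 <= expR 1 ^+ 5 :> R by rewrite lerXn2r ?nnegrE ?expR_ge0.
by apply: le_trans; rewrite -natrX ler_nat.
Qed.

(** If the differences of points of A lie in the hull scaled to the
    critical scale, then A lies in a translate of it by one of its points, hence in e^(6n)
    translates of the ball of radius sqrt n by hull_net; in the triangular
    coordinates supplied by greedy_triangular each of them contains at most
    e^(6n) lattice points. *)
Lemma lattice_cluster_card : exists v : 'I_n -> 'I_k.+1,
  forall L (A : {pred {ffun 'I_n -> 'I_L}}),
  {in A &, forall z w : {ffun 'I_n -> 'I_L}, convex_hull (range f)
     ((critical_scale n rho)^-1 *: \sum_i ((z i)%:R - (w i)%:R) *: f (v i))} ->
  #|A|%:R <= expR 12 ^+ n :> R.
Proof.
have [g Mu f1] := spanning_frame f_span.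
set M := invmx _ in f1; pose dot := qform M.
have Msym : M^T = M.
  rewrite /M trmx_inv; congr invmx; rewrite /design linear_sum /=.
  by apply: eq_bigr => j _; rewrite trmx_mul trmxK.
have dotC x y : dot x y = dot y x.
  by rewrite /dot /qform -[in LHS](trmxK (x *m M *m y^T)) [LHS]mxE !trmx_mul trmxK Msym mulmxA.
have dotDl x y z : dot (x + y) z = dot x z + dot y z.
  by rewrite /dot /qform !mulmxDl mxE.
have dotZl a x z : dot (a *: x) z = a * dot x z.
  by rewrite /dot /qform -!scalemxAl mxE.
have frame x y : dot x y = \sum_j dot x (f (g j)) * dot (f (g j)) y.
  by rewrite /dot -design_frame.
have dot_ge0 x : 0 <= dot x x.
  by rewrite frame; apply: sumr_ge0 => j _; rewrite (dotC (f _)) -expr2 sqr_ge0.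
have trace : \sum_j dot (f (g j)) (f (g j)) = n%:R by rewrite design_trace.
have [v [e [orth tri pos]]] := greedy_triangular dotC dotDl dotZl frame trace.
have bes := bessel dotC dotDl dotZl dot_ge0 orth.
have [C [sC hC]] := hull_net dotC dotDl dotZl dot_ge0 n_gt0 rho2 krho f1.
exists (g \o v) => L A hA.
have [A0|[w wA]] := set_0Vmem [set z in A]%SET.
  by rewrite -cardsE A0 cards0 exprn_ge0 ?expR_ge0.
rewrite inE in wA.
pose c (i j : 'I_n) := dot (e i) (f (g (v j))).
pose y (z : {ffun 'I_n -> 'I_L}) := \sum_i (z i)%:R *: f (g (v i)).
pose d (x : 'rV[R]_n) (i : 'I_n) := dot (e i) (y w + x).
pose E x := [pred z : {ffun 'I_n -> 'I_L} | \sum_i (\sum_j c i j * (z j)%:R - d x i) ^+ 2 <= n%:R].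
have c01 i : 0 < c i i <= 1.
  have [p _] := pos i; rewrite p /= -ler_sqr ?nnegrE ?ler01 ?(ltW p) //.
  rewrite expr1n; apply: (le_trans _ (f1 (g (v i)))).
  apply: (le_trans _ (bes (f (g (v i))))).
  by rewrite (bigD1 i) //= lerDl sumr_ge0 // => j _; rewrite sqr_ge0.
have cardE x : #|E x|%:R <= expR (3 * n%:R) * expR (3 * n%:R) :> R.
  apply: le_trans (@card_ellipsoid_le R n L c (d x) tri c01) _.
  rewrite ler_pM2l ?expR_gt0 // prod_triangular_le // => i; first by case/andP: (c01 i).
  by have [_] := pos i; rewrite card_prod card_ord card_bool mulnC.
have cover z : z \in A -> exists2 x, x \in C & z \in E x.
  move=> zA; have [x xC hx] := hC _ (hA _ _ zA wA); exists x => //; rewrite inE.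
  apply: (le_trans _ hx); apply: (le_trans _ (bes _)).
  rewrite le_eqVlt; apply/orP; left; apply/eqP; apply: eq_bigr => i _; congr (_ ^+ 2).
  rewrite scalerA divff ?gt_eqF ?critical_scale_gt0 // scale1r.
  rewrite /c /d (dotDr dotC dotDl) (dotDr dotC dotDl) (dotNr dotC dotZl) opprD addrA; congr (_ - _).
  rewrite /y !(dot_sumr dotC dotDl dotZl) -sumrB; apply: eq_bigr => j _.
  by rewrite !(dotZr dotC dotZl) mulrBl mulrC.
have : #|A|%:R <= \sum_(x <- C) #|E x|%:R :> R.
  rewrite -natr_sum ler_nat.
  elim: (C) (A) cover => [|x C' IH] B hB.
    rewrite big_nil leqn0; apply/eqP/eq_card0 => z; apply/negP => /hB [x]; by [].
  rewrite big_cons -(cardID (E x) B); apply: leq_add.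
    by apply: subset_leq_card; apply/fintype.subsetP => z; rewrite inE => /andP[].
  apply: IH => z; rewrite inE => /andP[zE /hB[u]]; rewrite inE => /orP[/eqP ->|]; last by exists u.
  by rewrite (negbTE zE).
move=> /le_trans; apply.
apply: (@le_trans _ _ (\sum_(x <- C) expR (3 * n%:R) * expR (3 * n%:R))).
  by apply: ler_sum.
rewrite big_const_seq count_predT iter_addr_0 -[leLHS]mulr_natl -expRD.
apply: le_trans (ler_wpM2r (expR_ge0 _) sC) _.
by rewrite -expRD -expRM_natl ler_expR; lra.
Qed.
End cluster_card.

(** * Vertices of polytopes and of symmetric balls *)
Section enumeration.
Variable T : choiceType.

Lemma card_eq_enum (A : set T) k : (A #= `I_k)%card ->
  exists2 f : 'I_k -> T, injective f & range f = A.
Proof.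
move=> Ak; have finA : finite_set A by apply/finite_setP; exists k.
have [X AX] := (finite_fsetP).1 finA; subst A.
have Xk : size (finmap.enum_fset X) == k by apply/eqP/(card_eq_fsetP).
exists (tnth (Tuple Xk)); first exact/tuple_uniqP/finmap.fset_uniq.
apply/seteqP; split=> [_ [i _ <-]|y yX] /=; first exact: (mem_tnth i (Tuple Xk)).
have /tnthP[i ->] : y \in Tuple Xk by [].
by exists i.
Qed.

End enumeration.

Section vertices.
Variables (R : realType) (V : lmodType R).

(** A generating set of minimal size has no redundant point. *)
Lemma polytope_minimal (P : set V) : is_polytope P ->
  exists s : seq V, P = convex_hull [set` s] /\
    forall x, x \in s -> ~ convex_hull [set` [seq y <- s | y != x]] x.
Proof.
move=> [F /finite_seqP [s0 ->] PE].
pose Q n := `[< exists s : seq V, P = convex_hull [set` s] /\ size s = n >].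
have exQ : exists n, Q n by exists (size s0); apply/asboolP; exists s0.
case: (ex_minnP exQ) => n /asboolP[s [Ps sn]] nmin.
exists s; split=> // x xs hx.
have : (n <= size [seq y <- s | y != x])%N.
  apply: nmin; apply/asboolP; exists [seq y <- s | y != x]; split=> //.
  rewrite Ps; apply/seteqP; split; apply: convex_hull_sub; try exact: convex_hull_closed.
    move=> y /= ys; have [->//|yx] := eqVneq y x.
    by apply: sub_convex_hull; rewrite /= mem_filter yx.
  by move=> y /=; rewrite mem_filter => /andP[_ ys]; apply: sub_convex_hull.
rewrite size_filter -sn -(count_predC (predC1 x) s) -[leqRHS]addn0 leq_add2l leqn0.
rewrite -leqn0 leqNgt -has_count => /negP; apply; apply/hasP; exists x => //=.
by rewrite negbK.
Qed.

Lemma weight_itv (b c : R) : 0 < b -> 0 < c -> 0 <= b / (b + c) <= 1.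
Proof.
move=> b0 c0; have bc : 0 < b + c by rewrite addr_gt0.
apply/andP; split; first by rewrite divr_ge0 // ltW.
by rewrite ler_pdivrMr // mul1r lerDl ltW.
Qed.

Section extreme.
Variables (H : set V) (x : V).
Hypothesis Hconv : convex_closed H.
Hypothesis Hx : ~ H x.

(** The cone generated by H - x, which contains no line since x is not in H. *)
Let cone d := d = 0 \/ exists b y, [/\ 0 < b, H y & d = b *: (y - x)].

Lemma coneZ a d : 0 <= a -> cone d -> cone (a *: d).
Proof.
move=> a0 [->|[b [y [b0 Hy ->]]]]; first by left; rewrite scaler0.
have [->|an] := eqVneq a 0; first by left; rewrite scale0r.
by right; exists (a * b), y; rewrite scalerA mulr_gt0 // lt_def an.
Qed.

Lemma coneD d e : cone d -> cone e -> cone (d + e).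
Proof.
move=> [->|[b [y [b0 Hy ->]]]]; first by rewrite add0r.
move=> [->|[c [z [c0 Hz ->]]]]; first by rewrite addr0; right; exists b, y.
have bc : 0 < b + c by rewrite addr_gt0.
right; exists (b + c), ((b / (b + c)) *: y + (1 - b / (b + c)) *: z); split=> //.
  by apply: Hconv => //; exact: weight_itv.
rewrite (_ : 1 - b / (b + c) = c / (b + c)); last by field; rewrite gt_eqF.
rewrite !scalerBr scalerDr !scalerA !(mulrC (b + c)) !divfK ?gt_eqF //.
by rewrite scalerDl opprD addrACA.
Qed.

Lemma cone_pointed d : cone d -> cone (- d) -> d = 0.
Proof.
move=> [//|[b [y [b0 Hy ->]]]] [/eqP|[c [z [c0 Hz e]]]].
  by rewrite oppr_eq0 => /eqP.
case: Hx; have bc : 0 < b + c by rewrite addr_gt0.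
have -> : x = (b / (b + c)) *: y + (1 - b / (b + c)) *: z; last first.
  by apply: Hconv => //; exact: weight_itv.
rewrite (_ : 1 - b / (b + c) = c / (b + c)); last by field; rewrite gt_eqF.
apply: (scalerI (lt0r_neq0 bc)).
rewrite scalerDr !scalerA !(mulrC (b + c)) !divfK ?gt_eqF //.
apply/eqP; rewrite -subr_eq0 -oppr_eq0 opprB scalerDl opprD addrACA -!scalerBr -e addrN.
by [].
Qed.

Lemma extreme_of_cone (P : set V) :
  (forall y, P y -> cone (y - x)) ->
  forall (y z : V) (t : R), P y -> P z -> 0 < t < 1 ->
    x = t *: y + (1 - t) *: z -> y = x /\ z = x.
Proof.
move=> Pc y z t Py Pz /andP[t0 t1] xE.
have e : (1 - t) *: (z - x) = - (t *: (y - x)).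
  apply/eqP; rewrite -addr_eq0 !scalerBr addrACA (addrC (_ *: z)) -xE -opprD -scalerDl.
  by rewrite subrK scale1r subrr.
have ty : t *: (y - x) = 0.
  apply: cone_pointed; first by apply/coneZ/Pc => //; exact: ltW.
  by rewrite -e; apply/coneZ/Pc => //; rewrite subr_ge0 ltW.
have tz : (1 - t) *: (z - x) = 0 by rewrite e ty oppr0.
split; apply/eqP; rewrite -subr_eq0.
  by move/eqP: ty; rewrite scaler_eq0 (gt_eqF t0).
by move/eqP: tz; rewrite scaler_eq0 (gt_eqF (_ : 0 < 1 - t)) // subr_gt0.
Qed.

Lemma hull_cone (s : set V) : (forall y, s y -> y = x \/ H y) ->
  forall y, convex_hull s y -> cone (y - x).
Proof.
move=> sH; apply: convex_hull_sub => [y z t /andP[t0 t1] cy cz|y /sH[->|Hy]].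
- have -> : t *: y + (1 - t) *: z - x = t *: (y - x) + (1 - t) *: (z - x).
    by rewrite !scalerBr addrACA -opprD -scalerDl (addrC t) subrK scale1r.
  by apply: coneD; apply: coneZ => //; rewrite subr_ge0.
- by left; rewrite subrr.
- by right; exists 1, y; rewrite scale1r.
Qed.
End extreme.

(** A point x of an irredundant generating set is not in the hull H of the other
    ones, so that P lies in x plus a pointed cone and x is extreme. *)
Lemma polytope_vertices (P : set V) : is_polytope P -> P = convex_hull (vertices P).
Proof.
move=> /polytope_minimal [s [Ps smin]].
have sP : [set` s] `<=` P by rewrite Ps; exact: sub_convex_hull.
apply/seteqP; split; last first.
  rewrite {2}Ps; apply: convex_hull_sub; first exact: convex_hull_closed.
  by rewrite -Ps => x [].
rewrite {1}Ps; apply: convex_hull_sub; first exact: convex_hull_closed.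
move=> x xs; apply: sub_convex_hull; split; first exact: sP.
apply: (extreme_of_cone (@convex_hull_closed _ _ _) (smin x xs)).
rewrite Ps; apply: hull_cone; first exact: convex_hull_closed.
move=> y /= ys; have [->|yx] := eqVneq y x; [by left|right].
by apply: sub_convex_hull; rewrite /= mem_filter yx.
Qed.

(** Removing an extreme point from a convex set leaves a convex set. *)
Lemma vertices_hull_sub (A : set V) : vertices (convex_hull A) `<=` A.
Proof.
move=> x [hx ext]; apply: contrapT => nAx.
have : (convex_hull A `\ x) x; last by move=> [_]; apply.
apply: (convex_hull_sub _ _ hx).
  move=> y z t /andP[t0 t1] [hy yx] [hz zx]; split.
    by apply: convex_hull_closed => //; rewrite t0 t1.
  have [->|tn0] := eqVneq t 0; first by rewrite scale0r add0r subr0 scale1r.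
  have [->|tn1] := eqVneq t 1; first by rewrite subrr scale0r addr0 scale1r.
  move=> e; have [] := ext y z t hy hz _ (esym e); last by move=> /yx.
  by rewrite lt_def tn0 t0 lt_neqAle tn1.
move=> y Ay; split; first exact: sub_convex_hull.
by move=> yx; apply: nAx; rewrite -yx.
Qed.

End vertices.

Section polytope_norm.
Variables (R : realType) (n k : nat) (X : norm_on R n) (f : 'I_k -> 'rV[R]_n).
Hypothesis n_gt0 : (0 < n)%N.
Let B : set (normed_space X) := @unit_ball R (normed_space X).
Hypothesis f_inj : injective f.
Hypothesis f_vert : range f = vertices B.
Hypothesis B_hull : B = convex_hull (range f).

Lemma norm_onE (x : 'rV[R]_n) : `|x : normed_space X| = X x.
Proof. by []. Qed.

Lemma norm_on_ge0 x : 0 <= X x.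
Proof. exact: (normr_ge0 (x : normed_space X)). Qed.

Lemma norm_on_gt0 x : x != 0 -> 0 < X x.
Proof. by move=> x0; rewrite lt_def norm_on_ge0 andbT; apply: contra_neq x0 => /norm_definite. Qed.

Lemma vertices_opp (x : normed_space X) : vertices B x -> vertices B (- x).
Proof.
move=> [Bx ext]; split; first by rewrite /B /unit_ball /= normrN.
move=> y z t By Bz t01 e.
have [||//||h1 h2] := ext (- y) (- z) t.
- by rewrite /B /unit_ball /= normrN.
- by rewrite /B /unit_ball /= normrN.
- by rewrite !scalerN -opprD -e opprK.
by split; apply: oppr_inj; rewrite opprK.
Qed.

Lemma vertices_neq0 (x : normed_space X) : vertices B x -> x <> 0.
Proof.
move=> [_ ext] x0; subst x.
pose e : 'rV[R]_n := const_mx 1.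
have e0 : e != 0.
  apply/eqP => /matrixP /(_ 0 (Ordinal n_gt0)); rewrite !mxE => /eqP.
  by rewrite oner_eq0.
pose y : normed_space X := (X e)^-1 *: e.
have Xe := norm_on_gt0 e0.
have y1 : `|y| = 1 by rewrite /y normrZ normfV norm_onE ger0_norm ?norm_on_ge0 // mulVf ?gt_eqF.
have [|||| y0 _] := ext y (- y) 2^-1.
- by rewrite /B /unit_ball /= y1.
- by rewrite /B /unit_ball /= normrN y1.
- by apply/andP; split; lra.
- by rewrite scalerN -scalerBl (_ : 2^-1 - (1 - 2^-1) = 0) ?scale0r //; lra.
by move: y1; rewrite y0 normr0 => /esym/eqP; rewrite oner_eq0.
Qed.

Lemma ball_spans (W : set 'rV[R]_n) :
  convex_closed W -> (forall a x, W x -> W (a *: x)) -> W 0 ->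
  (forall i, W (f i)) -> forall x, W x.
Proof.
move=> cW ZW W0 fW x.
have BW : B `<=` W by rewrite B_hull; apply: convex_hull_sub => // _ [i _ <-].
have [->//|x0] := eqVneq x 0; have Xx := norm_on_gt0 x0.
rewrite -(scale1r x) -(divff (lt0r_neq0 Xx)) -scalerA; apply: ZW; apply: BW.
rewrite /B /unit_ball /= normrZ normfV norm_onE ger0_norm ?norm_on_ge0 //.
by rewrite mulVf // gt_eqF.
Qed.

Lemma vertices_row_full : row_full (\matrix_i f i).
Proof.
rewrite -sub1mx; apply/row_subP => i; move: (row i _).
apply: (ball_spans (W := [set x | (x <= \matrix_i f i)%MS])).
- by move=> x y t _ hx hy /=; rewrite addmx_sub ?scalemx_sub.
- by move=> a x hx /=; rewrite scalemx_sub.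
- by rewrite /= sub0mx.
- by move=> j /=; rewrite -(rowK f j) row_sub.
Qed.

(** The involution x -> -x has no fixed vertex; one vertex in each antipodal pair
    is enough to span the space, so that there are at least n pairs. *)
Lemma vertices_card_ge : (2 * n <= k)%N.
Proof.
have opp_ex i : exists j, f j = - f i.
  have : vertices B (- f i) by apply: vertices_opp; rewrite -f_vert; exists i.
  by rewrite -f_vert => -[j _]; exists j.
pose s i := projT1 (cid (opp_ex i)).
have fs i : f (s i) = - f i by rewrite /s; case: cid.
have ss i : s (s i) = i by apply: f_inj; rewrite !fs opprK.
have sn i : s i != i.
  apply/eqP => si; have : vertices B (f i) by rewrite -f_vert; exists i.
  move/vertices_neq0; apply; have /eqP := fs i; rewrite si -addr_eq0 -mulr2n.
  by rewrite -scaler_nat scaler_eq0 pnatr_eq0 => /eqP.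
(* One index in each antipodal pair. *)
pose H : {set 'I_k} := [set i : 'I_k | (i < s i)%N]%SET.
have Hc : (#|H| <= #|~: H|)%N.
  rewrite -(card_imset (mem H) (can_inj ss)); apply: subset_leq_card.
  by apply/fintype.subsetP => _ /imsetP [i + ->]; rewrite !inE ss -leqNgt => /ltnW.
suff nH : (n <= #|H|)%N.
  by rewrite -[leqRHS]card_ord -(cardsC H) mul2n -addnn leq_add // (leq_trans nH).
pose U := <<[seq f i | i in H]>>%VS.
have fU i : f i \in U.
  have [iH|iH] := boolP (i \in H); first by apply/memv_span/map_f; rewrite mem_enum.
  rewrite -(opprK (f i)) rpredN -fs; apply/memv_span/map_f; rewrite mem_enum.
  by move: iH; rewrite !inE ss -leqNgt leq_eqVlt val_eqE (negbTE (sn i)).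
have UT : U = fullv.
  apply/vspaceP => x; rewrite memvf.
  apply: (ball_spans (W := [set x | x \in U])) => //=.
  - by move=> y z t _ hy hz /=; rewrite rpredD ?rpredZ.
  - by move=> a y hy /=; rewrite rpredZ.
  - by rewrite rpred0.
have := dim_span [seq f i | i in H]; rewrite -/U UT dimvf size_image.
by rewrite /dim /= mul1n.
Qed.

End polytope_norm.

(** * From cluster sizes to the separation modulus *)
Section random_partition.
Variables (R : realType) (d : measure_display) (Omega : measurableType d).
Variables (P : probability Omega R).

Lemma sum_probability_ge (I : finType) (A : I -> set Omega) (c : R) :
  (forall i, measurable (A i)) ->
  (forall w, c <= \sum_i \1_(A i) w) -> (c%:E <= \sum_i P (A i))%E.
Proof.
move=> mA hA; have [c0|c0] := leP 0 c; last first.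
  by apply: (@le_trans _ _ 0%E); [rewrite lee_fin ltW|apply: sume_ge0].
have mI i : measurable_fun [set: Omega] (fun w : Omega => (\1_(A i) w : R)%:E).
  exact/measurable_EFinP/measurable_indic.
rewrite (_ : (\sum_i P (A i))%E = (\int[P]_w (\sum_i (\1_(A i) w : R)%:E))%E); last first.
  rewrite ge0_integral_sum //.
  by apply: eq_bigr => i _; rewrite integral_indic // setIT.
have -> : (c%:E = \int[P]_w (cst c%:E) w)%E by rewrite integral_cst // [X in (_ * X)%E](probability_setT P) mule1.
apply: ge0_le_integral => //.
- by apply: emeasurable_sum => i; exact: mI.
- by move=> w _; rewrite sumEFin lee_fin.
Qed.

Variables (M : topologicalType) (Gamma : nat -> Omega -> set M).
Hypothesis rp : random_partition Gamma.
Hypothesis M_acc : forall x : M, closed [set x].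

Definition same_cluster x y := [set w | exists k, Gamma k w x /\ Gamma k w y].

Lemma same_clusterE x y : same_cluster x y =
  [set w | cluster_of Gamma w x = cluster_of Gamma w y].
Proof.
have [_ part] := rp.
have uniqk w k l z : Gamma k w z -> Gamma l w z -> k = l.
  by move=> hk hl; have [_ /trivIsetP tr] := part w; apply: contrapT => /eqP kl;
     have := tr k l I I kl; rewrite -subset0 => /(_ z); apply.
apply/seteqP; split=> w /= [].
  move=> k [hx hy]; apply/seteqP; split=> z [l /= hl hz].
    by exists k => //=; rewrite (uniqk _ _ _ _ hx hl).
  by exists k => //=; rewrite (uniqk _ _ _ _ hy hl).
move=> e; have [cov _] := part w.
have : setT y by []; rewrite -cov => -[k _ hk].
have : cluster_of Gamma w y y by exists k.
by rewrite -e => -[l hx hy]; exists l.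
Qed.

Lemma measurable_mem k x : measurable [set w | Gamma k w x].
Proof.
have [/(_ k) sm _] := rp; have := sm _ (@M_acc x); congr measurable.
apply/seteqP; split=> w /=; first by move=> [y [-> ]].
by move=> h; exists x.
Qed.

Lemma measurable_same_cluster x y : measurable (same_cluster x y).
Proof.
rewrite (_ : same_cluster x y = \bigcup_k ([set w | Gamma k w x] `&` [set w | Gamma k w y])).
  by apply: bigcup_measurable => k _; apply: measurableI; exact: measurable_mem.
by apply/seteqP; split=> w /=; [move=> [k ?]; exists k|move=> [k _ ?]; exists k].
Qed.

(** For a fixed outcome the partition becomes a colouring by integers, to which
    the counting argument on grids applies. *)
Lemma cluster_label w : exists kap : M -> nat,
  (forall x, Gamma (kap x) w x) /\
  forall x y, kap x = kap y <-> same_cluster x y w.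
Proof.
have [_ part] := rp; have [cov /trivIsetP tr] := part w.
have ex x : exists k, Gamma k w x.
  by have : setT x by []; rewrite -cov => -[k _ hk]; exists k.
exists (fun x => projT1 (cid (ex x))); split=> [x|x y]; first by case: cid.
case: cid => k hk /=; case: cid => l hl /=; split=> [e|[m [hx hy]]].
  by exists k; split=> //; rewrite e.
have u a z : Gamma a w z -> Gamma m w z -> a = m.
  move=> ha hm; apply: contrapT => /eqP am.
  by have := tr a m I I am; rewrite -subset0 => /(_ z); apply.
by rewrite (u _ _ hk hx) (u _ _ hl hy).
Qed.

End random_partition.

Section lower_bound.
Variables (R : realType) (n : nat) (X : norm_on R n).
Local Notation V := (normed_space X).

(** The points of the grid are the combinations of the u i with coefficients in
    0, ..., L.  By grid_boundary the expected number of separated edges is at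
    least n (L+1)^n (1/K - 1/(L+1)); there are at most n (L+1)^n edges, each of
    length at most 1, and L is arbitrary. *)
Lemma grid_separation (Delta s K : R) (u : 'I_n -> V) : (0 < n)%N ->
  0 < Delta -> 0 < K ->
  (forall i, `|u i| <= 1) ->
  (forall L (A : {pred {ffun 'I_n -> 'I_L}}),
     {in A &, forall z w : {ffun 'I_n -> 'I_L},
        `|\sum_i ((z i)%:R - (w i)%:R) *: u i| <= Delta} -> #|A|%:R <= K ^+ n) ->
  admits_separating V Delta s -> 0 <= s -> K^-1 <= s / Delta.
Proof.
move=> n0 D0 K0 u1 hK [d [ Omega [P [Gamma [rp bd sp]]]]] s0.
have acc (x : V) : closed [set x].
  exact/accessible_closed_set1/hausdorff_accessible/norm_hausdorff.
suff key L : K^-1 - L.+1%:R^-1 <= s / Delta.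
  apply/ler_addgt0Pr => e e0.
  have ke := key (Num.truncn e^-1).
  rewrite -lerBlDr; apply: le_trans ke; rewrite lerD2l lerN2.
  by rewrite -[leRHS]invrK lef_pV2 ?posrE ?ltr0n ?invr_gt0 // ltW // truncnS_gt.
pose G := {ffun 'I_n -> 'I_L.+1}.
pose y (z : G) : V := \sum_i (z i)%:R *: u i.
have yB (z w : G) : y z - y w = \sum_i ((z i)%:R - (w i)%:R) *: u i.
  by rewrite /y -sumrB; apply: eq_bigr => i _; rewrite scalerBl.
pose A (p : 'I_n * G) : set Omega := if ((p.2 p.1).+1 < L.+1)%N
  then ~` same_cluster Gamma (y (grid_succ p.1 p.2)) (y p.2) else set0.
have mA p : measurable (A p).
  rewrite /A; case: ifP => // _; apply: measurableC; exact: measurable_same_cluster.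
have cG : 0 < #|G|%:R :> R.
  by rewrite ltr0n; apply/card_gt0P; exists [ffun=> ord0].
have lower w : n%:R * #|G|%:R * (K^-1 - L.+1%:R^-1) <= \sum_p \1_(A p) w.
  have [kap [kap1 kap2]] := cluster_label rp w.
  apply: le_trans (grid_boundary (kap := fun z : G => kap (y z)) K0 _) _.
    move=> z; apply: hK => a b; rewrite !inE => /eqP ka /eqP kb.
    rewrite -yB -lee_fin; apply: le_trans (bd w (kap (y z))).
    apply: ereal_sup_ubound; exists (y a); first by rewrite -ka; exact: kap1.
    by exists (y b) => //; rewrite -kb; exact: kap1.
  rewrite (pair_bigA _ (fun (i : 'I_n) (z : G) => (((z i).+1 < L.+1)%N && (kap (y (grid_succ i z)) != kap (y z)))%:R : R)) /=.
  apply: ler_sum => -[i z] _ /=; rewrite /A /=; case: ifP => zL; last by rewrite indicE.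
  rewrite indicE; case: eqP => [_|k] /=; first by rewrite ler0n.
  by rewrite mem_set //= => /kap2.
have upper p : (P (A p) <= (s / Delta)%:E)%E.
  rewrite /A; case: ifP => zL; last by rewrite measure0 lee_fin divr_ge0 // ltW.
  have := sp (y (grid_succ p.1 p.2)) (y p.2); rewrite same_clusterE // => h.
  apply: le_trans h _; rewrite lee_fin ler_piMr ?divr_ge0 ?(ltW D0) //.
  apply: le_trans (u1 p.1); rewrite le_eqVlt; apply/orP; left; apply/eqP.
  rewrite /mdist /= yB (bigD1 p.1) //= big1 ?addr0 => [|j /negbTE jp].
    rewrite ffunE eqxx inordK // -natrB // subSnn scale1r //.
  by rewrite ffunE jp subrr scale0r.
rewrite -(ler_pM2l (mulr_gt0 (_ : 0 < n%:R) cG)) ?ltr0n // -lee_fin.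
apply: le_trans (sum_probability_ge P mA lower) _.
apply: le_trans (lee_sum _ (fun p _ => upper p)) _.
by rewrite sumEFin lee_fin sumr_const card_prod card_ord -[leLHS]mulr_natl natrM.
Qed.

(** At Delta = critical_scale the clusters meet the lattice in at most e^(12 n)
    points. *)
Lemma SEP_lower_bound (k : nat) (rho : R) : (0 < n)%N ->
  is_polytope (@unit_ball R V) ->
  (vertices (@unit_ball R V) #= `I_k)%card ->
  k%:R = rho * n%:R ->
  2 <= rho /\
  (((expR 12 * Num.sqrt 8)^-1 * (n%:R / Num.sqrt (ln rho)))%:E <= SEP V)%E.
Proof.
move=> n0 poly card krho.
have [f finj fvert] := card_eq_enum card.
have Bhull : @unit_ball R V = convex_hull (range f) by rewrite fvert; exact: polytope_vertices.
have np : 0 < n%:R :> R by rewrite ltr0n.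
have rho2 : 2 <= rho.
  rewrite -(ler_pM2r np) -krho -natrM ler_nat.
  exact: vertices_card_ge n0 finj fvert Bhull.
split=> //; apply/ereal_infP => _ [s [s0 hs] <-]; rewrite lee_fin.
have full := vertices_row_full Bhull.
case: k krho f card finj fvert Bhull full => [|k] krho f card finj fvert Bhull full.
  have : 0 < rho * n%:R by rewrite mulr_gt0 //; lra.
  by rewrite -krho ltxx.
have [v hv] := lattice_cluster_card n0 rho2 krho full.
have D0 := critical_scale_gt0 n0 rho2; set D := critical_scale n rho in D0 hv.
have := @grid_separation D s (expR 12) (fun i => f (v i)) n0 D0 (expR_gt0 _) _ _ (hs D D0) (ltW s0).
move=> /(_ _ _) h.
have {}h : (expR 12)^-1 <= s / D.
  apply: h => [i|L A hA].
    have : vertices (@unit_ball R V) (f (v i)) by rewrite -fvert; exists (v i).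
    by case.
  apply: hv => z w zA wA; rewrite -Bhull /unit_ball /=.
  rewrite normrZ normfV (gtr0_norm D0) ler_pdivrMl // mulr1.
  exact: hA.
rewrite ler_pdivlMr // in h; apply: le_trans h.
rewrite /D /critical_scale sqrtrM // le_eqVlt; apply/orP; left; apply/eqP.
field; rewrite !gt_eqF ?expR_gt0 ?sqrtr_gt0 //.
by have := ln_ge_half rho2; lra.
Qed.
End lower_bound.

(** * Two tools: random orders, and measurability on the line *)
Section leading_permutations.
Variable I : finType.

Definition leads (s : {perm I}) (i0 : I) (A : {set I}) : bool :=
  [forall i in A, (enum_rank (s i0) <= enum_rank (s i))%N].

(** In a random order, i0 precedes the whole of A with probability at most
    1 / #|A|.  Composing s with the transpositions of i0 and the members of A
    gives #|A| permutations for each s, all distinct: the member of A can be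
    recovered as the point of A where the result is minimal, and then s too. *)
Lemma card_leads_le (i0 : I) (A : {set I}) :
  (#|[set s | leads s i0 A]%SET| * #|A| <= #|{perm I}|)%N.
Proof.
pose F (p : {perm I} * I) := (tperm i0 p.2 * p.1)%g.
rewrite -cardsX -(@card_in_imset _ _ F); first exact: max_card.
have Fmin s i k : leads s i0 A -> i \in A -> k \in A ->
    (enum_rank (F (s, i) i) <= enum_rank (F (s, i) k))%N.
  move=> /forall_inP ld iA kA; rewrite !permM /= tpermR.
  by case: tpermP => [_|_|_ _]; [exact: ld|exact: leqnn|exact: ld].
move=> [s i] [t j]; rewrite !inE /= => /andP[ls iA] /andP[lt jA] e.
have ij : i = j.
  apply: (@perm_inj _ (F (s, i))); apply/enum_rank_inj/val_inj/eqP.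
  by rewrite eqn_leq (Fmin s i j) //= e (Fmin t j i).
by subst j; move: e; rewrite /F /= => /mulgI ->.
Qed.

End leading_permutations.

Section right_open.
Variable R : realType.
Implicit Types S : set R.

(** Open for the Sorgenfrey topology.  The events that two points share a cell
    have this form, because the radius of a cell may be increased slightly.  Since
    it is stable under arbitrary unions, the events of strong measurability, which
    are uncountable unions, have it too. *)
Definition right_open S := forall w, S w -> \forall w' \near w^'+, S w'.

(** For q rational, the points w of S such that [w, q) is contained in S form an
    interval, and S is the countable union of these intervals. *)
Lemma right_open_measurable S : right_open S -> measurable S.
Proof.
move=> So.
pose Sq (q : rat) := [set w | S w /\ w < ratr q /\ forall v, w <= v < ratr q -> S v].
have -> : S = \bigcup_q Sq q.
  apply/seteqP; split=> [w Sw|w [q _ []]//].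
  have [e /= e0 he] := So w Sw.
  have [q] := @rat_in_itvoo R w (w + e) (ltr_pwDr e0 (lexx w)).
  rewrite in_itv /= => /andP[wq qe].
  exists q => //; split=> //; split=> // v /andP[].
  rewrite le_eqVlt => /orP[/eqP <- //|wv] vq; apply: he => //=.
  by rewrite distrC gtr0_norm ?subr_gt0 // ltrBlDl (lt_trans vq).
apply: bigcupT_measurable_rat => q; apply: is_interval_measurable.
move=> a b [Sa [aq ha]] [Sb [bq hb]] v /andP[av vb].
have vq : v < ratr q by exact: le_lt_trans vb bq.
split; first by apply: ha; rewrite av.
by split=> // u /andP[vu uq]; apply: ha; rewrite (le_trans av vu).
Qed.
End right_open.

(** * Balls of integer points *)
Section lattice_balls.
Variables (R : realType) (m L : nat).

(** The integer points with coordinates between -L and L, encoded with the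
    offset L so as to form a finite type. *)
Definition box := {ffun 'I_m -> 'I_(L + L).+1}.

Definition centered (a : nat) : R := a%:R - L%:R.

Definition centered_abs (a : nat) : nat := ((a - L) + (L - a))%N.

Lemma centered_sqr a : centered a ^+ 2 = (centered_abs a ^ 2)%:R.
Proof.
rewrite /centered /centered_abs; have [aL|/ltnW La] := leqP a L.
  rewrite (_ : (a - L = 0)%N) ?add0n; last by lia.
  by rewrite natrX natrB // -sqrrN opprB.
rewrite (_ : (L - a = 0)%N) ?addn0; last by lia.
by rewrite natrX natrB.
Qed.

Definition lattice_ball (s : nat) : {set box} :=
  [set b : box | (\sum_i centered_abs (b i) ^ 2 <= s ^ 2)%N]%SET.

Lemma lattice_ballP s b :
  (b \in lattice_ball s) = (\sum_i centered (b i) ^+ 2 <= s%:R ^+ 2).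
Proof.
rewrite inE -(ler_nat R) natr_sum natrX; congr (_ <= _).
by apply: eq_bigr => i _; rewrite centered_sqr.
Qed.

(** The offset from L is divided by 2, rounding towards 0 so that the result stays
    in a ball of half the radius.  The remainder is 0, 1 (above L) or 2 (below L),
    hence a factor 3 per coordinate. *)
Definition halve (a : nat) : nat :=
  if (L <= a)%N then (L + (a - L) %/ 2)%N else (L - (L - a) %/ 2)%N.

Definition halve_rem (a : nat) : nat :=
  if (L <= a)%N then ((a - L) %% 2)%N else (2 * ((L - a) %% 2))%N.

Lemma halve_inj a b : halve a = halve b -> halve_rem a = halve_rem b -> a = b.
Proof. by rewrite /halve /halve_rem; case: ifP; case: ifP; lia. Qed.

Lemma card_lattice_ball_double s :
  (#|lattice_ball (2 * s)| <= #|lattice_ball s| * 3 ^ m)%N.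
Proof.
have hL a : (a < (L + L).+1)%N -> (halve a < (L + L).+1)%N.
  by rewrite /halve; case: ifP; lia.
have h3 a : (halve_rem a < 3)%N by rewrite /halve_rem; case: ifP; lia.
pose f (b : box) : box * {ffun 'I_m -> 'I_3} :=
  ([ffun i => Ordinal (hL _ (ltn_ord (b i)))], [ffun i => Ordinal (h3 (b i))]).
have finj : injective f.
  move=> b c /pair_equal_spec[/ffunP e1 /ffunP e2]; apply/ffunP => i; apply/val_inj.
  by apply: halve_inj; [have := e1 i|have := e2 i]; rewrite !ffunE => -[].
have -> : (3 ^ m = #|[set: {ffun 'I_m -> 'I_3}]%SET|)%N.
  by rewrite cardsT card_ffun !card_ord.
rewrite -cardsX -(card_imset _ finj); apply: subset_leq_card.
apply/fintype.subsetP => _ /imsetP[b + ->]; rewrite !inE andbT /= => hb.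
rewrite -(leq_pmul2l (_ : 0 < 4)%N) // (_ : 4 * s ^ 2 = (2 * s) ^ 2)%N; last by rewrite expnMn.
apply: leq_trans hb; rewrite big_distrr /=; apply: leq_sum => i _.
rewrite ffunE /=; set a := nat_of_ord (b i).
rewrite (_ : 4 = 2 ^ 2)%N // -expnMn leq_exp2r // /centered_abs /halve.
by case: ifP; lia.
Qed.

Lemma lattice_ball_gt0 s : (0 < #|lattice_ball s|)%N.
Proof.
apply/card_gt0P; exists [ffun=> inord L]; rewrite inE big1 // => i _.
by rewrite ffunE inordK ?ltnS ?leq_addr // /centered_abs subnn.
Qed.

(** Otherwise the number of points would be multiplied by more than 3^m when the
    radius goes from 6m * m to 6m * 2m by m steps, against
    card_lattice_ball_double. *)
Lemma lattice_ball_shell : (0 < m)%N -> exists2 j, (j < m)%N &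
  (#|lattice_ball (6 * m * (m + j.+1))| <= 3 * #|lattice_ball (6 * m * (m + j))|)%N.
Proof.
move=> m0; pose N j := #|lattice_ball (6 * m * (m + j))|.
suff [j jm h] : exists2 j, (j < m)%N & (N j.+1 <= 3 * N j)%N by exists j.
have [/existsP[j h]|/existsPn h] := boolP [exists j : 'I_m, N j.+1 <= 3 * N j]%N.
  by exists j.
have up j : (0 < j <= m)%N -> (3 ^ j * N 0 < N j)%N.
  elim: j => // j IH /andP[_ jm]; have := h (Ordinal jm); rewrite -ltnNge /=.
  case: j IH jm => [|j] IH jm; first by rewrite expn1.
  apply: leq_ltn_trans; rewrite expnS -mulnA leq_mul2l /=.
  by apply/ltnW/IH; rewrite /= ltnW.
have := up m; rewrite m0 leqnn => /(_ isT).
have e : (6 * m * (m + m) = 2 * (6 * m * (m + 0)))%N by nia.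
by rewrite ltnNge /N e (mulnC (3 ^ m)%N) card_lattice_ball_double.
Qed.

Definition box_flip (i : 'I_m) (b : box) : box :=
  [ffun k => if k == i then rev_ord (b k) else b k].

Lemma box_flipK i : involutive (box_flip i).
Proof.
by move=> b; apply/ffunP => k; rewrite !ffunE; case: eqP => // _; rewrite rev_ordK.
Qed.

Lemma centered_rev (a : 'I_(L + L).+1) : centered (rev_ord a) = - centered a.
Proof.
rewrite /centered /= subSS natrB; last by rewrite -ltnS.
by rewrite natrD; ring.
Qed.

Lemma box_flip_ball i s b : (box_flip i b \in lattice_ball s) = (b \in lattice_ball s).
Proof.
rewrite !lattice_ballP; congr (_ <= _); apply: eq_bigr => k _; rewrite ffunE.
by case: eqP => // _; rewrite centered_rev sqrrN.
Qed.

Definition box_swap (i j : 'I_m) (b : box) : box := [ffun k => b (tperm i j k)].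

Lemma box_swapK i j : involutive (box_swap i j).
Proof. by move=> b; apply/ffunP => k; rewrite !ffunE tpermK. Qed.

Lemma box_swap_ball i j s b : (box_swap i j b \in lattice_ball s) = (b \in lattice_ball s).
Proof.
rewrite !lattice_ballP; congr (_ <= _); rewrite [RHS](reindex_inj (@perm_inj _ (tperm i j))).
by apply: eq_bigr => k _; rewrite ffunE.
Qed.

Lemma sum_centered_cross s (i j : 'I_m) : i != j ->
  \sum_(b in lattice_ball s) centered (b i) * centered (b j) = 0.
Proof.
move=> ij; set S := LHS.
suff : S = - S by lra.
rewrite {1}/S (reindex_inj (can_inj (box_flipK i))) -sumrN.
apply: eq_big => [b|b _]; first exact: box_flip_ball.
by rewrite !ffunE eqxx eq_sym (negbTE ij) centered_rev mulNr.
Qed.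

Lemma sum_centered_sqr s (i j : 'I_m) :
  \sum_(b in lattice_ball s) centered (b i) ^+ 2 = \sum_(b in lattice_ball s) centered (b j) ^+ 2.
Proof.
rewrite (reindex_inj (can_inj (box_swapK i j))).
apply: eq_big => [b|b _]; first exact: box_swap_ball.
by rewrite ffunE tpermL.
Qed.

(** The symmetries of the ball by sign changes and transpositions of the
    coordinates make its covariance matrix scalar. *)
Lemma lattice_ball_isotropic s (u : 'I_m -> R) :
  m%:R * \sum_(b in lattice_ball s) (\sum_i u i * centered (b i)) ^+ 2
    <= (\sum_i u i ^+ 2) * (#|lattice_ball s|%:R * s%:R ^+ 2).
Proof.
have -> : \sum_(b in lattice_ball s) (\sum_i u i * centered (b i)) ^+ 2
    = \sum_i u i ^+ 2 * \sum_(b in lattice_ball s) centered (b i) ^+ 2.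
  under eq_bigr => b _ do rewrite expr2 mulr_suml.
  rewrite exchange_big /=; apply: eq_bigr => i _.
  under eq_bigr => b _ do rewrite mulr_sumr.
  rewrite exchange_big /= (bigD1 i) //= [X in _ + X]big1 ?addr0 => [|j ji].
    by rewrite mulr_sumr; apply: eq_bigr => b _; ring.
  rewrite (eq_bigr (fun b : box => u i * u j * (centered (b i) * centered (b j)))) => [|b _]; last by ring.
  by rewrite -mulr_sumr sum_centered_cross 1?eq_sym // mulr0.
rewrite mulr_sumr mulr_suml; apply: ler_sum => i _.
rewrite mulrCA ler_wpM2l ?sqr_ge0 //.
have -> : m%:R * \sum_(b in lattice_ball s) centered (b i) ^+ 2
    = \sum_(b in lattice_ball s) \sum_j centered (b j) ^+ 2.
  rewrite [RHS]exchange_big /= [RHS](eq_bigr (fun=> \sum_(b in lattice_ball s) centered (b i) ^+ 2)) => [|j _].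
    by rewrite sumr_const card_ord mulr_natl.
  exact: sum_centered_sqr.
rewrite -sum1_card natr_sum mulr_suml; apply: ler_sum => b; rewrite lattice_ballP mul1r.
exact.
Qed.

(** On average over the ball, a linear form is smaller than the trivial bound
    |u| s by a factor sqrt m: the second moment is given by isotropy. *)
Lemma lattice_ball_mean_abs s (u : 'I_m -> R) : (0 < m)%N -> (0 < s)%N ->
  \sum_(b in lattice_ball s) `|\sum_i u i * centered (b i)|
    <= Num.sqrt (\sum_i u i ^+ 2) * #|lattice_ball s|%:R * s%:R / Num.sqrt m%:R.
Proof.
move=> m0 s0; set U := \sum_i u i ^+ 2; set v := fun b : box => \sum_i u i * centered (b i).
have U0 : 0 <= U by apply: sumr_ge0 => i _; rewrite sqr_ge0.
have mp : 0 < m%:R :> R by rewrite ltr0n.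
have sp : 0 < s%:R :> R by rewrite ltr0n.
have iso := lattice_ball_isotropic s u; rewrite -/U in iso.
have [UE|Un] := eqVneq U 0.
  rewrite UE sqrtr0 !mul0r big1 // => b _.
  have u0 i : u i = 0.
    by move/eqP: UE; rewrite psumr_eq0 => [/allP/(_ i (mem_index_enum i))|k _];
      rewrite ?sqr_ge0 // sqrf_eq0 => /eqP.
  by rewrite big1 ?normr0 // => i _; rewrite u0 mul0r.
have Up : 0 < U by rewrite lt_def Un.
pose h := Num.sqrt U * s%:R / Num.sqrt m%:R.
have hp : 0 < h by rewrite /h divr_gt0 ?mulr_gt0 ?sqrtr_gt0.
have hh : m%:R * h ^+ 2 = U * s%:R ^+ 2.
  rewrite /h expr_div_n exprMn !sqr_sqrtr ?ltW //; field; by rewrite gt_eqF.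
have -> : Num.sqrt U * #|lattice_ball s|%:R * s%:R / Num.sqrt m%:R = #|lattice_ball s|%:R * h.
  by rewrite /h; ring.
(* |v| <= (h + v^2 / h) / 2, where h is the value that balances the two terms. *)
apply: (@le_trans _ _ (\sum_(b in lattice_ball s) (2^-1 * (h + h^-1 * v b ^+ 2)))).
  apply: ler_sum => b _; rewrite -/(v b).
  have e : h * (h^-1 * v b ^+ 2) = `|v b| ^+ 2.
    by rewrite mulrA divff ?gt_eqF // mul1r real_normK ?num_real.
  rewrite -(ler_pM2l hp); have := sqr_ge0 (h - `|v b|).
  move: (h^-1 * _) e => t e; rewrite sqrrB; lra.
rewrite -mulr_sumr big_split /= sumr_const -mulr_sumr.
have : h^-1 * \sum_(b in lattice_ball s) v b ^+ 2 <= #|lattice_ball s|%:R * h.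
  rewrite ler_pdivrMl // -(ler_pM2l mp); apply: le_trans iso _.
  rewrite (_ : m%:R * (h * (#|lattice_ball s|%:R * h)) = #|lattice_ball s|%:R * (m%:R * h ^+ 2));
    last by ring.
  by rewrite hh; lra.
by rewrite -[h *+ _]mulr_natl; lra.
Qed.
End lattice_balls.

(** * Carving Euclidean space by lattice balls *)
Section euclidean.
Variables (R : realType) (m : nat).
Implicit Types x y z : 'rV[R]_m.

Definition edot x y : R := \sum_i x 0 i * y 0 i.

Definition enorm x : R := Num.sqrt (edot x x).

Lemma edotC x y : edot x y = edot y x.
Proof. by apply: eq_bigr => i _; rewrite mulrC. Qed.

Lemma edotDl x y z : edot (x + y) z = edot x z + edot y z.
Proof. by rewrite -big_split; apply: eq_bigr => i _; rewrite mxE mulrDl. Qed.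

Lemma edotZl a x z : edot (a *: x) z = a * edot x z.
Proof. by rewrite mulr_sumr; apply: eq_bigr => i _; rewrite mxE mulrA. Qed.

Lemma edot_ge0 x : 0 <= edot x x.
Proof. by apply: sumr_ge0 => i _; rewrite -expr2 sqr_ge0. Qed.

Lemma enorm_ge0 x : 0 <= enorm x. Proof. exact: sqrtr_ge0. Qed.

Lemma enorm_sqr x : enorm x ^+ 2 = edot x x.
Proof. by rewrite sqr_sqrtr // edot_ge0. Qed.

Lemma enormE x : enorm x ^+ 2 = \sum_i x 0 i ^+ 2.
Proof. by rewrite enorm_sqr; apply: eq_bigr => i _; rewrite expr2. Qed.

Lemma enormZ a x : enorm (a *: x) = `|a| * enorm x.
Proof.
by rewrite /enorm edotZl edotC edotZl mulrA -expr2 sqrtrM ?sqr_ge0 // sqrtr_sqr.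
Qed.

Lemma enorm0 : enorm 0 = 0.
Proof. by rewrite -(scale0r 0) enormZ normr0 mul0r. Qed.

Lemma enormN x : enorm (- x) = enorm x.
Proof. by rewrite -scaleN1r enormZ normrN1 mul1r. Qed.

Lemma edot_le x y : `|edot x y| <= enorm x * enorm y.
Proof.
rewrite -ler_sqr ?nnegrE ?mulr_ge0 ?enorm_ge0 // exprMn !enorm_sqr.
rewrite real_normK ?num_real //.
exact: dot_cauchy edotC edotDl edotZl edot_ge0 x y.
Qed.

Lemma enormD x y : enorm (x + y) <= enorm x + enorm y.
Proof.
rewrite -ler_sqr ?nnegrE ?addr_ge0 ?enorm_ge0 // sqrrD !enorm_sqr.
rewrite (dot_sqD edotC edotDl) lerD2r lerD2l -[leRHS]mulr_natl ler_pM2l //.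
exact: le_trans (ler_norm _) (edot_le _ _).
Qed.

Lemma enormB x y : enorm (x - y) <= enorm x + enorm y.
Proof. by rewrite (le_trans (enormD _ _)) // enormN. Qed.

Lemma enorm_distC x y : enorm (x - y) = enorm (y - x).
Proof. by rewrite -enormN opprB. Qed.

Lemma enorm_dist_triangle y x z : enorm (x - z) <= enorm (x - y) + enorm (y - z).
Proof. by have := enormD (x - y) (y - z); rewrite addrA subrK. Qed.

Lemma coord_le_enorm x i : `|x 0 i| <= enorm x.
Proof.
rewrite -ler_sqr ?nnegrE ?enorm_ge0 // enormE real_normK ?num_real //.
by rewrite (bigD1 i) //= lerDl sumr_ge0 // => j _; rewrite sqr_ge0.
Qed.

Lemma enorm_eq0 x : enorm x = 0 -> x = 0.
Proof.
move=> x0; apply/rowP => i; rewrite mxE; apply/eqP; rewrite -normr_le0 -x0.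
exact: coord_le_enorm.
Qed.

Lemma enorm_diff_sqr x y : (enorm x - enorm y) * (enorm x + enorm y) = edot (x - y) (x + y).
Proof.
rewrite -subr_sqr !enorm_sqr edotDl (dotNl edotZl) !(dotDr edotC edotDl) (edotC y x); ring.
Qed.

Lemma enorm_le_coord x (t : R) : (forall i, `|x 0 i| <= t) -> 0 <= t ->
  enorm x <= Num.sqrt m%:R * t.
Proof.
move=> xt t0; rewrite -ler_sqr ?nnegrE ?mulr_ge0 ?sqrtr_ge0 ?enorm_ge0 //.
rewrite enormE exprMn sqr_sqrtr ?ler0n //.
rewrite mulr_natl -[X in _ *+ X]card_ord -sumr_const; apply: ler_sum => i _.
by rewrite -(real_normK (num_real _)) lerXn2r ?nnegrE // (le_trans _ (xt i)).
Qed.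

End euclidean.

Section cells.
Variables (R : realType) (m L : nat).
Local Notation center := {ffun 'I_m -> int}.
Local Notation Box := (box m L).
Local Notation q := (L + L).+1.

Definition vec_of (c : center) : 'rV[R]_m := \row_i (c i)%:~R.

(** The centres are ordered through their residues modulo q, so that the random
    order is a permutation of a finite set.  Centres with the same residue are at
    distance at least q, more than twice the radius, so that they never
    compete. *)
Definition residue (c : center) : Box := [ffun i => inord `|(c i %% q)%Z|%N].

Definition priority (s : {perm Box}) (c : center) : nat := enum_rank (s (residue c)).

(** The points of the ball of radius r around c that are not covered by a ball
    which comes earlier in the order. *)
Definition cell (s : {perm Box}) (r : R) (c : center) (x : 'rV[R]_m) : Prop :=
  enorm (x - vec_of c) <= r /\
  forall c', (priority s c' < priority s c)%N -> r < enorm (x - vec_of c').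

Lemma residueP c c' : residue c = residue c' -> forall i, (q %| c i - c' i)%Z.
Proof.
move=> /ffunP e i; rewrite -eqz_mod_dvd; have := e i; rewrite !ffunE => /(congr1 val).
have q0 : q%:Z != 0 by [].
have h (a : int) : (`|(a %% q)%Z| < q)%N.
  have := ltz_pmod a (isT : (0 < q%:Z)%R); have := modz_ge0 a q0.
  by case: (a %% q)%Z => // k _; rewrite ltz_nat.
rewrite /= !inordK ?h // => e2.
by rewrite -(gez0_abs (modz_ge0 (c i) q0)) -(gez0_abs (modz_ge0 (c' i) q0)) e2.
Qed.

Lemma same_residue_far c c' : residue c = residue c' -> c <> c' ->
  q%:R <= enorm (vec_of c - vec_of c').
Proof.
move=> /residueP dv cc'.
have [i ci] : exists i, c i != c' i.
  apply/existsP; apply: contra_notT cc' => /existsPn h; apply/ffunP => i.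
  by apply/eqP; rewrite -[_ == _]negbK.
apply: le_trans (coord_le_enorm _ i); rewrite !mxE -intrB.
have qc : (q%:Z <= `|c i - c' i|)%R.
  have /dvdzP[k e] := dv i; rewrite e normrM ler_peMl // -gtz0_ge1 normr_gt0.
  by apply: contraNneq ci => k0; rewrite -subr_eq0 e k0 mul0r.
by rewrite -intr_norm -(ler_int R) in qc *.
Qed.

Lemma priority_inj (s : {perm Box}) c c' : priority s c = priority s c' -> residue c = residue c'.
Proof. by move=> /val_inj /enum_rank_inj /perm_inj. Qed.

Lemma cell_far r c c' x : 2 * r < q%:R -> residue c = residue c' -> c <> c' ->
  enorm (x - vec_of c) <= r -> r < enorm (x - vec_of c').
Proof.
move=> rq e cc' xc; rewrite ltNge; apply/negP => xc'.
have := same_residue_far e cc'.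
have := enorm_dist_triangle x (vec_of c) (vec_of c'); rewrite (enorm_distC _ x); lra.
Qed.

Lemma cell_uniq s r c c' x : 2 * r < q%:R -> cell s r c x -> cell s r c' x -> c = c'.
Proof.
move=> rq [xc hc] [xc' hc']; apply: contrapT => cc'.
have [lt|lt|/priority_inj e] := ltngtP (priority s c) (priority s c').
- by have := hc' _ lt; rewrite ltNge xc.
- by have := hc _ lt; rewrite ltNge xc'.
- by have := cell_far rq e cc' xc; rewrite ltNge xc'.
Qed.

Definition floor_center (x : 'rV[R]_m) : center := [ffun i => Num.floor (x 0 i)].

Lemma floor_center_close x : enorm (x - vec_of (floor_center x)) <= Num.sqrt m%:R.
Proof.
rewrite -[leRHS]mulr1; apply: enorm_le_coord => // i; rewrite !mxE ffunE.
have := floor_le (x 0 i); have := floorD1_gt (x 0 i); rewrite intrD => h1 h2.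
by rewrite ger0_norm; lra.
Qed.

Lemma cell_cover s r x : Num.sqrt m%:R <= r -> exists c, cell s r c x.
Proof.
move=> mr.
pose Q k := `[< exists c, priority s c = k /\ enorm (x - vec_of c) <= r >].
have exQ : exists k, Q k.
  exists (priority s (floor_center x)); apply/asboolP; exists (floor_center x); split=> //.
  exact: le_trans (floor_center_close x) mr.
case: (ex_minnP exQ) => k /asboolP[c [ck xc]] kmin; exists c; split=> // c' lt.
rewrite ltNge; apply/negP => xc'.
have Qc' : Q (priority s c') by apply/asboolP; exists c'.
by have := kmin _ Qc'; rewrite -ck leqNgt lt.
Qed.

(** For each of the finitely many residues, at most one centre is within r + 1 of
    x, so that the strict inequalities in the definition of a cell are finitely
    many as far as radii below r + 1 are concerned. *)
Lemma cell_right_open s r c x : 2 * (r + 1) < q%:R -> cell s r c x ->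
  \forall r' \near r^'+, cell s r' c x.
Proof.
move=> rq [xc hc].
have far (b : Box) : \forall r' \near r^'+, forall c', residue c' = b ->
    (priority s c' < priority s c)%N -> r' < enorm (x - vec_of c').
  have [[c0 [e0 [p0 x0]]]|no] := pselect (exists c0, residue c0 = b /\
      (priority s c0 < priority s c)%N /\ enorm (x - vec_of c0) <= r + 1).
    near=> r' => c' e p.
    have [->|cc] := pselect (c' = c0).
      by near: r'; apply: nbhs_right_lt; exact: hc.
    apply: (@lt_trans _ _ (r + 1)); last by apply: cell_far x0 => //; rewrite ?e0 ?e //; exact: nesym.
    by near: r'; apply: nbhs_right_lt; rewrite ltrDl.
  near=> r' => c' e p; apply: (@lt_trans _ _ (r + 1)).
    by near: r'; apply: nbhs_right_lt; rewrite ltrDl.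
  by rewrite ltNge; apply/negP => xc'; apply: no; exists c'.
have {}far : \forall r' \near r^'+, forall b c', residue c' = b ->
    (priority s c' < priority s c)%N -> r' < enorm (x - vec_of c').
  exact: filter_forall far.
near=> r'; split; first by apply: le_trans xc _; near: r'; exact: nbhs_right_ge.
have h : forall b c', residue c' = b ->
    (priority s c' < priority s c)%N -> r' < enorm (x - vec_of c') by near: r'.
by move=> c'; exact: (h (residue c')).
Unshelve. all: by end_near. Qed.
End cells.

(** * The probability that two points fall in different cells *)
Section measure_bounds.
Variable R : realType.

Lemma measure_bigsetU_le (d : measure_display) (T : measurableType d)
    (mu : {measure set T -> \bar R}) (I : Type) (s : seq I) (Q : pred I) (A : I -> set T) :
  (forall i, measurable (A i)) ->
  (mu (\big[setU/set0]_(i <- s | Q i) A i) <= \sum_(i <- s | Q i) mu (A i))%E.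
Proof.
move=> mA; elim: s => [|i s IH]; first by rewrite !big_nil measure0.
rewrite !big_cons; case: ifP => // _.
apply: le_trans (measureU2 _ _ _) _ => //; first exact: bigsetU_measurable.
by rewrite leeD2l.
Qed.

Lemma uniform_prob_le (a b : R) (ab : a < b) (A : set R) : measurable A ->
  (uniform_prob ab A <= ((b - a)^-1)%:E * lebesgue_measure (A `&` `[a, b]))%E.
Proof.
move=> mA; rewrite /uniform_prob integral_uniform_pdf.
rewrite -integral_cst; last exact: measurableI.
rewrite le_eqVlt; apply/orP; left; apply/eqP; apply: eq_integral => x.
by move=> /set_mem[_]; rewrite /= in_itv /= /uniform_pdf => ->.
Qed.

End measure_bounds.

Section random_cells.
Variables (R : realType) (m L r0 : nat).
Local Notation center := {ffun 'I_m -> int}.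
Local Notation Box := (box m L).
Local Notation q := (L + L).+1.
Hypothesis m_gt0 : (0 < m)%N.
Hypothesis r0_ge : (m <= r0)%N.
Hypothesis r0_le : (r0 + 4 * m <= L)%N.

Let M := #|{perm Box}|.

Lemma card_perm_gt0 : 0 < M%:R :> R.
Proof. by rewrite ltr0n; apply/card_gt0P; exists 1%g. Qed.

Definition cell_prob := uniform_prob card_perm_gt0.

(** For w uniform between 0 and the number of permutations, the integer part of w
    chooses the order of the centres, and its fractional part the radius,
    uniformly between r0 and r0 + 2m. *)
Definition order_at (w : R) : {perm Box} := nth 1%g (enum {perm Box}) `|Num.floor w|%N.

Definition radius_at (w : R) : R := r0%:R + (2 * m)%:R * (w - (Num.floor w)%:~R).

Definition random_cell (w : R) (c : center) (x : 'rV[R]_m) := cell (order_at w) (radius_at w) c x.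

Let mp : 0 < (2 * m)%:R :> R.
Proof. by rewrite ltr0n muln_gt0. Qed.

Lemma radius_at_itv w : r0%:R <= radius_at w < r0%:R + (2 * m)%:R.
Proof.
have := floor_le w; have := floorD1_gt w; rewrite intrD /radius_at => h1 h2.
rewrite lerDl ltrD2l; apply/andP; split; first by rewrite mulr_ge0 ?subr_ge0.
by rewrite gtr_pMr //; lra.
Qed.

Lemma radius_at_q w : 2 * (radius_at w + 1) < q%:R.
Proof.
have /andP[_ h] := radius_at_itv w.
have : r0%:R + (4 * m)%:R <= L%:R :> R by rewrite -natrD ler_nat.
have : 1 <= m%:R :> R by rewrite ler1n.
have -> : q%:R = L%:R + L%:R + 1 :> R by rewrite -addn1 !natrD.
rewrite !natrM in h *; lra.
Qed.

Lemma random_cell_uniq w c c' x : random_cell w c x -> random_cell w c' x -> c = c'.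
Proof.
apply: cell_uniq; have := radius_at_q w; lra.
Qed.

Lemma sqrt_le_nat : Num.sqrt m%:R <= m%:R :> R.
Proof.
rewrite -[leRHS]ger0_norm ?ler0n // -sqrtr_sqr ler_sqrt ?sqr_ge0 // -natrX ler_nat.
by rewrite -[leqLHS]muln1 leq_mul.
Qed.

Lemma random_cell_cover w x : exists c, random_cell w c x.
Proof.
apply: cell_cover; have /andP[h _] := radius_at_itv w.
apply: le_trans h; apply: le_trans sqrt_le_nat _; by rewrite ler_nat.
Qed.

Lemma random_cell_right_open c x : right_open [set w | random_cell w c x].
Proof.
move=> w /= h; have [e /= e0 he] := cell_right_open (radius_at_q w) h.
have fw : \forall w' \near w^'+, Num.floor w' = Num.floor w.
  near=> w'; apply: Num.Theory.floor_def; apply/andP; split.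
    by apply: le_trans (floor_le w) _; near: w'; exact: nbhs_right_ge.
  by near: w'; apply: nbhs_right_lt; exact: floorD1_gt.
near=> w'.
have fw' : Num.floor w' = Num.floor w by near: w'.
have ww' : w < w' by near: w'; exact: nbhs_right_gt.
have we : w' - w < e / (2 * m)%:R by near: w'; apply: nbhs_right_ltDr; rewrite divr_gt0.
have ow' : order_at w' = order_at w by rewrite /order_at fw'.
rewrite /= /random_cell ow'; apply: he; rewrite /radius_at fw' /=; last first.
  by rewrite ltrD2l ltr_pM2l // ltrD2r.
rewrite ltr_pdivlMr // in we.
rewrite distrC gtr0_norm ?subr_gt0 ?ltrD2l ?ltr_pM2l ?ltrD2r //.
by rewrite opprD addrACA subrr add0r -mulrBr opprB addrA subrK mulrC.
Unshelve. all: by end_near. Qed.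

Definition same_cell x y := [set w | exists c, random_cell w c x /\ random_cell w c y].

Lemma same_cell_right_open x y : right_open (same_cell x y).
Proof.
move=> w [c [hx hy]].
near=> w'; exists c; split.
  by near: w'; exact: random_cell_right_open hx.
by near: w'; exact: random_cell_right_open hy.
Unshelve. all: by end_near. Qed.

End random_cells.

(** The points x and y are fixed, and c0 is an integer point near x.  If they are
    separated, then the centre of one of their two cells, the one that comes
    first, has exactly one of them in its ball.  This centre is within s + 6m of c0, the radius lies between the two distances to this
    centre, and this centre precedes all those within s of c0, whose balls
    contain both points. *)
Section local_estimate.
Variables (R : realType) (m L s : nat).
Local Notation center := {ffun 'I_m -> int}.
Local Notation Box := (box m L).
Local Notation q := (L + L).+1.
Hypothesis m_gt0 : (0 < m)%N.
Hypothesis s_ge : (m <= s)%N.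
Hypothesis s_le : (s + 6 * m <= L)%N.
Let r0 := (s + 2 * m)%N.

Let r0_ge : (m <= r0)%N. Proof. rewrite /r0; lia. Qed.
Let r0_le : (r0 + 4 * m <= L)%N. Proof. rewrite /r0; lia. Qed.

Variables (x y : 'rV[R]_m).
Hypothesis xy1 : enorm (x - y) <= 1.
Let c0 := floor_center x.

Definition offset (b : Box) : 'rV[R]_m := \row_i centered R L (b i).

Definition box_center (b : Box) : center := [ffun i => c0 i + (b i)%:Z - L%:Z].

Lemma vec_of_box_center b : vec_of R (box_center b) = vec_of R c0 + offset b.
Proof.
by apply/rowP => i; rewrite !mxE ffunE /centered !intrD mulrNz -!pmulrn addrA.
Qed.

Lemma offset_ball b t : (b \in lattice_ball m L t) = (enorm (offset b) <= t%:R).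
Proof.
rewrite (lattice_ballP R) -[RHS]ler_sqr ?nnegrE ?enorm_ge0 ?ler0n // enormE.
by congr (_ <= _); apply: eq_bigr => i _; rewrite mxE.
Qed.

Lemma residue_box_center_inj : injective (fun b => residue L (box_center b)).
Proof.
move=> b b' /residueP dv; apply/ffunP => i; apply/val_inj => /=.
have := dv i; rewrite !ffunE (_ : _ - _ = (b i)%:Z - (b' i)%:Z); last by lia.
rewrite -eqz_mod_dvd => /eqP; rewrite !modz_small //; last 2 first.
- by rewrite lez_nat ltz_nat /= ltn_ord.
- by rewrite lez_nat ltz_nat /= ltn_ord.
by case.
Qed.

Lemma box_center_surj c (t : nat) : (t <= L)%N -> enorm (vec_of R c - vec_of R c0) <= t%:R ->
  exists2 b, b \in lattice_ball m L t & box_center b = c.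
Proof.
move=> tL ct.
have ci i : `|c i - c0 i| <= L%:Z.
  rewrite -(ler_int R) intr_norm intrB; apply: (@le_trans _ _ t%:R); last by rewrite -pmulrn ler_nat.
  by apply: le_trans ct; have := coord_le_enorm (vec_of R c - vec_of R c0) i; rewrite !mxE.
have bl i : (absz (c i - c0 i + L%:Z)%R < q)%N by have := ci i; lia.
pose b : Box := [ffun i => Ordinal (bl i)].
have bc : box_center b = c.
  apply/ffunP => i; rewrite !ffunE /= gez0_abs; last by have := ci i; lia.
  by rewrite (_ : Num.floor (x 0 i) = c0 i) ?[RHS]ffunE //; ring.
exists b => //; rewrite offset_ball.
by have := vec_of_box_center b; rewrite bc => e; move: ct; rewrite e addrC addKr.
Qed.

Let x_c0 : enorm (x - vec_of R c0) <= m%:R.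
Proof. exact: le_trans (floor_center_close x) (sqrt_le_nat R m_gt0). Qed.

Let y_c0 : enorm (y - vec_of R c0) <= (2 * m)%:R.
Proof.
have := enorm_dist_triangle x y (vec_of R c0); rewrite (enorm_distC y x).
have : 1 <= m%:R :> R by rewrite ler1n.
rewrite natrM; move: x_c0 xy1; lra.
Qed.

Let A' : {set Box} := [set residue L (box_center b) | b in lattice_ball m L s]%SET.

Let far b : bool := (r0%:R <= enorm (x - vec_of R (box_center b)))
   || (r0%:R <= enorm (y - vec_of R (box_center b))).

(** The values of the parameter for which the order is p.1 and the radius lies
    between the distances of x and y to the centre p.2. *)
Let J (p : {perm Box} * Box) : set R :=
  let dx := enorm (x - vec_of R (box_center p.2)) in
  let dy := enorm (y - vec_of R (box_center p.2)) in
  let k := (enum_rank p.1 : nat)%:R in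
  `[k + (Num.min dx dy - r0%:R) / (2 * m)%:R, k + (Num.max dx dy - r0%:R) / (2 * m)%:R].

Let good (p : {perm Box} * Box) : bool :=
  [&& p.2 \in lattice_ball m L (s + 6 * m), far p.2 & leads p.1 (residue L (box_center p.2)) A'].

Let mp : 0 < (2 * m)%:R :> R.
Proof. by rewrite ltr0n muln_gt0. Qed.

Lemma J_measure p : lebesgue_measure (J p) =
  (`|enorm (x - vec_of R (box_center p.2)) - enorm (y - vec_of R (box_center p.2))| / (2 * m)%:R)%:E.
Proof.
rewrite /J /=; set dx := enorm _; set dy := enorm (y - _).
rewrite lebesgue_measure_itv /= lte_fin ltrD2l ltr_pM2r ?invr_gt0 // ltrD2r.
have e (a b : R) : (a%:E - b%:E = (a - b)%:E)%E by [].
have [lt|lt|->] := ltgtP dx dy.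
- rewrite lt e ltr0_norm ?subr_lt0 //; congr (_%:E); move: (lt0r_neq0 mp) => ?; field; by rewrite pnatr_eq0 -lt0n.
- rewrite lt e gtr0_norm ?subr_gt0 //; congr (_%:E); move: (lt0r_neq0 mp) => ?; field; by rewrite pnatr_eq0 -lt0n.
- by rewrite ltxx subrr normr0 mul0r.
Qed.

Let radius_q w : 2 * radius_at m r0 w < q%:R :> R.
Proof. have := radius_at_q (R := R) m_gt0 r0_le w; lra. Qed.

(** If z' lies in the cell of a centre that does not come before c, then the ball
    around c misses z'. *)
Lemma leading_center (w : R) c c' z : random_cell L r0 w c z -> forall z', random_cell L r0 w c' z' ->
  c <> c' -> (priority (order_at m L w) c <= priority (order_at m L w) c')%N ->
  radius_at m r0 w < enorm (z' - vec_of R c).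
Proof.
move=> hz z' [close early] cc'; rewrite leq_eqVlt => /orP[/eqP e|]; last exact: early.
by apply: (cell_far (radius_q w) (esym (priority_inj e)) _ close) => e2; apply: cc'.
Qed.

(** A centre within s of c0 has z in its ball, since s + 2m is the least possible
    radius; it cannot come before the centre whose cell contains z. *)
Lemma leading_leads (w : R) c z : random_cell L r0 w c z ->
  enorm (z - vec_of R c0) <= (2 * m)%:R -> leads (order_at m L w) (residue L c) A'.
Proof.
move=> [_ early] zc; apply/forall_inP => _ /imsetP[b bA ->].
rewrite leqNgt; apply/negP => /early; rewrite ltNge => /negP; apply.
have /andP[h _] := radius_at_itv r0 m_gt0 w; apply: le_trans h.
rewrite vec_of_box_center opprD addrA; apply: le_trans (enormB _ _) _.
by move: bA; rewrite offset_ball /r0 natrD => h; rewrite [leRHS]addrC; exact: lerD.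
Qed.

Lemma separated_cover : ~` same_cell L r0 x y `&` `[0, #|{perm Box}|%:R] `<=`
  (\big[setU/set0]_(p | good p) J p) `|` [set #|{perm Box}|%:R].
Proof.
move=> w [nsame]; rewrite /= in_itv /= => /andP[w0 wM].
have [->|wn] := eqVneq w #|{perm Box}|%:R; [by right|left].
have wlt : w < #|{perm Box}|%:R by rewrite lt_neqAle wn.
have f0 : 0 <= Num.floor w by rewrite floor_ge0.
have fE : (`|Num.floor w|%N)%:R = (Num.floor w)%:~R :> R.
  by rewrite -[in RHS](gez0_abs f0).
have fM : (`|Num.floor w| < #|{perm Box}|)%N.
  by rewrite -(ltr_nat R) fE (le_lt_trans (floor_le w)).
have rk : enum_rank (order_at m L w) = `|Num.floor w|%N :> nat.
  rewrite /order_at -(enum_val_nth _ (Ordinal fM)) enum_valK //.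
have [cx hx] := random_cell_cover L m_gt0 r0_ge w x.
have [cy hy] := random_cell_cover L m_gt0 r0_ge w y.
have cxy : cx <> cy by move=> e; apply: nsame; exists cx; rewrite {2}e.
have /andP[ra rb] := radius_at_itv r0 m_gt0 w.
have x_c0' : enorm (x - vec_of R c0) <= (2 * m)%:R.
  by apply: le_trans x_c0 _; rewrite ler_nat leq_pmull.
suff key c : enorm (x - vec_of R c) <= radius_at m r0 w < enorm (y - vec_of R c)
    \/ enorm (y - vec_of R c) <= radius_at m r0 w < enorm (x - vec_of R c) ->
    leads (order_at m L w) (residue L c) A' ->
    (\big[setU/set0]_(p | good p) J p) w.
  have [pc|/ltnW pc] := leqP (priority (order_at m L w) cx) (priority (order_at m L w) cy).
    apply: (key cx); last exact: leading_leads hx _.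
    by left; case: (hx) => -> _; rewrite (leading_center hx hy).
  apply: (key cy); last exact: leading_leads hy _.
  by right; case: (hy) => -> _; rewrite (leading_center hy hx) //; by move=> e; apply: cxy.
move=> sep ld.
have near_c0 : enorm (vec_of R c - vec_of R c0) <= (s + 6 * m)%:R.
  have h z : enorm (z - vec_of R c0) <= (2 * m)%:R -> enorm (z - vec_of R c) <= radius_at m r0 w ->
      enorm (vec_of R c - vec_of R c0) <= (s + 6 * m)%:R.
    move=> h1 h2; have := enorm_dist_triangle z (vec_of R c) (vec_of R c0).
    rewrite (enorm_distC (vec_of R c) z).
    have e1 : (s + 6 * m)%:R = s%:R + 6 * m%:R :> R by rewrite natrD natrM.
    have e2 : r0%:R = s%:R + 2 * m%:R :> R by rewrite natrD natrM.
    by move: h1 h2 rb; rewrite e1 e2 natrM; lra.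
  by case: sep => /andP[h1 _]; [apply: (h x)|apply: (h y)].
have [b bE bc] := box_center_surj s_le near_c0.
have gp : good (order_at m L w, b).
  rewrite /good /= bE bc ld andbT /far bc.
  by case: sep => /andP[_ h]; apply/orP; [right|left]; apply: le_trans ra (ltW h).
rewrite (bigD1 (order_at m L w, b)) //=; left.
have rE : radius_at m r0 w = r0%:R + (w - (Num.floor w)%:~R) * (2 * m)%:R.
  by rewrite /radius_at mulrC.
rewrite /J /= in_itv /= rk fE bc.
rewrite -lerBrDl ler_pdivrMr // lerBlDl -rE -(lerBlDl w) ler_pdivlMr // lerBrDl -rE ge_min le_max.
by case: sep => /andP[h1 /ltW h2]; rewrite h1 h2 ?orbT.
Qed.

Let num b : R := `|edot (x - y) ((x - vec_of R c0) + (y - vec_of R c0) - 2 *: offset b)|.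

(** The difference of the distances to the centre is that of their squares, which
    is affine in the centre, divided by their sum, which is at least r0. *)
Lemma far_diff_le b : far b ->
  `|enorm (x - vec_of R (box_center b)) - enorm (y - vec_of R (box_center b))| <= num b / r0%:R.
Proof.
set c := vec_of R (box_center b) => fb.
have r0p : 0 < r0%:R :> R by rewrite ltr0n; move: r0_ge m_gt0; lia.
have dx0 := enorm_ge0 (x - c); have dy0 := enorm_ge0 (y - c).
have sum_ge : r0%:R <= enorm (x - c) + enorm (y - c).
  by case/orP: fb; rewrite -/c; lra.
rewrite ler_pdivlMr //.
have := enorm_diff_sqr (x - c) (y - c).
rewrite opprB addrA subrK => e.
have -> : num b = `|(enorm (x - c) - enorm (y - c)) * (enorm (x - c) + enorm (y - c))|.
  rewrite e /num; congr (`|edot _ _|).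
  rewrite /c vec_of_box_center scaler_nat mulr2n !opprD.
  by rewrite !addrA; apply/rowP => i; rewrite !mxE; ring.
rewrite normrM (ger0_norm (addr_ge0 dx0 dy0)).
by rewrite ler_wpM2l.
Qed.

(** Sum over the possible centres the product of the probability that it leads
    (card_leads_le) and of the probability that the radius separates x from y. *)
Lemma separated_prob_le :
  (cell_prob m L (~` same_cell L r0 x y) <=
   ((#|lattice_ball m L s|%:R)^-1 *
    \sum_(b in lattice_ball m L (s + 6 * m)) (num b / (r0%:R * (2 * m)%:R)))%:E)%E.
Proof.
have mS : measurable (~` same_cell L r0 x y).
  by apply: measurableC; apply: right_open_measurable; exact: same_cell_right_open.
have mJ p : measurable (J p) by exact: measurable_itv.
apply: le_trans (uniform_prob_le _ mS) _; rewrite subr0.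
have Mp := card_perm_gt0 R m L; set M : R := #|{perm Box}|%:R in Mp *.
have r0p : 0 < r0%:R :> R by rewrite ltr0n; move: r0_ge m_gt0; lia.
have num0 b : 0 <= num b / (r0%:R * (2 * m)%:R).
  by rewrite divr_ge0 ?normr_ge0 // mulr_ge0 ?ler0n.
have Ap : 0 < #|lattice_ball m L s|%:R :> R by rewrite ltr0n lattice_ball_gt0.
pose I0 : set R := `[0, M]%classic.
have bound : (lebesgue_measure (~` same_cell L r0 x y `&` I0) <=
    \sum_(p | good p) lebesgue_measure (J p))%E.
  have m1 : lebesgue_measure [set M] = 0%E by exact: lebesgue_measure_set1.
  apply: (@le_trans _ _ (lebesgue_measure ((\big[setU/set0]_(p | good p) J p) `|` [set M]))).
    apply: le_measure; last exact: separated_cover.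
      by apply/mem_set; apply: measurableI => //; exact: measurable_itv.
    apply/mem_set; apply: measurableU; last exact: measurable_set1.
    by apply: bigsetU_measurable => p _; exact: mJ.
  apply: le_trans (measureU2 _ _ _) _ => //; first by apply: bigsetU_measurable => p _; exact: mJ.
  by rewrite [X in (_ + X <= _)%E]m1 adde0; apply: measure_bigsetU_le.
apply: le_trans (lee_wpmul2l _ bound) _; first by rewrite lee_fin invr_ge0 ltW.
under eq_bigr => p _ do rewrite J_measure.
rewrite sumEFin -EFinM lee_fin ler_pdivrMl //.
apply: (@le_trans _ _ (\sum_(p | good p) (num p.2 / (r0%:R * (2 * m)%:R)))).
  apply: ler_sum => p /and3P[_ fp _].
  by rewrite invfM mulrA ler_pM2r ?invr_gt0 //; exact: far_diff_le.
rewrite (eq_bigl (fun p : {perm Box} * Box => xpredT p.1 && good p)) //.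
rewrite -(pair_big_dep xpredT (fun s b => good (s, b)) (fun _ b => num b / (r0%:R * (2 * m)%:R))) /=.
rewrite (exchange_big_dep (mem (lattice_ball m L (s + 6 * m)))) /= => [|p b _]; last by case/and3P.
rewrite mulrCA mulr_sumr mulr_sumr; apply: ler_sum => b bE.
rewrite sumr_const -[leLHS]mulr_natl; set N := #|_|.
have NM : N%:R * #|lattice_ball m L s|%:R <= M.
  have := card_leads_le (residue L (box_center b)) A'.
  rewrite (card_imset _ residue_box_center_inj) -(ler_nat R); apply: le_trans.
  rewrite natrM ler_wpM2r // ler_nat; apply: subset_leq_card; apply/fintype.subsetP => p.
  by rewrite !inE => /and3P[].
rewrite [leRHS]mulrA [X in _ <= X * _]mulrC.
by rewrite ler_wpM2r // ler_pdivlMr.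
Qed.

End local_estimate.

Section shell_choice.
Variables (R : realType) (m : nat).
Hypothesis m_gt0 : (0 < m)%N.

(** Among the candidate radii 6m (m + j), choose one such that enlarging the ball
    by 6m multiplies the number of its points by at most 3.  The sum in
    separated_prob_le is then at most three times an average, estimated by
    lattice_ball_mean_abs. *)
Lemma exists_good_radius : exists r0 L : nat,
  [/\ (m <= r0)%N, (r0 + 4 * m <= L)%N, (r0 <= 12 * m ^ 2)%N &
   forall x y : 'rV[R]_m, enorm (x - y) <= 1 ->
    (cell_prob m L (~` same_cell L r0 x y) <=
      (7 * Num.sqrt m%:R / m%:R ^+ 2 * enorm (x - y))%:E)%E].
Proof.
pose L := (12 * m ^ 2)%N.
have [j jm shell] := lattice_ball_shell L m_gt0; set s := (6 * m * (m + j))%N in shell.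
have sE : (6 * m * (m + j.+1) = s + 6 * m)%N by rewrite /s; nia.
rewrite sE in shell.
have s_ge : (m <= s)%N by rewrite /s; nia.
have s6 : (6 * m ^ 2 <= s)%N by rewrite /s; nia.
have sL : (s + 6 * m <= L)%N by rewrite -sE /L; nia.
have s6_gt0 : (0 < s + 6 * m)%N by rewrite addn_gt0 muln_gt0 m_gt0 orbT.
have s2_gt0 : (0 < s + 2 * m)%N by rewrite addn_gt0 muln_gt0 m_gt0 orbT.
exists (s + 2 * m)%N, L; split; [lia|lia|move: sL; rewrite /L; lia|].
move=> x y xy1; apply: le_trans (separated_prob_le m_gt0 s_ge sL xy1) _; rewrite lee_fin.
set u := x - y; set c0 := vec_of R _; set v := x - c0 + (y - c0).
set E := lattice_ball m L (s + 6 * m); set A := lattice_ball m L s in shell *.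
have mp : 1 <= m%:R :> R by rewrite ler1n.
have m0 : 0 < m%:R :> R by rewrite ltr0n.
set t := Num.sqrt (m%:R : R).
have tt : t ^+ 2 = m%:R by rewrite sqr_sqrtr // ltW.
have t1 : 1 <= t by rewrite -sqrtr1 ler_sqrt //.
have Ap : 0 < #|A|%:R :> R by rewrite ltr0n lattice_ball_gt0.
have vle : enorm v <= 3 * t.
  have h := floor_center_close x; rewrite -/c0 -/t in h.
  apply: le_trans (enormD _ _) _.
  have := enorm_dist_triangle x y c0; rewrite (enorm_distC y x); lra.
have r2 : (s + 6 * m)%:R <= 12 * t ^+ 4 :> R.
  rewrite (exprM t 2 2) tt -natrX -natrM ler_nat; exact: sL.
have mean := lattice_ball_mean_abs L (fun i => u 0 i) m_gt0 (_ : 0 < s + 6 * m)%N.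
have {mean} mean : \sum_(b in E) `|edot u (offset R b)| <= enorm u * #|E|%:R * (12 * t ^+ 3).
  have hE (b : box m L) : edot u (offset R b) = \sum_i u 0 i * centered R L (b i).
    by apply: eq_bigr => i _; rewrite [offset _ _ _ _]mxE.
  under eq_bigr => b _ do rewrite hE.
  apply: le_trans (mean s6_gt0) _.
  rewrite -enormE sqrtr_sqr ger0_norm ?enorm_ge0 // -mulrA ler_wpM2l ?mulr_ge0 ?enorm_ge0 //.
  rewrite -/t ler_pdivrMr; last lra.
  by rewrite -mulrA -exprSr.
have num : \sum_(b in E) `|edot u (v - 2 *: offset R b)| <= enorm u * #|E|%:R * (27 * t ^+ 3).
  apply: (@le_trans _ _ (\sum_(b in E) (enorm u * (3 * t) + 2 * `|edot u (offset R b)|))).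
    apply: ler_sum => b _; rewrite edotC edotDl (dotNl (@edotZl R m)) edotZl !(edotC _ u).
    apply: le_trans (ler_normB _ _) _; rewrite normrM ger0_norm // lerD2r.
    by apply: le_trans (edot_le _ _) _; rewrite ler_wpM2l ?enorm_ge0.
  rewrite big_split /= sumr_const -[_ *+ _]mulr_natl -mulr_sumr.
  have t3 : t <= t ^+ 3 by rewrite exprS ler_peMr ?expr_ge1 //; lra.
  have uE : 0 <= enorm u * #|E|%:R by rewrite mulr_ge0 ?enorm_ge0.
  have := ler_wpM2l uE t3; lra.
rewrite -mulr_suml.
have r0p : 6 * t ^+ 4 <= (s + 2 * m)%:R :> R.
  by rewrite (exprM t 2 2) tt -natrX -natrM ler_nat; exact: leq_trans s6 (leq_addr _ _).
have EA : #|E|%:R <= 3 * #|A|%:R :> R by rewrite -natrM ler_nat.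
rewrite mulrA ler_pdivrMr; last by rewrite -natrM ltr0n muln_gt0 s2_gt0 muln_gt0.
rewrite ler_pdivrMl //.
apply: le_trans num _.
have t0 : 0 < t by lra.
rewrite -tt -exprM.
have -> : #|A|%:R * (7 * t / t ^+ (2 * 2) * enorm u * ((s + 2 * m)%:R * (2 * m)%:R))
   = enorm u * (#|A|%:R * ((s + 2 * m)%:R * (14 * m%:R * t / t ^+ 4))).
  by rewrite natrM; ring.
rewrite -mulrA ler_wpM2l ?enorm_ge0 // -tt.
have f1 (z : R) : z != 0 -> 14 * z ^+ 2 * z / z ^+ 4 = 14 / z by move=> z0; field.
rewrite (f1 t) ?gt_eqF //.
apply: (@le_trans _ _ (3 * #|A|%:R * (27 * t ^+ 3))).
  by rewrite ler_wpM2r // mulr_ge0 // exprn_ge0 // ltW.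
rewrite -mulrA mulrCA ler_wpM2l //.
apply: (@le_trans _ _ (6 * t ^+ 4 * (14 / t))); last by rewrite ler_wpM2r // divr_ge0 // ltW.
have f2 (z : R) : z != 0 -> 6 * z ^+ 4 * (14 / z) = 84 * z ^+ 3 by move=> z0; field.
rewrite (f2 t) ?gt_eqF //.
have : 0 <= t ^+ 3 by rewrite exprn_ge0 // ltW.
lra.
Qed.
End shell_choice.

(** * Norms with prescribed vertices *)
Lemma continuous_sumr (R : realType) (T : topologicalType) (I : Type) (s : seq I)
    (F : I -> T -> R) : (forall i, continuous (F i)) ->
  continuous (fun x => \sum_(i <- s) F i x).
Proof. by move=> cF; apply: continuous_big => //; exact: add_continuous. Qed.

Section gauge.
Variables (R : realType) (n k : nat) (v : 'I_k -> 'rV[R]_n).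

(** x lies in t times the convex hull of the v j. *)
Definition gauge_le (x : 'rV[R]_n) (t : R) : Prop :=
  exists2 l : 'I_k -> R, forall j, 0 <= l j &
    \sum_j l j = t /\ \sum_j l j *: v j = x.

Lemma gauge_le_ge0 x t : gauge_le x t -> 0 <= t.
Proof. by move=> [l l0 [<- _]]; apply: sumr_ge0. Qed.

Lemma gauge_leD x y s t : gauge_le x s -> gauge_le y t -> gauge_le (x + y) (s + t).
Proof.
move=> [l l0 [<- <-]] [m m0 [<- <-]]; exists (fun j => l j + m j).
  by move=> j; rewrite addr_ge0.
by split; rewrite -big_split //=; apply: eq_bigr => j _; rewrite scalerDl.
Qed.

Lemma gauge_leZ a x t : 0 <= a -> gauge_le x t -> gauge_le (a *: x) (a * t).
Proof.
move=> a0 [l l0 [<- <-]]; exists (fun j => a * l j).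
  by move=> j; rewrite mulr_ge0.
by rewrite mulr_sumr scaler_sumr; split=> //; apply: eq_bigr => j _; rewrite scalerA.
Qed.

Lemma gauge_le_gen j : gauge_le (v j) 1.
Proof.
exists (fun i => (i == j)%:R) => //; split.
  by rewrite (bigD1 j) //= eqxx big1 ?addr0 // => i /negbTE ->.
rewrite (bigD1 j) //= eqxx scale1r big1 ?addr0 // => i /negbTE ->.
by rewrite scale0r.
Qed.

Lemma gauge_le_lower (N : 'rV[R]_n -> R) x t :
  (forall a y, N (a *: y) = `|a| * N y) -> (forall y z, N (y + z) <= N y + N z) ->
  (forall j, N (v j) <= 1) -> gauge_le x t -> N x <= t.
Proof.
move=> NZ ND N1 [l l0 [<- <-]].
have N0 : N 0 = 0 by rewrite -(scale0r 0) NZ normr0 mul0r.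
elim/big_rec2: _ => [|j y1 y2 _ h]; first by rewrite N0.
apply: le_trans (ND _ _) (lerD _ h); rewrite NZ ger0_norm //.
by rewrite ler_piMr.
Qed.

Lemma convex_hull_gauge_le x : convex_hull (range v) x <-> gauge_le x 1.
Proof.
split.
  move: x; apply: convex_hull_sub => [x y t /andP[t0 t1] hx hy|_ [j _ <-]]; last exact: gauge_le_gen.
  have := gauge_leD (gauge_leZ t0 hx) (gauge_leZ (_ : 0 <= 1 - t) hy).
  by rewrite !mulr1 (addrC t) subrK subr_ge0; apply.
move=> [l l0 [l1 <-]].
have key (s : seq 'I_k) : \sum_(j <- s) l j = 0 /\ \sum_(j <- s) l j *: v j = 0 \/
    0 < \sum_(j <- s) l j /\
    exists2 y, convex_hull (range v) y & \sum_(j <- s) l j *: v j = (\sum_(j <- s) l j) *: y.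
  elim: s => [|j s IH]; first by left; rewrite !big_nil.
  rewrite !big_cons.
  have hj : convex_hull (range v) (v j) by apply: sub_convex_hull; exists j.
  have [lj|lj] := eqVneq (l j) 0; first by rewrite lj scale0r !add0r.
  have lp : 0 < l j by rewrite lt_def lj l0.
  right; case: IH => [[-> ->]|[sp [y hy ->]]].
    by rewrite !addr0; split=> //; exists (v j).
  set S := \sum_(i <- s) _ in sp *; have tp : 0 < l j + S by rewrite addr_gt0.
  split=> //; exists ((l j / (l j + S)) *: v j + (1 - l j / (l j + S)) *: y).
    by apply: convex_hull_closed => //; exact: weight_itv.
  rewrite (_ : 1 - l j / (l j + S) = S / (l j + S)); last by field; rewrite gt_eqF.
  by rewrite scalerDr !scalerA !(mulrC (l j + S)) !divfK ?gt_eqF.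
have [[h _]|[_ [y hy ->]]] := key (index_enum _); last by rewrite l1 scale1r.
by move: l1 => /eqP; rewrite h eq_sym oner_eq0.
Qed.

(** The weights lie in a compact box, so that the infimum of the values t with
    gauge_le x t is attained. *)
Lemma gauge_le_closed x t : (forall e, 0 < e -> exists2 s, t <= s < t + e & gauge_le x s) ->
  gauge_le x t.
Proof.
move=> h; have t0 : 0 <= t.
  rewrite leNgt; apply/negP => t0; have [|s /andP[_ st] /gauge_le_ge0] := h (- t).
    by rewrite oppr_gt0.
  by move: st; rewrite subrr; lra.
pose f (l : 'rV[R]_k) : R := `|t - \sum_j l 0 j| + \sum_i `|x 0 i - \sum_j l 0 j * v j 0 i|.
have cf : continuous f.
  have clin (a : 'I_k -> R) : continuous (fun l : 'rV[R]_k => \sum_j l 0 j * a j).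
    apply: continuous_sumr => j l; apply: (@continuousM _ _ (fun l : 'rV[R]_k => l 0 j) (fun=> a j) l).
      exact: coord_continuous.
    exact: cst_continuous.
  have cabs (b : R) (g : 'rV[R]_k -> R) : continuous g -> continuous (fun l => `|b - g l|).
    move=> cg l; apply: (@continuous_comp _ _ _ (fun l => b - g l) (fun z : R => `|z|)).
      apply: (@continuousB _ _ _ (fun=> b) g l); last exact: cg.
      exact: cst_continuous.
    exact: norm_continuous.
  move=> l; apply: (@continuousD _ _ _ (fun l : 'rV[R]_k => `|t - \sum_j l 0 j|)
    (fun l : 'rV[R]_k => \sum_i `|x 0 i - \sum_j l 0 j * v j 0 i|) l).
    apply: cabs; apply: continuous_sumr => j; exact: coord_continuous.
  apply: (continuous_sumr (F := fun i (l : 'rV[R]_k) => `|x 0 i - \sum_j l 0 j * v j 0 i|)).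
  by move=> i; apply: cabs.
pose B := [set l : 'rV[R]_k | forall j, `[0, t + 1]%classic (l 0 j)].
have cB : compact B by apply: (@rV_compact R k (fun=> `[0, t + 1]%classic)) => j; exact: segment_compact.
have B0 : B !=set0.
  by exists 0 => j /=; rewrite mxE in_itv /= lexx addr_ge0.
have [l /set_mem lB lmin] := compact_EVT_min B0 cB (continuous_subspaceT cf).
have fl0 : f l <= 0.
  apply/ler_addgt0Pr => e e0; rewrite add0r.
  have e1 : 0 < Num.min e 1 by rewrite lt_min e0 ltr01.
  have [s /andP[ts se] [m m0 [ms mx]]] := h _ e1.
  pose l' : 'rV[R]_k := \row_j m j.
  have l's : \sum_j l' 0 j = s by rewrite -ms; apply: eq_bigr => j _; rewrite mxE.
  have l'x i : \sum_j l' 0 j * v j 0 i = x 0 i.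
    by rewrite -mx summxE; apply: eq_bigr => j _; rewrite !mxE.
  apply: (@le_trans _ _ (f l')).
    apply: lmin; apply/mem_set => j /=; rewrite in_itv /= mxE m0 /=.
    have : m j <= s by rewrite -ms (bigD1 j) //= lerDl sumr_ge0.
    move: se; rewrite -ltrBlDl lt_min => /andP[_]; lra.
  rewrite /f l's big1 => [|i _]; last by rewrite l'x subrr normr0.
  by rewrite addr0 distrC ger0_norm ?subr_ge0 // ltW // ltrBlDl (lt_le_trans se) // lerD2l ge_min lexx.
have [f1 f2] : `|t - \sum_j l 0 j| = 0 /\ \sum_i `|x 0 i - \sum_j l 0 j * v j 0 i| = 0.
  have a0 := normr_ge0 (t - \sum_j l 0 j).
  have b0 : 0 <= \sum_i `|x 0 i - \sum_j l 0 j * v j 0 i| by apply: sumr_ge0.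
  move: fl0; rewrite /f => fl0; split; lra.
exists (fun j => l 0 j); first by move=> j; have := lB j; rewrite /= in_itv /= => /andP[].
split; first by move/normr0_eq0/eqP: f1; rewrite subr_eq0 => /eqP.
apply/rowP => i; rewrite summxE.
move/eqP: f2; rewrite psumr_eq0 // => /allP/(_ i (mem_index_enum i)) /=.
rewrite normr_eq0 subr_eq0 => /eqP ->.
by apply: eq_bigr => j _; rewrite mxE.
Qed.

Section gauge_norm.
Hypothesis n_gt0 : (0 < n)%N.
Hypothesis v_opp : forall j, exists j', v j' = - v j.
Hypothesis v_basis : forall i, exists j, v j = delta_mx 0 i.

Lemma gauge_le_scaled_gen a j : gauge_le (a *: v j) `|a|.
Proof.
have [a0|a0] := leP 0 a.
  by rewrite ger0_norm //; have := gauge_leZ a0 (gauge_le_gen j); rewrite mulr1.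
have [j' vj'] := v_opp j.
have := gauge_leZ (_ : 0 <= - a) (gauge_le_gen j').
by rewrite oppr_ge0 (ltW a0) mulr1 ltr0_norm // vj' scalerN scaleNr opprK; apply.
Qed.

Lemma gauge_le_basis x : gauge_le x (\sum_i `|x 0 i|).
Proof.
rewrite {1}(row_sum_delta x); elim/big_rec2: _ => [|i t y _ h].
  by exists (fun=> 0) => //; split; rewrite big1 // => j _; rewrite scale0r.
by apply: gauge_leD => //; have [j <-] := v_basis i; exact: gauge_le_scaled_gen.
Qed.

Lemma gauge_le0 t : 0 <= t -> gauge_le 0 t.
Proof.
move=> t0; have [j _] := v_basis (Ordinal n_gt0).
have h0 : 0 <= t / 2 by rewrite divr_ge0.
have := gauge_leD (gauge_le_scaled_gen (t / 2) j) (gauge_le_scaled_gen (- (t / 2)) j).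
by rewrite scaleNr subrr normrN ger0_norm // -splitr.
Qed.

Lemma gauge_le_mono x s t : s <= t -> gauge_le x s -> gauge_le x t.
Proof.
move=> st hx; have := gauge_leD hx (gauge_le0 (_ : 0 <= t - s)).
by rewrite addr0 (addrC s) subrK subr_ge0; apply.
Qed.

Definition gauge x : R := inf [set t | gauge_le x t].

Lemma gauge_has_inf x : has_inf [set t | gauge_le x t].
Proof.
split; first by exists (\sum_i `|x 0 i|); exact: gauge_le_basis.
by exists 0 => t /gauge_le_ge0.
Qed.

Lemma gauge_leP x t : gauge_le x t <-> gauge x <= t.
Proof.
split=> [h|h]; first by apply: ge_inf => //; exists 0 => s /gauge_le_ge0.
apply: gauge_le_mono h _; apply: gauge_le_closed => e e0.
have [s hs se] := inf_adherent e0 (gauge_has_inf x).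
by exists s => //; rewrite se andbT; apply: ge_inf => //; exists 0 => u /gauge_le_ge0.
Qed.

Lemma gauge_ge0 x : 0 <= gauge x.
Proof. by apply: (@gauge_le_ge0 x); apply/gauge_leP. Qed.

Lemma gaugeD x y : gauge (x + y) <= gauge x + gauge y.
Proof. by apply/gauge_leP; apply: gauge_leD; apply/gauge_leP. Qed.

Lemma gaugeN_le x : gauge (- x) <= gauge x.
Proof.
apply/gauge_leP; have /gauge_leP[l l0 [<- xE]] := lexx (gauge x).
rewrite -xE -sumrN; elim/big_rec2: _ => [|j y t _ h]; first exact: gauge_le0.
by apply: gauge_leD => //; rewrite -scaleNr -{2}(ger0_norm (l0 j)) -normrN; exact: gauge_le_scaled_gen.
Qed.

Lemma gaugeN x : gauge (- x) = gauge x.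
Proof. by apply/le_anti; rewrite gaugeN_le -{1}(opprK x) gaugeN_le. Qed.

Lemma gaugeZ_le a x : gauge (a *: x) <= `|a| * gauge x.
Proof.
have h (b : R) : 0 <= b -> gauge (b *: x) <= b * gauge x.
  by move=> b0; apply/gauge_leP; apply: gauge_leZ => //; apply/gauge_leP.
have [a0|a0] := leP 0 a; first by rewrite ger0_norm // h.
by rewrite ltr0_norm // -gaugeN -scaleNr h // oppr_ge0 ltW.
Qed.

Lemma gaugeZ a x : gauge (a *: x) = `|a| * gauge x.
Proof.
apply/le_anti; rewrite gaugeZ_le /=.
have [->|a0] := eqVneq a 0.
  rewrite normr0 mul0r; exact: gauge_ge0.
have := gaugeZ_le a^-1 (a *: x); rewrite scalerA mulVf // scale1r normfV.
by rewrite -ler_pdivlMl ?invr_gt0 ?normr_gt0 // invrK.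
Qed.

(** The comparison norm N is what shows that the gauge is definite, and, when the
    v j are extreme in the unit ball of N, that none of them is lost as a vertex
    of the smaller ball of the gauge. *)
Variable N : 'rV[R]_n -> R.
Hypothesis NZ : forall a y, N (a *: y) = `|a| * N y.
Hypothesis ND : forall y z, N (y + z) <= N y + N z.
Hypothesis N_le1 : forall j, N (v j) <= 1.
Hypothesis N_def : forall x, N x = 0 -> x = 0.

Lemma lower_le_gauge x : N x <= gauge x.
Proof. by apply: (gauge_le_lower NZ ND N_le1); apply/gauge_leP. Qed.

Lemma lower_ge0 x : 0 <= N x.
Proof.
have := ND x (- x); rewrite subrr -scaleN1r NZ normrN1 mul1r -(scale0r 0) NZ normr0 mul0r; lra.
Qed.

Lemma gauge_definite x : gauge x = 0 -> x = 0.
Proof.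
move=> gx; apply: N_def; apply/le_anti; rewrite lower_ge0 andbT -gx.
exact: lower_le_gauge.
Qed.

Definition gauge_norm : norm_on R n := NormOn gaugeD gaugeZ gauge_definite.

Lemma gauge_unit_ball : @unit_ball R (normed_space gauge_norm) = convex_hull (range v).
Proof.
apply/seteqP; split=> [x|x /convex_hull_gauge_le] h.
  by apply/convex_hull_gauge_le; apply/gauge_leP.
by apply/gauge_leP.
Qed.

Lemma gauge_polytope : is_polytope (@unit_ball R (normed_space gauge_norm)).
Proof.
exists (range v); last exact: gauge_unit_ball.
by apply: finite_image; apply: finite_finset.
Qed.

Hypothesis v_inj : injective v.
Hypothesis v_ext : forall j y z t, N y <= 1 -> N z <= 1 -> 0 < t < 1 ->
  v j = t *: y + (1 - t) *: z -> y = v j /\ z = v j.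

Lemma gauge_vertices : vertices (@unit_ball R (normed_space gauge_norm)) = range v.
Proof.
apply/seteqP; split; first by rewrite gauge_unit_ball; exact: vertices_hull_sub.
move=> _ [j _ <-]; split.
  by rewrite gauge_unit_ball; apply: sub_convex_hull; exists j.
move=> y z t hy hz t01 e.
have Ny : N y <= 1 := le_trans (lower_le_gauge y) hy.
have Nz : N z <= 1 := le_trans (lower_le_gauge z) hz.
exact: v_ext Ny Nz t01 e.
Qed.

Lemma gauge_vertices_card : (vertices (@unit_ball R (normed_space gauge_norm)) #= `I_k)%card.
Proof.
rewrite gauge_vertices; apply: card_eq_trans (card_esym card_II).
by apply: inj_card_eq => i j _ _; exact: v_inj.
Qed.
End gauge_norm.
End gauge.

(** * The l_1 sum of Euclidean blocks *)
Section blocks.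
Variables (R : realType) (n m : nat).
Hypothesis m_gt0 : (0 < m)%N.
Local Notation nb := (n %/ m).+1.
Implicit Types (x y z : 'rV[R]_n) (w : 'rV[R]_m).

(** The coordinates b m, ..., b m + m - 1.  If m does not divide n the last block
    is incomplete, and the missing coordinates are read as 0; there are always
    n %/ m + 1 blocks, the last one being empty if m divides n. *)
Definition block_mx_of (b : nat) : 'M[R]_(n, m) := \matrix_(i, j) (i == b * m + j :> nat)%N%:R.

Definition blk b x : 'rV[R]_m := x *m block_mx_of b.

Definition emb b w : 'rV[R]_n := w *m (block_mx_of b)^T.

Lemma index_blockE (i b : nat) (j : 'I_m) :
  (i == b * m + j)%N = (b == i %/ m)%N && (j == i %% m :> nat)%N.
Proof.
apply/eqP/andP => [->|[/eqP -> /eqP ->]]; last exact: divn_eq.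
by rewrite divnMDl // modnMDl divn_small // modn_small // addn0 !eqxx.
Qed.

Lemma embE b w i : emb b w 0 i =
  if (b == i %/ m)%N then w 0 (Ordinal (ltn_pmod i m_gt0)) else 0.
Proof.
rewrite mxE; case: ifP => bi; last first.
  by rewrite big1 // => j _; rewrite !mxE index_blockE bi mulr0.
rewrite (bigD1 (Ordinal (ltn_pmod i m_gt0))) //= big1 ?addr0 => [|j ji].
  by rewrite !mxE index_blockE bi eqxx mulr1.
rewrite !mxE index_blockE bi /= (_ : (_ == _) = false) ?mulr0 //.
by apply: contraNF ji => /eqP e; apply/eqP/val_inj.
Qed.

Lemma blkE b x (j : 'I_m) (i : 'I_n) : i = (b * m + j)%N :> nat -> blk b x 0 j = x 0 i.
Proof.
move=> e; rewrite mxE (bigD1 i) //= big1 ?addr0 => [|k ki].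
  by rewrite mxE e eqxx mulr1.
by rewrite mxE -e val_eqE (negbTE ki) mulr0.
Qed.

Lemma blk_out b x (j : 'I_m) : (n <= b * m + j)%N -> blk b x 0 j = 0.
Proof.
move=> h; rewrite mxE big1 // => i _; rewrite mxE (_ : (_ == _) = false) ?mulr0 //.
by have := ltn_ord i; lia.
Qed.

Lemma blkD b x y : blk b (x + y) = blk b x + blk b y.
Proof. exact: mulmxDl. Qed.

Lemma blkZ b a x : blk b (a *: x) = a *: blk b x.
Proof. by rewrite /blk scalemxAl. Qed.

Lemma blkN b x : blk b (- x) = - blk b x.
Proof. exact: mulNmx. Qed.

Lemma blkB b x y : blk b (x - y) = blk b x - blk b y.
Proof. by rewrite blkD blkN. Qed.

Lemma embZ b a w : emb b (a *: w) = a *: emb b w.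
Proof. by rewrite /emb scalemxAl. Qed.

Lemma embB b w w' : emb b (w - w') = emb b w - emb b w'.
Proof. exact: mulmxBl. Qed.

Lemma blk_emb_neq b b' w : b != b' -> blk b' (emb b w) = 0.
Proof.
move=> bb; apply/rowP => j; rewrite [RHS]mxE.
have [h|h] := leqP n (b' * m + j); first exact: blk_out.
rewrite (blkE _ (i := Ordinal h)) // embE /= divnMDl // divn_small // addn0.
by rewrite (negbTE bb).
Qed.

Lemma blk_emb b w : (forall j : 'I_m, (n <= b * m + j)%N -> w 0 j = 0) ->
  blk b (emb b w) = w.
Proof.
move=> hw; apply/rowP => j.
have [h|h] := leqP n (b * m + j); first by rewrite blk_out ?hw.
rewrite (blkE _ (i := Ordinal h)) // embE /= divnMDl // divn_small // addn0 eqxx.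
by congr (w _ _); apply/val_inj; rewrite /= modnMDl modn_small.
Qed.

Lemma blk_emb_blk b x : blk b (emb b (blk b x)) = blk b x.
Proof. by apply: blk_emb => j; exact: blk_out. Qed.

Lemma sum_emb_blk x : x = \sum_(b < nb) emb b (blk b x).
Proof.
apply/rowP => i; rewrite summxE.
have ib : (i %/ m < nb)%N by rewrite ltnS leq_div2r // ltnW.
rewrite (bigD1 (Ordinal ib)) //= big1 ?addr0 => [|b bi].
  by rewrite embE eqxx; apply/esym/blkE; exact: divn_eq.
by rewrite embE (_ : (_ == _) = false) //; apply: contraNF bi => /eqP e; apply/eqP/val_inj.
Qed.

Lemma blk_ext x y : (forall b : 'I_nb, blk b x = blk b y) -> x = y.
Proof. by move=> h; rewrite (sum_emb_blk x) (sum_emb_blk y); apply: eq_bigr => b _; rewrite h. Qed.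

Definition bnorm x : R := \sum_(b < nb) enorm (blk b x).

Lemma bnormZ a x : bnorm (a *: x) = `|a| * bnorm x.
Proof. by rewrite mulr_sumr; apply: eq_bigr => b _; rewrite blkZ enormZ. Qed.

Lemma bnormD x y : bnorm (x + y) <= bnorm x + bnorm y.
Proof. by rewrite -big_split; apply: ler_sum => b _; rewrite blkD enormD. Qed.

Lemma bnorm_ge0 x : 0 <= bnorm x.
Proof. by apply: sumr_ge0 => b _; exact: enorm_ge0. Qed.

Lemma enorm_blk_le (b : 'I_nb) x : enorm (blk b x) <= bnorm x.
Proof. by rewrite /bnorm (bigD1 b) //= lerDl sumr_ge0 // => c _; exact: enorm_ge0. Qed.

Lemma bnorm_eq0 x : bnorm x = 0 -> x = 0.
Proof.
move=> x0; apply: blk_ext => b; rewrite /blk mul0mx; apply: enorm_eq0.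
by apply/le_anti; rewrite enorm_ge0 andbT -x0 enorm_blk_le.
Qed.

Definition sphere_point x := exists b : 'I_nb, enorm (blk b x) = 1 /\
  forall b' : 'I_nb, b' != b -> blk b' x = 0.

Lemma sphere_point_bnorm x : sphere_point x -> bnorm x = 1.
Proof.
move=> [b [b1 b0]]; rewrite /bnorm (bigD1 b) //= b1 big1 ?addr0 // => c cb.
by rewrite b0 // enorm0.
Qed.

Lemma sphere_pointN x : sphere_point x -> sphere_point (- x).
Proof.
move=> [b [b1 b0]]; exists b; split; first by rewrite blkN enormN.
by move=> c cb; rewrite blkN b0 // oppr0.
Qed.

Lemma sphere_point_neq0 x : sphere_point x -> x != 0.
Proof.
move=> /sphere_point_bnorm h; apply/eqP => x0; move: h.
rewrite x0 -(scale0r 0) bnormZ normr0 mul0r => /eqP; by rewrite eq_sym oner_eq0.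
Qed.

(** Equality in the Cauchy-Schwarz inequality: the linear form x -> <p, x> is at
    most 1 on the unit ball of bnorm, and p is the only point where it equals
    1. *)
Lemma sphere_point_exposed p (b : 'I_nb) y : enorm (blk b p) = 1 ->
  (forall b' : 'I_nb, b' != b -> blk b' p = 0) ->
  bnorm y <= 1 -> edot (blk b p) (blk b y) = 1 -> y = p.
Proof.
move=> p1 p0 y1 py.
have yb : enorm (blk b y) = 1.
  apply/le_anti; rewrite (le_trans (enorm_blk_le b y)) //=.
  by have := edot_le (blk b p) (blk b y); rewrite py p1 mul1r normr1.
apply: blk_ext => c; have [->|cb] := eqVneq c b; last first.
  rewrite p0 //; apply: enorm_eq0; apply/le_anti; rewrite enorm_ge0 andbT.
  move: y1; rewrite /bnorm (bigD1 b) //= yb (bigD1 c) //= -[X in _ <= X -> _]addr0 lerD2l.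
  by apply: le_trans; rewrite lerDl sumr_ge0 // => d _; exact: enorm_ge0.
apply/eqP; rewrite -subr_eq0; apply/eqP/enorm_eq0/eqP; rewrite -sqrf_eq0 enorm_sqr.
rewrite (dot_sqD (@edotC R m) (@edotDl R m)) (dotNl (@edotZl R m)) !(dotNr (@edotC R m) (@edotZl R m)).
by rewrite -!enorm_sqr yb p1 edotC py expr1n; apply/eqP; lra.
Qed.

Lemma sphere_point_extreme p y z t : sphere_point p -> bnorm y <= 1 -> bnorm z <= 1 ->
  0 < t < 1 -> p = t *: y + (1 - t) *: z -> y = p /\ z = p.
Proof.
move=> [b [p1 p0]] y1 z1 /andP[t0 t1] e.
have le1 u : bnorm u <= 1 -> edot (blk b p) (blk b u) <= 1.
  move=> u1; apply: le_trans (ler_norm _) (le_trans (edot_le _ _) _).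
  by rewrite p1 mul1r (le_trans (enorm_blk_le b u)).
have : edot (blk b p) (blk b p) = 1 by rewrite -enorm_sqr p1 expr1n.
rewrite {2}e blkD !blkZ edotC edotDl !edotZl !(edotC _ (blk b p)) => s.
have hy := le1 y y1; have hz := le1 z z1.
by split; apply: sphere_point_exposed p1 p0 _ _ => //; nra.
Qed.

Section gauge_upper.
Variables (k : nat) (v : 'I_k -> 'rV[R]_n).
Hypothesis n_gt0 : (0 < n)%N.
Hypothesis v_opp : forall j, exists j', v j' = - v j.
Hypothesis v_basis : forall i, exists j, v j = delta_mx 0 i.
Hypothesis net : forall (b : 'I_nb) x, blk b x != 0 -> exists j p,
  [/\ v j = emb b p, blk b (v j) = p, enorm p = 1 &
      enorm (blk b x) / 2 <= edot p (blk b x)].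

(** Subtracting |x| / 2 times a net point p such that <p, x> >= |x| / 2 leaves a
    vector of norm at most 7/8 |x|, at a cost |x| / 2.  The series sums up to
    4 |x|; after J steps the remainder is bounded with the basis vectors. *)
Lemma gauge_block_approx J (b : 'I_nb) x : x = emb b (blk b x) ->
  gauge v x <= (4 + (7 / 8) ^+ J * n%:R) * enorm (blk b x).
Proof.
elim: J x => [|J IH] x xb.
  rewrite expr0 mul1r mulrDl; apply: (@le_trans _ _ (n%:R * enorm (blk b x))); last first.
    by rewrite lerDr mulr_ge0 ?enorm_ge0.
  have /(gauge_leP n_gt0 v_opp v_basis) := gauge_le_basis v_opp v_basis x.
  move=> /le_trans; apply.
  rewrite mulr_natl -[X in _ *+ X]card_ord -sumr_const; apply: ler_sum => i _.
  rewrite {1}xb embE; case: ifP => _; last by rewrite normr0 enorm_ge0.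
  exact: coord_le_enorm.
set w := blk b x in xb *.
have [w0|w0] := eqVneq w 0.
  rewrite xb w0 /emb mul0mx -(scale0r 0) (gaugeZ n_gt0 v_opp v_basis) normr0 mul0r.
  by rewrite mulr_ge0 ?enorm_ge0 // addr_ge0 ?mulr_ge0 ?exprn_ge0 ?divr_ge0.
have [j [p [vp bp p1 pw]]] := net w0; rewrite -/w in pw.
set r := enorm w in pw *.
have r0 : 0 <= r := enorm_ge0 w.
pose y := x - (r / 2) *: v j.
have yE : blk b y = w - (r / 2) *: p by rewrite blkB blkZ bp.
have yb : y = emb b (blk b y) by rewrite yE embB embZ -vp -xb.
have q : enorm (blk b y) <= 7 / 8 * r.
  rewrite -ler_sqr ?nnegrE ?mulr_ge0 ?divr_ge0 ?enorm_ge0 // yE enorm_sqr.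
  rewrite (dot_sqD (@edotC R m) (@edotDl R m)) (dotNl (@edotZl R m)) !(dotNr (@edotC R m) (@edotZl R m)).
  rewrite !(@edotZl R m, dotZr (@edotC R m) (@edotZl R m)).
  rewrite -!enorm_sqr p1 -/r (edotC w p).
  have := ler_wpM2l r0 pw; nra.
have xE : x = (r / 2) *: v j + y by rewrite addrC subrK.
rewrite {1}xE; apply: le_trans (gaugeD n_gt0 v_opp v_basis _ _) _.
have h1 : gauge v ((r / 2) *: v j) <= r / 2.
  rewrite (gaugeZ n_gt0 v_opp v_basis) ger0_norm ?divr_ge0 // ler_piMr ?divr_ge0 //.
  apply/(gauge_leP n_gt0 v_opp v_basis); exact: gauge_le_gen.
have e0 : 0 <= (7 / 8) ^+ J * n%:R :> R by rewrite mulr_ge0 ?exprn_ge0 ?divr_ge0.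
have h2 : gauge v y <= (4 + (7 / 8) ^+ J * n%:R) * (7 / 8 * r).
  by apply: le_trans (IH y yb) _; rewrite ler_wpM2l // addr_ge0.
apply: le_trans (lerD h1 h2) _; rewrite -/w -/r exprS; lra.
Qed.

Lemma exists_geometric_le1 : exists J, (7 / 8) ^+ J * n%:R <= 1 :> R.
Proof.
have h J : (7 / 8) ^+ J * (1 + J%:R / 7) <= 1 :> R.
  elim: J => [|J IH]; first by rewrite expr0 mul0r addr0 mulr1.
  have A0 : 0 <= (7 / 8) ^+ J :> R by rewrite exprn_ge0 // divr_ge0.
  have := mulr_ge0 A0 (ler0n R J); rewrite exprS -[J.+1%:R]natr1; lra.
exists (7 * n)%N; apply: le_trans (h (7 * n)%N).
rewrite ler_wpM2l ?exprn_ge0 ?divr_ge0 // natrM mulrAC divff // mul1r; lra.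
Qed.

Lemma gauge_le_bnorm x : gauge v x <= 5 * bnorm x.
Proof.
have [J hJ] := exists_geometric_le1.
have blkx (b : 'I_nb) : gauge v (emb b (blk b x)) <= 5 * enorm (blk b x).
  have := @gauge_block_approx J b (emb b (blk b x)); rewrite blk_emb_blk => /(_ erefl).
  move=> /le_trans; apply; rewrite ler_wpM2r ?enorm_ge0 //; lra.
rewrite {1}(sum_emb_blk x) /bnorm mulr_sumr.
elim/big_rec2: _ => [|b y1 y2 _ h]; last first.
  exact: le_trans (gaugeD n_gt0 v_opp v_basis _ _) (lerD (blkx b) h).
by apply/(gauge_leP n_gt0 v_opp v_basis); apply: gauge_le0.
Qed.
End gauge_upper.
End blocks.

(** * Vertex sets of prescribed size that are nets of the block spheres *)
Section vertex_sets.
Variables (R : realType) (n m : nat).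
Hypothesis m_gt0 : (0 < m)%N.
Local Notation nb := (n %/ m).+1.
Local Notation sphere := (@sphere_point R n m).

Definition vertex_set (V : seq 'rV[R]_n) : Prop :=
  [/\ uniq V, {in V, forall p, sphere p}, {in V, forall p, - p \in V} & ~~ odd (size V)].

Lemma add_antipodal V p : vertex_set V -> sphere p -> p \notin V ->
  vertex_set [:: p, - p & V].
Proof.
move=> [uV sV oV eV] sp pV.
have pN : p != - p.
  by rewrite -addr_eq0 -mulr2n -scaler_nat scaler_eq0 pnatr_eq0 /= (sphere_point_neq0 sp).
split.
- rewrite /= inE negb_or pN pV uV andbT /= andbT; apply: contra pV => /oV.
  by rewrite opprK.
- move=> q; rewrite !inE => /or3P[/eqP ->//|/eqP ->|/sV //]; exact: sphere_pointN.
- move=> q; rewrite !inE => /or3P[/eqP ->|/eqP ->|/oV ->]; rewrite ?opprK ?eqxx ?orbT //.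
- by rewrite /= negbK.
Qed.

Lemma symmetrize (l : seq 'rV[R]_n) : {in l, forall p, sphere p} ->
  exists V, [/\ vertex_set V, {subset l <= V} & (size V <= 2 * size l)%N].
Proof.
elim: l => [_|p l IH sl]; first by exists [::].
have [|V [vV lV Vl]] := IH; first by move=> q ql; apply: sl; rewrite inE ql orbT.
have [pV|pV] := boolP (p \in V).
  exists V; split=> //; last by rewrite /=; lia.
  by move=> q; rewrite inE => /orP[/eqP ->|/lV].
exists [:: p, - p & V]; split; last by rewrite /=; lia.
  by apply: add_antipodal => //; apply: sl; rewrite mem_head.
by move=> q; rewrite !inE => /orP[->//|/lV ->]; rewrite !orbT.
Qed.

Lemma delta_emb (i : 'I_n) : delta_mx 0 i =
  emb (R := R) n (i %/ m) (delta_mx 0 (Ordinal (ltn_pmod i m_gt0))).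
Proof.
apply/rowP => k; rewrite (embE m_gt0).
have [e|e] := eqVneq (i %/ m)%N (k %/ m)%N; rewrite !mxE eqxx /=.
  rewrite (_ : (k == i) = (Ordinal (ltn_pmod k m_gt0) == Ordinal (ltn_pmod i m_gt0))) //.
  apply/eqP/eqP => [->//|/(congr1 val) /= h]; apply: val_inj.
  by rewrite /= (divn_eq k m) (divn_eq i m) e h.
by rewrite (_ : (k == i) = false) //; apply: contraNF e => /eqP ->.
Qed.

Lemma blk_delta (i : 'I_n) : blk m (i %/ m) (delta_mx 0 i : 'rV[R]_n) =
  delta_mx 0 (Ordinal (ltn_pmod i m_gt0)).
Proof.
rewrite delta_emb blk_emb // => j h; rewrite !mxE eqxx /= -val_eqE /=.
case: eqP => // e; move: h; rewrite e -divn_eq.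
by have := ltn_ord i; lia.
Qed.

Lemma enorm_delta (j : 'I_m) : enorm (delta_mx 0 j : 'rV[R]_m) = 1.
Proof.
have : enorm (delta_mx 0 j : 'rV[R]_m) ^+ 2 = 1.
  rewrite enormE (bigD1 j) //= big1 ?addr0 => [|i ij]; first by rewrite !mxE !eqxx expr1n.
  by rewrite mxE (negbTE ij) andbF expr0n.
move/eqP; rewrite sqrp_eq1 ?enorm_ge0 // => /eqP //.
Qed.

Lemma nb_ltn (i : 'I_n) : (i %/ m < nb)%N.
Proof. by rewrite ltnS leq_div2r // ltnW. Qed.

Lemma sphere_of_emb (b : 'I_nb) (w : 'rV[R]_m) : enorm w = 1 -> blk m b (emb n b w) = w ->
  sphere (emb n b w).
Proof.
move=> w1 wb; exists b; split; first by rewrite wb.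
by move=> c cb; apply: blk_emb_neq => //; rewrite eq_sym.
Qed.

Lemma sphere_delta (i : 'I_n) : sphere (delta_mx 0 i).
Proof.
rewrite delta_emb; apply: (sphere_of_emb (b := Ordinal (nb_ltn i))); first exact: enorm_delta.
by rewrite -delta_emb blk_delta.
Qed.

Section fresh.
Hypothesis m2 : (1 < m)%N.
Hypothesis mn : (m <= n)%N.

(** Infinitely many points of the unit sphere of the first block, from which the
    number of vertices can be adjusted to any even value. *)
Definition circle_coord (t : nat) : 'rV[R]_m :=
  \row_i (if i == 0%N :> nat then t.+1%:R^-1
          else if i == 1%N :> nat then Num.sqrt (1 - t.+1%:R^-1 ^+ 2) else 0).

Lemma enorm_circle_coord t : enorm (circle_coord t) = 1.
Proof.
have : enorm (circle_coord t) ^+ 2 = 1.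
  rewrite enormE (bigD1 (Ordinal m_gt0)) //= (bigD1 (Ordinal m2)) //= big1 ?addr0.
    rewrite !mxE /= sqr_sqrtr; first by rewrite addrC subrK.
    by rewrite subr_ge0 expr_le1 ?invf_le1 ?ler1n ?invr_ge0.
  move=> i /andP[i0 i1]; rewrite mxE.
  move: i0 i1; rewrite -!val_eqE /= => /negbTE -> /negbTE ->.
  by rewrite expr0n.
move/eqP; rewrite sqrp_eq1 ?enorm_ge0 // => /eqP //.
Qed.

Lemma blk_circle t : blk m 0 (emb n 0 (circle_coord t)) = circle_coord t.
Proof. by apply: blk_emb => // j; rewrite mul0n add0n; have := ltn_ord j; lia. Qed.

Lemma circle_inj : injective (fun t => emb n 0 (circle_coord t)).
Proof.
move=> s t /(congr1 (blk m 0)); rewrite !blk_circle => /rowP /(_ (Ordinal m_gt0)).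
by rewrite !mxE /= => /invr_inj /eqP; rewrite eqr_nat => /eqP [].
Qed.

Lemma exists_fresh (V : seq 'rV[R]_n) : exists2 p, sphere p & p \notin V.
Proof.
have [/hasP[t _ h]|/hasPn h] := boolP (has (fun t => emb n 0 (circle_coord t) \notin V) (iota 0 (size V).+1)).
  exists (emb n 0 (circle_coord t)) => //.
  by apply: (sphere_of_emb (b := ord0)); [exact: enorm_circle_coord|exact: blk_circle].
have : (size [seq emb n 0 (circle_coord t) | t <- iota 0 (size V).+1] <= size V)%N.
  apply: uniq_leq_size; first by rewrite map_inj_uniq ?iota_uniq //; exact: circle_inj.
  by move=> _ /mapP[t /h + ->]; rewrite negbK.
by rewrite size_map size_iota ltnn.
Qed.

Lemma extend_vertex_set V k : vertex_set V -> (size V <= k)%N -> ~~ odd k ->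
  exists V', [/\ vertex_set V', {subset V <= V'} & size V' = k].
Proof.
move=> vV Vk ek; have [d] : exists d, (k = size V + 2 * d)%N.
  have [_ _ _ eV] := vV; exists ((k - size V) %/ 2)%N; lia.
elim: d V vV {Vk} => [|d IH] V vV kE; first by exists V; split=> //; rewrite kE muln0 addn0.
have [p sp pV] := exists_fresh V.
have [|V' [vV' sub sz]] := IH _ (add_antipodal vV sp pV); first by rewrite kE /=; lia.
by exists V'; split=> // q qV; apply: sub; rewrite !inE qV !orbT.
Qed.
End fresh.

(** V contains a point of each block sphere within 60 degrees of any given
    direction. *)
Definition block_net (V : seq 'rV[R]_n) : Prop :=
  forall (b : 'I_nb) (x : 'rV[R]_n), blk m b x != 0 -> exists p : 'rV[R]_m,
    [/\ emb n b p \in V, blk m b (emb n b p) = p, enorm p = 1 &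
      enorm (blk m b x) / 2 <= edot p (blk m b x)].

Lemma edot_delta (j : 'I_m) (w : 'rV[R]_m) : edot (delta_mx 0 j) w = w 0 j.
Proof.
rewrite /edot (bigD1 j) //= big1 ?addr0 => [|i ij]; first by rewrite mxE !eqxx mul1r.
by rewrite mxE (negbTE ij) andbF mul0r.
Qed.

Lemma embN b (w : 'rV[R]_m) : emb n b (- w) = - emb n b w.
Proof. exact: mulNmx. Qed.

(** In dimension at most 4, the largest coordinate of a vector is at least half
    of its norm. *)
Lemma small_block_net V : (m <= 4)%N -> vertex_set V -> (forall i, delta_mx 0 i \in V) ->
  block_net V.
Proof.
move=> m4 [_ _ oV _] dV b x; set w := blk m b x => w0.
have [j wj] : exists j, enorm w / 2 <= `|w 0 j|.
  apply/not_existsP => h.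
  have wp : 0 < enorm w.
    by rewrite lt_def enorm_ge0 andbT; apply: contra_neq w0; exact: enorm_eq0.
  have lt j : w 0 j ^+ 2 < (enorm w / 2) ^+ 2.
    rewrite -(real_normK (num_real (w 0 j))) ltrXn2r ?nnegrE ?divr_ge0 ?enorm_ge0 //.
    by rewrite ltNge; apply/negP/h.
  have : \sum_j w 0 j ^+ 2 < \sum_(j < m) (enorm w / 2) ^+ 2.
    apply: ltr_sum => [|j _]; last exact: lt.
    by apply/hasP; exists (Ordinal m_gt0); rewrite ?mem_index_enum.
  rewrite -enormE sumr_const card_ord -[ltRHS]mulr_natl.
  have : m%:R <= 4 :> R by rewrite ler_nat.
  by rewrite expr_div_n; have := exprn_gt0 2 wp; nra.
have wj0 : w 0 j != 0.
  apply: contra_neq w0 => wj0; apply: enorm_eq0; apply/le_anti; rewrite enorm_ge0 andbT.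
  by move: wj; rewrite wj0 normr0; lra.
have jn : (b * m + j < n)%N.
  by rewrite ltnNge; apply: contra wj0 => h; rewrite /w blk_out.
pose i := Ordinal jn.
have eb : emb n b (delta_mx 0 j) = delta_mx 0 i :> 'rV[R]_n.
  rewrite delta_emb /= divnMDl // (divn_small (ltn_ord j)) addn0; congr emb; congr (delta_mx 0 _).
  by apply: val_inj; rewrite /= modnMDl modn_small.
have bb : blk m b (emb n b (delta_mx 0 j)) = delta_mx 0 j :> 'rV[R]_m.
  by rewrite eb; have := blk_delta i; rewrite /= divnMDl // (divn_small (ltn_ord j)) addn0 => ->;
     congr (delta_mx 0 _); apply: val_inj; rewrite /= modnMDl modn_small.
have [wp|wn] := leP 0 (w 0 j).
  exists (delta_mx 0 j); split; rewrite ?eb ?enorm_delta //; first by rewrite -eb.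
  by rewrite edot_delta; move: wj; rewrite ger0_norm.
exists (- delta_mx 0 j); split.
- by rewrite embN eb oV.
- by rewrite embN blkN bb.
- by rewrite enormN enorm_delta.
- by rewrite (dotNl (@edotZl R m)) edot_delta; move: wj; rewrite ltr0_norm.
Qed.

Lemma block_net_sub V V' : {subset V <= V'} -> block_net V -> block_net V'.
Proof. by move=> sub net b x /net[p [pV h1 h2 h3]]; exists p; split=> //; exact: sub. Qed.

Definition lattice_vec (a : box m (2 * m)) : 'rV[R]_m := \row_j centered R (2 * m) (a j).

Definition short_vecs : {set box m (2 * m)} :=
  [set a : box m (2 * m) | (\sum_j centered_abs (2 * m) (a j) ^ 2 <= 4 * m)%N]%SET.

Lemma short_vecsP a : (a \in short_vecs) = (enorm (lattice_vec a) ^+ 2 <= 4 * m%:R).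
Proof.
rewrite inE -natrM -(ler_nat R) enormE natr_sum; congr (_ <= _).
by apply: eq_bigr => j _; rewrite mxE centered_sqr.
Qed.

Lemma card_short_vecs : #|short_vecs|%:R <= expR (3 * m%:R) * 8 ^+ m :> R.
Proof.
have -> : 8 ^+ m = \prod_(i < m) (4 / 2^-1) :> R.
  by rewrite prodr_const card_ord; congr (_ ^+ _); rewrite invrK -natrM.
apply: (@card_lattice_le R m _ (mem short_vecs) (fun=> 2^-1)
  (fun a i => (a i)%:Z - (2 * m)%:Z) (fun a i => centered R (2 * m) (a i) / 2)).
- by move=> i; apply/andP; split; lra.
- move=> a b _ _ e; apply/ffunP => i; apply: val_inj.
  by have /addIr [] := e i.
- move=> a i _; rewrite intrB -!pmulrn -/(centered R (2 * m) (a i)).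
  by rewrite normrM normfV (ger0_norm (ler0n _ 2)) mulrC lerDr.
- move=> a aS; have h : enorm (lattice_vec a) ^+ 2 <= 4 * m%:R by rewrite -short_vecsP.
  rewrite enormE in h.
  have -> : \sum_i (centered R (2 * m) (a i) / 2) ^+ 2 = 4^-1 * \sum_i lattice_vec a 0 i ^+ 2.
    by rewrite mulr_sumr; apply: eq_bigr => i _; rewrite mxE; field.
  by move: h; lra.
Qed.

(** Scale the given vector to norm 2 sqrt m and round its coordinates towards 0.
    The rounded vector z is no longer than y, it satisfies |z|^2 <= <z, y>, and
    |y - z| <= sqrt m, whence |z| >= sqrt m; so z makes an angle of cosine
    at least 1/2 with y.  Rounding towards 0 also keeps the coordinates that are
    missing from an incomplete block equal to 0. *)
Lemma exists_short_vec (b : 'I_nb) (x : 'rV[R]_n) : blk m b x != 0 ->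
  exists a, [/\ a \in short_vecs, blk m b (emb n b (lattice_vec a)) = lattice_vec a,
    0 < enorm (lattice_vec a) &
    enorm (blk m b x) / 2 * enorm (lattice_vec a) <= edot (lattice_vec a) (blk m b x)].
Proof.
set w := blk m b x => w0.
have r0 : 0 < enorm w.
  by rewrite lt_def enorm_ge0 andbT; apply: contra_neq w0; exact: enorm_eq0.
set r := enorm w in r0 *; set t := Num.sqrt (m%:R : R).
have m1 : 1 <= m%:R :> R by rewrite ler1n.
have tt : t ^+ 2 = m%:R by rewrite sqr_sqrtr //; lra.
have t0 : 0 < t by rewrite sqrtr_gt0; lra.
pose y : 'rV[R]_m := (2 * t / r) *: w.
have c0 : 0 < 2 * t / r by rewrite divr_gt0 // mulr_gt0.
have y_norm : enorm y = 2 * t by rewrite enormZ gtr0_norm // divfK // gt_eqF.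
have y4 : enorm y ^+ 2 = 4 * m%:R by rewrite y_norm -tt; ring.
pose q j := Num.truncn `|y 0 j|.
have ql j : (q j)%:R <= `|y 0 j| by rewrite truncn_le.
have qg j : `|y 0 j| < (q j).+1%:R by rewrite truncnS_gt.
have q2 j : (q j <= 2 * m)%N.
  rewrite -(ler_nat R) natrM; apply: le_trans (ql j) _; apply: le_trans (coord_le_enorm _ _) _.
  rewrite y_norm ler_pM2l // -tt; have : 1 <= t by rewrite -sqrtr1 ler_sqrt; lra.
  by move=> t1; rewrite expr2 ler_peMr // ltW.
have hq' j : ((if (0 <= y 0 j)%R then 2 * m + q j else 2 * m - q j) < (2 * m + 2 * m).+1)%N.
  by case: ifP; have := q2 j; lia.
pose a : box m (2 * m) := [ffun j => Ordinal (hq' j)].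
have zE j : lattice_vec a 0 j = if 0 <= y 0 j then (q j)%:R else - (q j)%:R.
  rewrite mxE ffunE /= /centered; case: ifP => _; first by rewrite natrD; ring.
  by rewrite natrB //; ring.
have zn j : `|lattice_vec a 0 j| = (q j)%:R.
  by rewrite zE; case: ifP; rewrite ?normrN ger0_norm.
have yz j : lattice_vec a 0 j ^+ 2 <= lattice_vec a 0 j * y 0 j.
  have h := ql j; have q0 := ler0n R (q j); rewrite zE; case: ifP h => [y0|/negbT].
    by rewrite ger0_norm // => h; rewrite expr2 ler_wpM2l.
  by rewrite -ltNge => y0; rewrite ltr0_norm // => h; rewrite sqrrN expr2 mulNr -mulrN ler_wpM2l.
have yz1 j : `|(y - lattice_vec a) 0 j| <= 1.
  have := ql j; have := qg j; rewrite -natr1 [(y - _) 0 j]mxE [(- lattice_vec a) 0 j]mxE zE.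
  case: ifP => [y0|/negbT]; first by rewrite ger0_norm // => *; rewrite ger0_norm; lra.
  by rewrite -ltNge => y0; rewrite ltr0_norm // => *; rewrite opprK ler0_norm; lra.
set z := lattice_vec a in zE zn yz yz1 *.
have zt : t <= enorm z.
  have := enorm_le_coord yz1 ler01; rewrite mulr1 -/t.
  have := enormD (y - z) z; rewrite subrK y_norm; lra.
have z0 : 0 < enorm z by apply: lt_le_trans zt.
exists a; rewrite -/z; split=> //.
- rewrite short_vecsP -y4 !enormE; apply: ler_sum => j _.
  rewrite -(real_normK (num_real (z 0 j))) -(real_normK (num_real (y 0 j))).
  by rewrite lerXn2r ?nnegrE // zn.
- apply: (blk_emb m_gt0) => j jn; apply/eqP; rewrite -normr_eq0 zn pnatr_eq0.
  by rewrite /q /y mxE /w blk_out // mulr0 normr0 truncn0.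
- have -> : edot z w = r / (2 * t) * edot z y.
    rewrite /y (dotZr (@edotC R m) (@edotZl R m)) mulrA -[r / _ * _]mulrA.
    by rewrite [X in _ * X * _](_ : _ = r^-1) ?divff ?mul1r //; [rewrite gt_eqF|field; rewrite !gt_eqF].
  have h : enorm z ^+ 2 <= edot z y by rewrite enormE; apply: ler_sum => j _; exact: yz.
  apply: (@le_trans _ _ (r / (2 * t) * enorm z ^+ 2)).
    have -> : r / 2 = r / (2 * t) * t by field; rewrite gt_eqF.
    by rewrite expr2 mulrA ler_wpM2r ?enorm_ge0 // ler_wpM2l // divr_ge0 ?mulr_ge0 ?ltW.
  by rewrite ler_wpM2l // divr_ge0 ?ltW // mulr_gt0.
Qed.

Definition short_point (b : 'I_nb) (a : box m (2 * m)) : 'rV[R]_n :=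
  emb n b ((enorm (lattice_vec a))^-1 *: lattice_vec a).

(** The filter removes the zero vector and the vectors that do not fit in an
    incomplete block. *)
Definition short_points : seq 'rV[R]_n :=
  [seq p <- [seq short_point b a | b <- enum 'I_nb, a <- enum short_vecs] | bnorm m p == 1].

Lemma size_short_points : (size short_points <= nb * #|short_vecs|)%N.
Proof.
by rewrite size_filter (leq_trans (count_size _ _)) // size_allpairs -!cardE card_ord.
Qed.

Lemma short_points_sphere : {in short_points, forall p, sphere p}.
Proof.
move=> p; rewrite mem_filter => /andP[/eqP p1 /allpairsP[[b a] /= [_ _ pE]]].
have p0 (c : 'I_nb) : c != b -> blk m c p = 0.
  by move=> cb; rewrite pE; apply: blk_emb_neq => //; rewrite eq_sym.
exists b; split=> //; rewrite -p1 /bnorm (bigD1 b) //= big1 ?addr0 // => c /p0 ->.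
exact: enorm0.
Qed.

Lemma short_points_net : block_net short_points.
Proof.
move=> b x /exists_short_vec [a [aS ab a0 ax]].
pose p := (enorm (lattice_vec a))^-1 *: lattice_vec a; exists p.
have p1 : enorm p = 1 by rewrite /p enormZ gtr0_norm ?invr_gt0 // mulVf // gt_eqF.
have pb : blk m b (emb n b p) = p by rewrite /p embZ blkZ ab.
split=> //; last first.
  by rewrite /p edotZl ler_pdivlMl // mulrC.
rewrite mem_filter; apply/andP; split.
  by rewrite (sphere_point_bnorm (sphere_of_emb p1 pb)).
by apply/allpairsP; exists (b, a); rewrite /= !mem_enum aS.
Qed.

End vertex_sets.

Section existence.
Variables (R : realType) (n k : nat) (rho : R).
Hypothesis n_gt0 : (0 < n)%N.
Hypothesis k_even : ~~ odd k.
Hypothesis krho : k%:R = rho * n%:R.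
Hypothesis rho2 : 2 <= rho.
Hypothesis rhoe : rho <= expR n%:R.

Let basis := [seq (delta_mx 0 i : 'rV[R]_n) | i <- enum 'I_n].

Let basis_in i : delta_mx 0 i \in basis.
Proof. by apply: map_f; rewrite mem_enum. Qed.

Let k2n : (2 * n <= k)%N.
Proof. by rewrite -(ler_nat R) krho natrM ler_wpM2r. Qed.

(** If ln rho is large, m = floor (ln rho / 8) leaves enough room for the short
    lattice vectors of all the blocks: together with the basis they are at most
    n + n rho / 4, and symmetrisation at most doubles this.  Otherwise blocks of
    dimension 2 suffice, or of dimension 1 if n = 1, where the hypothesis
    rho <= e forces k = 2. *)
Lemma exists_vertex_set : exists m (V : seq 'rV[R]_n),
  [/\ (0 < m <= n)%N, ln rho <= 16 * m%:R, vertex_set m V /\ size V = k,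
     (forall i, delta_mx 0 i \in V) & block_net m V].
Proof.
have np : 0 < n%:R :> R by rewrite ltr0n.
have rp : 0 < rho by apply: lt_le_trans rho2.
have lnn : ln rho <= n%:R by rewrite -ler_expR lnK.
have basis_size : size basis = n by rewrite size_map -cardE card_ord.
have basis_sphere m : (0 < m)%N -> {in basis, forall p, sphere_point m p}.
  by move=> m0 p /mapP[i _ ->]; exact: sphere_delta.
have [big|small] := leP 16 (ln rho).
  pose m := Num.truncn (ln rho / 8).
  have m1 : m%:R <= ln rho / 8 by rewrite truncn_le //; lra.
  have m2 : ln rho / 8 < m.+1%:R by rewrite truncnS_gt.
  have m3 : (1 < m)%N.
    by rewrite -(ltr_nat R) ltNge; apply/negP => h; move: m2; rewrite -[m.+1%:R]natr1; lra.
  have mn : (m <= n)%N by rewrite -(ler_nat R); lra.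
  have m0 : (0 < m)%N by apply: ltnW.
  have sph : {in basis ++ short_points R n m, forall p, sphere_point m p}.
    by move=> p; rewrite mem_cat => /orP[/(basis_sphere _ m0)//|]; exact: short_points_sphere.
  have [V [vV sV Vs]] := symmetrize m0 sph.
  have Vk : (size V <= k)%N.
    rewrite (leq_trans Vs) // size_cat basis_size -(ler_nat R) krho.
    have e2 : 2 <= expR 1 :> R by apply: le_trans (expR_ge1Dx _); lra.
    have eX (c : R) d : c <= 2 ^+ d -> 0 <= c -> c <= expR d%:R.
      move=> cd c0; apply: le_trans cd _; rewrite -[d%:R]mulr1 expRM_natl.
      by rewrite lerXn2r ?nnegrE ?expR_ge0.
    set S : R := #|short_vecs m|%:R.
    have S1 : 1 <= S.
      rewrite ler1n; apply/card_gt0P; exists [ffun=> inord (2 * m)]; rewrite inE big1 // => j _.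
      by rewrite ffunE inordK ?ltnS ?leq_addr // /centered_abs subnn.
    have S4 : 4 * S <= rho.
      have hS := card_short_vecs R m; rewrite -/S in hS.
      apply: (@le_trans _ _ (expR (8 * m%:R))); last first.
        by rewrite -ler_ln ?posrE ?expR_gt0 // expRK mulrC -ler_pdivlMr.
      have -> : 8 * m%:R = 2 * m%:R + (3 * m%:R + m%:R * 3) :> R by ring.
      rewrite !expRD; apply: ler_pM => //.
        apply: (@le_trans _ _ (expR 2)); first by apply: (eX _ 2) => //; rewrite -natrX.
        by rewrite ler_expR ler_peMr // ler1n.
      apply: le_trans hS _; rewrite ler_pM2l ?expR_gt0 // expRM_natl lerXn2r ?nnegrE ?expR_ge0 //.
      by apply: (eX _ 3) => //; rewrite -natrX.
    have nbn : ((n %/ m).+1 <= n)%N.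
      exact: ltn_Pdiv.
    have hs : (size (short_points R n m))%:R <= n%:R * S :> R.
      apply: (@le_trans _ _ ((n %/ m).+1 * #|short_vecs m|)%:R).
        by rewrite ler_nat size_short_points.
      by rewrite natrM ler_wpM2r // ler_nat.
    rewrite natrM natrD; have := ler_wpM2l (ltW np) S4; have := ler_wpM2l (ltW np) S1; lra.
  have [V' [vV' sub sz]] := extend_vertex_set m0 m3 mn vV Vk k_even.
  exists m, V'; split=> //.
  - by rewrite m0.
  - have : 1 <= m%:R :> R by rewrite ler1n.
    move: m2; rewrite -[m.+1%:R]natr1; lra.
  - by move=> i; apply/sub/sV; rewrite mem_cat basis_in.
  - apply: block_net_sub (short_points_net m0) => p ps.
    by apply/sub/sV; rewrite mem_cat ps orbT.
pose m := minn 2 n.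
have m0 : (0 < m)%N by rewrite /m; lia.
have mn : (m <= n)%N by rewrite /m; lia.
have [V [vV sV Vs]] := symmetrize m0 (basis_sphere _ m0).
have [V' [vV' sub sz]] : exists V', [/\ vertex_set m V', {subset V <= V'} & size V' = k].
  rewrite basis_size in Vs.
  have [n1|n1] := leqP n 1; last first.
    by apply: extend_vertex_set => //; [rewrite /m; lia|exact: leq_trans Vs k2n].
  have n1E : n = 1%N by lia.
  exists V; split=> //.
  have k4 : (k < 4)%N.
    rewrite -(ltr_nat R) krho n1E mulr1; apply: le_lt_trans (expR1_lt4 R).
    by move: rhoe; rewrite n1E.
  have V0 : (0 < size V)%N.
    by have := sV _ (basis_in (Ordinal n_gt0)); case: (V).
  have [_ _ _ eV] := vV.
  have := k2n; move: k_even; lia.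
exists m, V'; split=> //.
- by rewrite m0.
- have : 1 <= m%:R :> R by rewrite ler1n.
  lra.
- by move=> i; apply/sub/sV.
- apply: small_block_net => //; first by rewrite /m; lia.
  by move=> i; apply/sub/sV.
Qed.
End existence.

(** * The partition of the l_1 sum *)
Section block_partition.
Variables (R : realType) (n m : nat) (X : norm_on R n).
Hypothesis m_gt0 : (0 < m)%N.
Local Notation nb := (n %/ m).+1.
Local Notation V := (normed_space X).
Hypothesis X_le : forall x : 'rV[R]_n, X x <= 5 * bnorm m x.
Hypothesis X_ge : forall x : 'rV[R]_n, bnorm m x <= X x.
Variables (r0 L : nat).
Hypothesis r0_ge : (m <= r0)%N.
Hypothesis r0L : (r0 + 4 * m <= L)%N.
Hypothesis r0_le : (r0 <= 12 * m ^ 2)%N.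
Hypothesis local_sep : forall x y : 'rV[R]_m, enorm (x - y) <= 1 ->
    (cell_prob m L (~` same_cell L r0 x y) <=
      (7 * Num.sqrt m%:R / m%:R ^+ 2 * enorm (x - y))%:E)%E.
Variable Delta : R.
Hypothesis Delta_gt0 : 0 < Delta.

(** The cells of a block have Euclidean diameter at most 28 m^2.  Hence those of
    the sum of nb blocks have bnorm-diameter at most 28 nb m^2, and X-diameter
    at most 140 nb m^2; space is dilated so that this corresponds to Delta. *)
Definition dilation : R := 140 * nb%:R * m%:R ^+ 2 / Delta.
Local Notation lam := dilation.

Let mp : 0 < m%:R :> R. Proof. by rewrite ltr0n. Qed.
Let nbp : 0 < nb%:R :> R. Proof. by rewrite ltr0n. Qed.
Let lam0 : 0 < lam.
Proof.
by apply: divr_gt0 => //; apply: mulr_gt0 (exprn_gt0 _ mp); apply: mulr_gt0 nbp; rewrite ltr0n.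
Qed.

(** The same order and radius serve for all the blocks, so that the probability
    space remains an interval. *)
Definition block_cell (w : R) (c : {ffun 'I_nb -> {ffun 'I_m -> int}}) (x : 'rV[R]_n) : Prop :=
  forall b : 'I_nb, random_cell L r0 w (c b) (lam *: blk m b x).

Definition block_cluster (i : nat) (w : R) : set V :=
  [set x : V | exists2 c : {ffun 'I_nb -> {ffun 'I_m -> int}}, pickle c = i & block_cell w c x].

Lemma block_cell_cover w x : exists c, block_cell w c x.
Proof.
have h (b : 'I_nb) := random_cell_cover L m_gt0 r0_ge w (lam *: blk m b x).
exists [ffun b => projT1 (cid (h b))] => b; rewrite ffunE; by case: cid.
Qed.

Lemma block_cell_uniq w c c' x : block_cell w c x -> block_cell w c' x -> c = c'.
Proof.
move=> h h'; apply/ffunP => b.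
exact: (random_cell_uniq m_gt0 r0L (h b) (h' b)).
Qed.

Lemma block_cell_right_open c x : right_open [set w | block_cell w c x].
Proof.
move=> w h; apply: filter_forall => b.
exact: (random_cell_right_open m_gt0 r0L (h b)).
Qed.

Lemma block_random_partition : random_partition block_cluster.
Proof.
split=> [i E _|w].
  apply: right_open_measurable => w [x [Ex [c ci hc]]].
  near=> w'; exists x; split=> //; exists c => //.
  near: w'; exact: block_cell_right_open hc.
split.
  apply/seteqP; split=> // x _; have [c hc] := block_cell_cover w x.
  by exists (pickle c) => //; exists c.
apply/trivIsetP => i j _ _ ij; apply/seteqP; split=> // x [[c ci hc] [c' cj hc']].
by move: ij; rewrite -ci -cj (block_cell_uniq hc hc') eqxx.
Unshelve. all: by end_near. Qed.

Lemma block_bounded : bounded_partition block_cluster Delta.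
Proof.
move=> w i; apply: ge_ereal_sup => _ [x [c ci hx] [y [c' cj hy] <-]]; rewrite lee_fin.
have cc : c' = c.
  by apply: (pcan_inj pickleK); rewrite ci cj.
subst c'; rewrite /mdist /=; apply: le_trans (X_le (x - y)) _.
have m1 : 1 <= m%:R :> R by rewrite ler1n.
have r1 : radius_at m r0 w <= 14 * m%:R ^+ 2.
  have /andP[_ h] := radius_at_itv r0 m_gt0 w; apply: ltW (lt_le_trans h _).
  have : r0%:R <= 12 * m%:R ^+ 2 :> R by rewrite -natrX -natrM ler_nat.
  rewrite natrM; have : m%:R <= m%:R ^+ 2 :> R by rewrite expr2 ler_peMl // ltW.
  lra.
have blkle (b : 'I_nb) : enorm (blk m b (x - y)) <= 28 * m%:R ^+ 2 / lam.
  have e : enorm (blk m b (x - y)) * lam = enorm (lam *: blk m b x - lam *: blk m b y).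
    by rewrite mulrC -{1}(gtr0_norm lam0) -enormZ blkB scalerBr.
  rewrite ler_pdivlMr // e.
  have := enorm_dist_triangle (vec_of R (c b)) (lam *: blk m b x) (lam *: blk m b y).
  rewrite (enorm_distC (vec_of R (c b))).
  have [hx1 _] := hx b; have [hy1 _] := hy b; lra.
apply: (@le_trans _ _ (5 * \sum_(b < nb) (28 * m%:R ^+ 2 / lam))).
  by rewrite ler_pM2l // /bnorm; apply: ler_sum.
rewrite sumr_const card_ord -[_ *+ nb]mulr_natl /lam le_eqVlt; apply/orP; left; apply/eqP.
by field; rewrite !gt_eqF.
Qed.

Definition sep_prob (x y : V) : \bar R := cell_prob m L (~` same_cluster block_cluster x y).

Lemma acc_normed (x : V) : closed [set x].
Proof. exact/accessible_closed_set1/hausdorff_accessible/norm_hausdorff. Qed.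

Lemma sep_prob_triangle x y z : (sep_prob x z <= sep_prob x y + sep_prob y z)%E.
Proof.
have ms a b : measurable (~` same_cluster block_cluster a b).
  by apply: measurableC; exact: (measurable_same_cluster block_random_partition acc_normed).
apply: (le_trans _ (measureU2 (cell_prob m L) (ms x y) (ms y z))).
apply: le_measure; [apply/mem_set; exact: ms|apply/mem_set; apply: measurableU; exact: ms|].
rewrite !same_clusterE; try exact: block_random_partition.
move=> w /= xz; have [xy|] := pselect (cluster_of block_cluster w x = cluster_of block_cluster w y); last by left.
by right=> yz; apply: xz; rewrite xy.
Qed.

Let kappa : R := 980 * nb%:R * Num.sqrt m%:R / Delta.

(** Union bound over the blocks; the Euclidean norms of the blocks of x - y add
    up to bnorm (x - y). *)
Lemma sep_prob_local (x y : V) : lam * bnorm m (x - y) <= 1 ->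
  (sep_prob x y <= (kappa * bnorm m (x - y))%:E)%E.
Proof.
move=> xy1.
have ms (b : 'I_nb) : measurable (~` same_cell L r0 (lam *: blk m b x) (lam *: blk m b y)).
  by apply: measurableC; apply: right_open_measurable; apply: same_cell_right_open.
have bE (b : 'I_nb) : enorm (lam *: blk m b x - lam *: blk m b y) = lam * enorm (blk m b (x - y)).
  by rewrite -scalerBr -blkB enormZ gtr0_norm.
apply: (@le_trans _ _ (\sum_(b < nb) cell_prob m L
    (~` same_cell L r0 (lam *: blk m b x) (lam *: blk m b y)))%E).
  apply: (le_trans _ (measure_bigsetU_le (cell_prob m L) (index_enum _) xpredT ms)).
  apply: le_measure.
  - apply/mem_set; apply: measurableC.
    exact: (measurable_same_cluster block_random_partition acc_normed).
  - by apply/mem_set; apply: bigsetU_measurable => b _; exact: ms.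
  move=> w /= nsame; apply: contrapT => nU; apply: nsame.
  have h (b : 'I_nb) : same_cell L r0 (lam *: blk m b x) (lam *: blk m b y) w.
    apply: contrapT => nb'; apply: nU; rewrite (bigD1 b) //=; by left.
  pose c : {ffun 'I_nb -> {ffun 'I_m -> int}} := [ffun b => projT1 (cid (h b))].
  exists (pickle c); split; exists c => // b; rewrite ffunE; by case: cid => ? [].
apply: (@le_trans _ _ (\sum_(b < nb) (7 * Num.sqrt m%:R / m%:R ^+ 2 * (lam * enorm (blk m b (x - y))))%:E)%E).
  apply: lee_sum => b _; rewrite -bE; apply: local_sep; rewrite bE.
  by apply: le_trans xy1; rewrite ler_pM2l // enorm_blk_le.
rewrite sumEFin lee_fin -mulr_sumr -mulr_sumr -/(bnorm m (x - y)) mulrA ler_wpM2r ?bnorm_ge0 //.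
rewrite /kappa /lam le_eqVlt; apply/orP; left; apply/eqP.
by field; rewrite !gt_eqF.
Qed.

(** The local bound extends to all distances by subdividing the segment from x to
    y, since the probability of separation satisfies the triangle inequality. *)
Lemma sep_prob_le (x y : V) : (sep_prob x y <= (kappa * bnorm m (x - y))%:E)%E.
Proof.
pose Q := (Num.truncn (lam * bnorm m (x - y))).+1.
have Qp : 0 < Q%:R :> R by rewrite ltr0n.
have hQ : lam * bnorm m (x - y) <= Q%:R by rewrite ltW // truncnS_gt.
pose p (i : nat) : V := x + (i%:R / Q%:R) *: (y - x).
have pS i : p i - p i.+1 = Q%:R^-1 *: (x - y).
  rewrite /p opprD addrACA subrr add0r -scalerBl -mulrBl -natr1 opprD addrA subrr add0r.
  by rewrite mulN1r scaleNr -scalerN opprB.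
have step i : (sep_prob (p i) (p i.+1) <= (kappa * bnorm m (x - y) / Q%:R)%:E)%E.
  have e : bnorm m (p i - p i.+1) = bnorm m (x - y) / Q%:R.
    by rewrite pS bnormZ gtr0_norm ?invr_gt0 // mulrC.
  rewrite -mulrA -e; apply: sep_prob_local.
  by rewrite e mulrA ler_pdivrMr // mul1r.
have chain i : (sep_prob x (p i) <= (i%:R * (kappa * bnorm m (x - y) / Q%:R))%:E)%E.
  elim: i => [|i IH].
    have e : ~` same_cluster block_cluster x x = set0.
      rewrite same_clusterE; last exact: block_random_partition.
      by apply/seteqP; split=> w //=; apply.
    have e0 : sep_prob x x = 0%E by rewrite /sep_prob e; exact: measure0.
    by rewrite /p mul0r scale0r addr0 mul0r e0.
  apply: le_trans (sep_prob_triangle _ (p i) _) _.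
  by apply: le_trans (leeD IH (step i)) _; rewrite -EFinD lee_fin -natr1; lra.
have := chain Q; rewrite /p divff ?gt_eqF // scale1r addrC subrK => h.
by apply: le_trans h _; rewrite mulrC divfK // gt_eqF.
Qed.

Lemma block_admits : admits_separating V Delta (980 * nb%:R * Num.sqrt m%:R).
Proof.
exists _, _, (cell_prob m L : probability _ R), block_cluster; split.
- exact: block_random_partition.
- exact: block_bounded.
move=> x y; have := sep_prob_le x y; rewrite /sep_prob same_clusterE; last exact: block_random_partition.
have kappa0 : 0 <= kappa.
  rewrite /kappa; apply: divr_ge0 (ltW Delta_gt0); apply: mulr_ge0 (sqrtr_ge0 _).
  by apply: mulr_ge0 (ltW nbp); exact: ler0n.
move=> /le_trans; apply; rewrite lee_fin; apply: (ler_wpM2l kappa0); exact: X_ge.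
Qed.
End block_partition.

Section upper_bound.
Variable R : realType.

(** The number nb of blocks is at most 2n / m, so that nb sqrt m is at most of
    order n / sqrt m, and ln rho <= 16 m. *)
Lemma SEP_upper_bound (n k : nat) (rho : R) : (0 < n)%N -> ~~ odd k ->
  k%:R = rho * n%:R -> 2 <= rho <= expR n%:R ->
  exists X : norm_on R n,
    [/\ is_polytope (@unit_ball R (normed_space X)),
        (vertices (@unit_ball R (normed_space X)) #= `I_k)%card &
        (SEP (normed_space X) <= (8000 * (n%:R / Num.sqrt (ln rho)))%:E)%E].
Proof.
move=> n0 ke krho /andP[rho2 rhoe].
have [m [V [/andP[m0 mn] mrho [[uV sV oV _] sz] dV net]]] := exists_vertex_set n0 ke krho rho2 rhoe.
have szE : size V == k by apply/eqP.
pose v (j : 'I_k) : 'rV[R]_n := tnth (Tuple szE) j.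
have vV j : v j \in V := mem_tnth j (Tuple szE).
have Vv p : p \in V -> exists j, v j = p.
  by move=> pV; have /tnthP[j ->] : p \in Tuple szE by []; exists j.
have v_inj : injective v by apply/tuple_uniqP.
have v_sph j : sphere_point m (v j) by apply: sV.
have v_opp j : exists j', v j' = - v j by apply/Vv/oV.
have v_basis i : exists j, v j = delta_mx 0 i by apply/Vv/dV.
have v_net (b : 'I_(n %/ m).+1) (x : 'rV[R]_n) : blk m b x != 0 -> exists j p,
    [/\ v j = emb n b p, blk m b (v j) = p, enorm p = 1 &
        enorm (blk m b x) / 2 <= edot p (blk m b x)].
  by move=> /net[p [pV h1 h2 h3]]; have [j vj] := Vv _ pV; exists j, p; rewrite vj.
have v_le1 j : bnorm m (v j) <= 1 by rewrite (sphere_point_bnorm (v_sph j)).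
pose X := gauge_norm n0 v_opp v_basis (@bnormZ R n m) (@bnormD R n m) v_le1 (bnorm_eq0 m0).
exists X; split.
- exact: gauge_polytope.
- apply: gauge_vertices_card => // j y z t; exact: sphere_point_extreme.
have np : 0 < n%:R :> R by rewrite ltr0n.
have m1 : 1 <= m%:R :> R by rewrite ler1n.
have [r0 [L [h1 h2 h3 h4]]] := exists_good_radius R m0.
apply: (@le_trans _ _ (980 * (n %/ m).+1%:R * Num.sqrt m%:R)%:E).
  apply: ereal_inf_lbound; exists (980 * (n %/ m).+1%:R * Num.sqrt m%:R); last by [].
  split.
    apply: mulr_gt0; last by rewrite sqrtr_gt0; lra.
    by apply: mulr_gt0; rewrite ltr0n.
  move=> Delta D0; apply: (block_admits m0 _ _ h1 h2 h3 h4 D0).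
    by move=> x; apply: gauge_le_bnorm.
  move=> x; apply: (lower_le_gauge n0 v_opp v_basis _ _ v_le1); [exact: bnormZ|exact: bnormD].
rewrite lee_fin; set t := Num.sqrt (m%:R : R); set u := Num.sqrt (ln rho).
have L0 := ln_ge_half rho2.
have tt : t ^+ 2 = m%:R by rewrite sqr_sqrtr.
have u0 : 0 < u by rewrite sqrtr_gt0; lra.
have t0 : 0 < t by rewrite sqrtr_gt0; lra.
have ut : u <= 4 * t.
  rewrite -ler_sqr ?nnegrE; [|exact: ltW|by rewrite ltW // mulr_gt0].
  rewrite exprMn tt sqr_sqrtr; last by lra.
  by apply: le_trans mrho _; lra.
have nbm : (n %/ m).+1%:R * t ^+ 2 <= 2 * n%:R :> R.
  have le : ((n %/ m).+1 * m <= 2 * n)%N by rewrite mulSn mul2n -addnn leq_add // leq_trunc_div.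
  by rewrite tt; move: le; rewrite -(ler_nat R) !natrM.
rewrite mulrA ler_pdivlMr //.
apply: (@le_trans _ _ (980 * (n %/ m).+1%:R * t * (4 * t))).
  by apply: ler_wpM2l ut; apply: mulr_ge0 (ltW t0); apply: mulr_ge0; exact: ler0n.
by move: nbm; rewrite expr2; lra.
Qed.
End upper_bound.

(** * The separation modulus of polytopal norms *)
Theorem theorem74 (R : realType) :
  (exists c : R, 0 < c /\
     forall (n : nat) (X : norm_on R n) (k : nat) (rho : R),
       (0 < n)%N ->
       is_polytope (@unit_ball R (normed_space X)) ->
       (vertices (@unit_ball R (normed_space X)) #= `I_k)%card ->
       k%:R = rho * n%:R ->
       2 <= rho /\
       ((c * (n%:R / Num.sqrt (ln rho)))%:E <= SEP (normed_space X))%E)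
  /\
  (exists C : R, 0 < C /\
     forall (n k : nat) (rho : R),
       (0 < n)%N ->
       ~~ odd k ->
       k%:R = rho * n%:R ->
       2 <= rho <= expR n%:R ->
       exists X : norm_on R n,
         [/\ is_polytope (@unit_ball R (normed_space X)),
             (vertices (@unit_ball R (normed_space X)) #= `I_k)%card &
             (SEP (normed_space X) <= (C * (n%:R / Num.sqrt (ln rho)))%:E)%E]).
Proof.
split.
  exists ((expR 12 * Num.sqrt 8)^-1); split; last first.
    by move=> n X k rho n0 polyX cardV krho; apply: SEP_lower_bound n0 polyX cardV krho.
  by rewrite invr_gt0 mulr_gt0 ?expR_gt0 // sqrtr_gt0.
exists 8000; split; first by rewrite ltr0n.
by move=> n k rho n0 ke krho rhoI; apply: SEP_upper_bound n0 ke krho rhoI.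
Qed.
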